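(* Let $p\in(0,1)$, $q=1-p$, and let $\mu$ be the probability measure on $\mathbb{R}$ with $\mu\{-1/p\}=p$ and $\mu\{1/q\}=q$ (it has zero mean and variance $(pq)^{-1}$). For $n\ge1$ let $\mu^{(n)}(dx)=(\mu\boxplus\cdots\boxplus\mu)\left(\sqrt{\tfrac{n}{pq}}\,dx\right)$ ($n$ copies of $\mu$, $\boxplus$ denoting free additive convolution), and let $\mathcal{F}_n$ be the cumulative distribution function of $\mu^{(n)}$. Let $\Phi$ be the cumulative distribution function of the standard semicircle law. If $p\neq q$, then there exist positive constants $C_1$ and $C_2$ (not depending on $n$) such that $$C_1 n^{-1/2}\le \sup_{x\in\mathbb{R}}\left|\mathcal{F}_n(x)-\Phi(x)\right|\le C_2 n^{-1/2}$$ for every $n\ge 1$.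
   Context: Free additive convolution. For a compactly supported probability measure $\mu$ on $\mathbb{R}$, its Cauchy transform is $G_\mu(z)=\int_{\mathbb{R}}\frac{d\mu(t)}{z-t}$. It is univalent for $|z|$ large, so it has a functional inverse $K_\mu$ (the $K$-function of $\mu$), defined in a punctured neighborhood of $0$: $K_\mu(G_\mu(z))=z$. For compactly supported probability measures $\mu_1,\mu_2$, the free convolution $\mu_1\boxplus\mu_2$ is the unique compactly supported probability measure whose $K$-function is $K_{\mu_1}(z)+K_{\mu_2}(z)-\frac1z$. The notation $\nu(a\,dx)$, $a>0$, denotes the measure $E\mapsto\nu(aE)$. The standard semicircle law is the probability measure with density $\frac{1}{2\pi}\sqrt{4-x^2}\,\chi_{[-2,2]}(x)$, where $\chi_{[-2,2]}$ is the indicator function of $[-2,2]$, and $\Phi$ is its cumulative distribution function. *)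

(* Defs.v *)
From HB Require Import structures.
From mathcomp Require Import all_boot all_order all_algebra.
From mathcomp Require Import complex.
From mathcomp Require Import all_classical all_reals all_analysis.

Set Implicit Arguments.
Unset Strict Implicit.
Unset Printing Implicit Defensive.

Import Order.TTheory GRing.Theory Num.Theory.
Import numFieldNormedType.Exports.

Local Open Scope classical_set_scope.
Local Open Scope ring_scope.
Local Open Scope complex_scope.

Notation realProb R := (probability (measurableTypeR R) R).

Definition compactly_supported (R : realType) (mu : realProb R) : Prop :=
  exists A : set R, compact A /\ mu (~` A) = 0%E.

(* G_mu(z) = \int (z - t)^-1 dmu(t), integrated componentwise since the
   library has no complex-valued integral. *)
Definition cauchy_transform (R : realType) (mu : realProb R) (z : R[i]) : R[i] :=
  (\int[mu]_t complex.Re ((z - t%:C)^-1)) +i*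
  (\int[mu]_t complex.Im ((z - t%:C)^-1)).

(* K is a total function standing for the germ of K_mu at the puncture 0: for
   mu compactly supported, G_mu({|z| > r}) contains a punctured neighborhood of
   0, so two K satisfying this agree near 0. *)
Definition is_K_function (R : realType) (mu : realProb R)
    (K : R[i] -> R[i]) : Prop :=
  exists r : R, forall z : R[i], r%:C < `|z| -> K (cauchy_transform mu z) = z.

Definition is_free_convolution (R : realType)
    (mu1 mu2 nu : realProb R) : Prop :=
  compactly_supported nu /\
  exists K1 K2 K : R[i] -> R[i],
    [/\ is_K_function mu1 K1, is_K_function mu2 K2, is_K_function nu K &
        exists2 e : R, 0 < e &
          forall w : R[i], 0 < `|w| < e%:C -> K w = K1 w + K2 w - w^-1].

(* For compactly supported mu1 and mu2 there is exactly one such nu; otherwise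
   the value is irrelevant. *)
Definition free_convolution (R : realType) (mu1 mu2 : realProb R) : realProb R :=
  get [set nu | is_free_convolution mu1 mu2 nu].

(* n copies of mu, for n >= 1. *)
Definition free_convolution_power (R : realType) (mu : realProb R) (n : nat) :
    realProb R :=
  iter n.-1 (fun nu => free_convolution nu mu) mu.

(* The measure nu(a dx), E |-> nu (a E). *)
Definition rescale (R : realType) (nu : set R -> \bar R) (a : R) :
    set R -> \bar R :=
  fun E => nu [set a * x | x in E].

Definition distribution_function (R : realType) (nu : set R -> \bar R) (x : R) :
    R :=
  fine (nu `]-oo, x]%classic).

Definition semicircle_pdf (R : realType) (x : R) : R :=
  (2 * pi)^-1 * Num.sqrt (4 - x ^+ 2) * \1_`[- 2, 2]%classic x.

Definition semicircle_law (R : realType) (E : set R) : \bar R :=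
  (\int[@lebesgue_measure R]_(x in E) (semicircle_pdf x)%:E)%E.

(* Main.v *)
(* Write v = 1/(pq) and s = 1/p - 1/q. The Cauchy transform G of the n-fold free
   power of mu is given near infinity by
     z = v/xi + (n-1) xi - s,   G(z) = xi / (v - s xi - xi^2):
   the second formula does not involve n, so the additivity of the K-functions
   only changes the parametrization of z. For n >= 2, with m = n - 1,
   kap = sqrt(m p q) and sig = m/kap, the change of variables u = kap xi turns z into
   sig (u + 1/u) - s and, by partial fractions, G into a combination of
   1/(1 - t u) and 1/(1 + r u) with t = q/kap, r = p/kap. Each term is the transform of
   an explicit law on 2 cos th (a density on the arc, plus an atom when the
   parameter exceeds 1) whose Chebyshev moments are the powers of t, resp. -r, so
   the n-fold power is their mixture with weights q and p.
   When t = r = 0 the law is the semicircle law, and the angular density depends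
   on its parameter in a Lipschitz way; as t + r = 1/kap is of order n^(-1/2), this
   gives the upper bound. For the lower bound, the normalized third moment of the
   n-fold power is of order n^(-1/2), whereas that of the semicircle law is 0, and both
   laws live in a fixed compact interval, on which the difference of third moments
   is controlled by the distance of the distribution functions. *)
Require Import Defs.
From HB Require Import structures.
From mathcomp Require Import all_boot all_order all_algebra.
From mathcomp Require Import complex.
From mathcomp Require Import all_classical all_reals all_analysis.
From mathcomp Require Import measurable_realfun ring lra.

Set Implicit Arguments.
Unset Strict Implicit.
Unset Printing Implicit Defensive.

Import Order.TTheory GRing.Theory Num.Theory.
Import numFieldNormedType.Exports.

(** [free_convolution] picks a law by [get], so nothing is known about its value until some law with
    the right K-function is exhibited. The explicit law [fpow] is that witness at each step of the
    induction; since the Cauchy transform near infinity determines a compactly supported law, it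
    also has the distribution function of the free power. The induction carries only the germ of the
    transform, as a parametrized curve ([param]): every inversion amounts to a quadratic equation,
    and no complex analysis enters. The transform of the explicit law comes from finite Chebyshev
    expansions of the resolvent whose remainder tends to 0 uniformly on the support.

    The atoms of the n-fold power lie at distance of order n, too far for the lower bound; but an
    atom is present only for boundedly many n, and so the support has radius of order sqrt(n). The
    upper bound adds three errors: the change of density, the shift by s, and the ratio of the
    dilations sig and sqrt(n/(pq)). *)

Local Open Scope classical_set_scope.
Local Open Scope ring_scope.

(** * Germs at infinity *)

Section Germs.
Variables (C : numClosedFieldType) (v s : C).
Hypothesis v0 : 0 < v.

Definition zpar (m : nat) (xi : C) : C := v / xi + m%:R * xi - s.
Definition wpar (xi : C) : C := xi / (v - s * xi - xi ^+ 2).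

Definition Kgerm (G K : C -> C) : Prop :=
  exists2 r : C, 0 < r & forall z, r < `|z| -> K (G z) = z.

(** Nonvanishing is included because K-functions are compared only on a punctured neighborhood of
    0. *)
Definition decays (G : C -> C) : Prop := forall e, 0 < e ->
  exists2 r : C, 0 < r & forall z, r < `|z| -> 0 < `|G z| < e.

(** Says that the K-function is [zpar m] composed with the inverse of [wpar], without inverting
    anything. The index [m] is the number of factors minus one. *)
Definition param (m : nat) (G : C -> C) : Prop :=
  exists2 e : C, 0 < e & forall xi, 0 < `|xi| < e -> G (zpar m xi) = wpar xi.

(** Both [zpar n xi = z] and [wpar xi = w] are quadratic equations of this form with a large linear
    coefficient. The roots satisfy a x y = v and a x + a y = b; if both had modulus at least e, then
    |a x| and |a y| would be at most v / e, against the size of b. *)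
Lemma small_root (a b e : C) : 0 < e -> 2 * v / e < `|b| ->
  exists2 xi, 0 < `|xi| < e & a * xi ^+ 2 - b * xi + v = 0.
Proof.
move=> e0 hb.
have b0 : b != 0.
  by rewrite -normr_gt0 (lt_trans _ hb)// divr_gt0// mulr_gt0.
have v0n : v != 0 by rewrite gt_eqF.
have nz xi : a * xi ^+ 2 - b * xi + v = 0 -> 0 < `|xi|.
  rewrite normr_gt0; apply: contra_eq_neq => ->.
  by rewrite expr0n/= !mulr0 subr0 add0r.
have vn : `|v| = v by rewrite gtr0_norm.
have [->|a0] := eqVneq a 0.
  exists (v / b); last by rewrite mul0r sub0r mulrC divfK// addNr.
  rewrite normr_gt0 mulf_neq0 ?invr_eq0//= normf_div vn.
  rewrite ltr_pdivrMr ?normr_gt0// mulrC -ltr_pdivrMr//.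
  apply: lt_trans hb.
  by rewrite ltr_pM2r ?invr_gt0// ltr_pMl// ltr1n.
pose d := sqrtC (b ^+ 2 - 4 * a * v).
have d2 : d ^+ 2 = b ^+ 2 - 4 * a * v by rewrite sqrtCK.
pose x := (b - d) / (2 * a); pose y := (b + d) / (2 * a).
have xr : a * x ^+ 2 - b * x + v = 0.
  have -> : a * x ^+ 2 - b * x + v = (d ^+ 2 - (b ^+ 2 - 4 * a * v)) / (4 * a).
    by rewrite /x; field; rewrite a0.
  by rewrite d2 subrr mul0r.
have yr : a * y ^+ 2 - b * y + v = 0.
  have -> : a * y ^+ 2 - b * y + v = (d ^+ 2 - (b ^+ 2 - 4 * a * v)) / (4 * a).
    by rewrite /y; field; rewrite a0.
  by rewrite d2 subrr mul0r.
have xy : a * x * y = v.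
  have -> : a * x * y = (b ^+ 2 - d ^+ 2) / (4 * a).
    by rewrite /x /y; field; rewrite a0.
  by rewrite d2; field; rewrite a0.
have sxy : a * x + a * y = b by rewrite /x /y; field; rewrite a0.
have [xe|ex] := real_ltP (normr_real x) (gtr0_real e0).
  by exists x; rewrite ?xe ?nz.
have [ye|ey] := real_ltP (normr_real y) (gtr0_real e0).
  by exists y; rewrite ?ye ?nz.
exfalso; move: hb; apply/negP; rewrite -real_leNgt ?normr_real//; last first.
  by rewrite gtr0_real// divr_gt0// mulr_gt0.
rewrite -sxy; apply: le_trans (ler_normD _ _) _.
have h1 : `|a * x| <= v / e.
  by rewrite ler_pdivlMr// -[leRHS]vn -xy (normrM _ y) ler_wpM2l.
have h2 : `|a * y| <= v / e.
  by rewrite ler_pdivlMr// -[leRHS]vn -xy mulrAC (normrM _ x) ler_wpM2l.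
by rewrite -mulrA mulr_natl mulr2n lerD.
Qed.

(** Below this radius |s xi + xi^2| < v, so [wpar] has no pole, and n |xi eta| < v, so the cofactor
    of xi - eta in the injectivity proofs does not vanish. *)
Definition rad (n : nat) : C := v / (`|s| + v + 1 + n%:R).

Lemma den_gt0 n : 0 < `|s| + v + 1 + n%:R :> C.
Proof. by rewrite ltr_wpDr ?ler0n// ltr_wpDl// addr_ge0// ltW. Qed.

Lemma rad_gt0 n : 0 < rad n. Proof. by rewrite divr_gt0// den_gt0. Qed.

Lemma rad_le1 n : rad n <= 1.
Proof.
rewrite ler_pdivrMr ?den_gt0// mul1r -!addrA addrCA lerDl.
by rewrite !addr_ge0.
Qed.

Lemma radM n : rad n * (`|s| + v + 1 + n%:R) = v.
Proof. by rewrite /rad divfK// gt_eqF// den_gt0. Qed.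

Lemma wpar_den xi : `|xi| < rad 0 -> v - s * xi - xi ^+ 2 != 0.
Proof.
move=> hx; apply/eqP => h.
have : `|s * xi + xi ^+ 2| = v.
  by rewrite -[RHS](gtr0_norm v0); congr (`|_|); rewrite -[LHS]addr0 -h; ring.
apply/eqP; rewrite lt_eqF//.
apply: le_lt_trans (ler_normD _ _) _; rewrite !normrM.
rewrite -mulrDl -(radM 0) addr0 mulrC.
rewrite (le_lt_trans (y := `|xi| * (`|s| + v + 1)))//.
  rewrite ler_wpM2l// -addrA lerD2l.
  by rewrite (le_trans (ltW hx))// (le_trans (rad_le1 0))// lerDr ltW.
by rewrite ltr_pM2r//; have := den_gt0 0; rewrite addr0.
Qed.

Lemma rad_prod n xi eta : `|xi| < rad n -> `|eta| < rad n ->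
  v != n%:R * (xi * eta).
Proof.
move=> hx he; apply/eqP => h.
suff : `|n%:R * (xi * eta)| < v by rewrite -h gtr0_norm// ltxx.
rewrite !normrM normr_nat.
have : `|xi| * `|eta| <= rad n.
  rewrite -[rad n]mulr1 ler_pM// ?(ltW hx)//.
  exact: le_trans (ltW he) (rad_le1 n).
move=> /(ler_wpM2l (ler0n C n)) /le_lt_trans; apply.
rewrite -[ltRHS](radM n) mulrC ltr_pM2l ?rad_gt0//.
by rewrite ltrDr; have := den_gt0 0; rewrite addr0.
Qed.

Lemma rad_anti n : rad n <= rad 0.
Proof.
by rewrite /rad ler_pM2l// lef_pV2 ?posrE ?den_gt0// lerD2l ler0n.
Qed.

Lemma wpar_inj xi eta : `|xi| < rad 1 -> `|eta| < rad 1 ->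
  wpar xi = wpar eta -> xi = eta.
Proof.
move=> hx he.
have dx := wpar_den (lt_le_trans hx (rad_anti 1)).
have de := wpar_den (lt_le_trans he (rad_anti 1)).
move=> /eqP; rewrite eqr_div// => /eqP h.
have /eqP : (xi - eta) * (v + 1%:R * (xi * eta)) = 0.
  transitivity (xi * (v - s * eta - eta ^+ 2) - eta * (v - s * xi - xi ^+ 2)).
    by ring.
  by rewrite h subrr.
rewrite mulf_eq0 subr_eq0 addr_eq0 -mulrN -mulrN => /orP[/eqP//|/eqP hv].
by have := @rad_prod 1 xi (- eta); rewrite normrN -hv eqxx => /(_ hx he).
Qed.

Lemma zpar_inj n xi eta : 0 < `|xi| < rad n -> 0 < `|eta| < rad n ->
  zpar n xi = zpar n eta -> xi = eta.
Proof.
rewrite !normr_gt0 => /andP[x0 hx] /andP[e0 he] h.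
have /eqP : (xi - eta) * (v - n%:R * (xi * eta)) = 0.
  transitivity ((zpar n eta - zpar n xi) * (xi * eta)).
    by rewrite /zpar; field; rewrite x0.
  by rewrite h subrr mul0r.
by rewrite mulf_eq0 !subr_eq0 (negbTE (rad_prod hx he)) orbF => /eqP.
Qed.

Lemma zpar_surj n e : 0 < e -> exists2 r, 0 < r &
  forall z, r < `|z| -> exists2 xi, 0 < `|xi| < e & zpar n xi = z.
Proof.
move=> e0; exists (`|s| + 2 * v / e).
  by rewrite ltr_wpDl// divr_gt0// mulr_gt0.
move=> z hz.
have [|xi hxi h] := @small_root n%:R (z + s) e e0.
  rewrite -(ltrD2l (`|s|)) (lt_le_trans hz)//.
  by rewrite -{1}(addrK s z) (le_trans (ler_normB _ _))// addrC.
exists xi => //; case/andP: hxi; rewrite normr_gt0 => x0 _.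
apply/eqP; rewrite -subr_eq0 -(mulIr_eq0 _ (mulIf x0)).
by rewrite -h /zpar; apply/eqP; field; rewrite x0.
Qed.

Lemma wpar_surj e : 0 < e -> exists2 d, 0 < d &
  forall w, 0 < `|w| < d -> exists2 xi, 0 < `|xi| < e & wpar xi = w.
Proof.
move=> e0.
(* [C] is only partially ordered; product over sum serves as a minimum of two positive numbers, here
   and below. *)
pose e' := e * rad 0 / (e + rad 0).
have r00 := rad_gt0 0; have er0 : 0 < e + rad 0 by rewrite addr_gt0.
have e'0 : 0 < e' by rewrite divr_gt0// mulr_gt0.
have e'e : e' <= e.
  by rewrite ler_pdivrMr// ler_wpM2l ?ltW// ltrDr.
have e'r : e' <= rad 0.
  by rewrite ler_pdivrMr// mulrC ler_wpM2l ?ltW// ltrDl.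
have b0 : 0 < `|s| + 2 * v / e' by rewrite ltr_wpDl// divr_gt0// mulr_gt0.
exists (`|s| + 2 * v / e')^-1; first by rewrite invr_gt0.
move=> w /andP[w0 hw]; have wn : w != 0 by rewrite -normr_gt0.
have [|xi hxi h] := @small_root (-1) (w^-1 + s) e' e'0.
  rewrite -(ltrD2l (`|s|)) (lt_le_trans (y := `|w^-1|))//.
    by rewrite normfV -(invrK (_ + _)) ltf_pV2// posrE ?invr_gt0.
  by rewrite -{1}(addrK s w^-1) (le_trans (ler_normB _ _))// addrC.
exists xi; first by case/andP: hxi => -> /lt_le_trans ->.
case/andP: hxi => _ hx; have /wpar_den dx := lt_le_trans hx e'r.
apply: (mulIf dx); rewrite /wpar divfK//; apply/esym/eqP; rewrite -subr_eq0.
have -> : w * (v - s * xi - xi ^+ 2) - xi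
  = w * (-1 * xi ^+ 2 - (w^-1 + s) * xi + v) by field.
by rewrite h mulr0.
Qed.

Lemma zpar_large n r : 0 < r -> exists2 e, 0 < e &
  forall xi, 0 < `|xi| < e -> r < `|zpar n xi|.
Proof.
move=> r0; pose b := v + n%:R + `|s| + r.
have b0 : 0 < b by rewrite !(ltr_wpDr, addr_gt0)// ltW.
exists (v / b); first by rewrite divr_gt0.
move=> xi /andP[x0 hx].
have x1 : `|xi| <= 1.
  rewrite (le_trans (ltW hx))// ler_pdivrMr// mul1r /b -!addrA lerDl.
  by rewrite !addr_ge0// ltW.
have hb : b < `|v / xi|.
  rewrite normf_div (gtr0_norm v0) ltr_pdivlMr//.
  by rewrite mulrC -ltr_pdivlMr.
have : `|v / xi| <= `|zpar n xi| + (n%:R + `|s|).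
  have -> : v / xi = zpar n xi - (n%:R * xi - s) by rewrite /zpar; ring.
  apply: le_trans (ler_normB _ _) _; rewrite lerD2l.
  apply: le_trans (ler_normB _ _) _; rewrite lerD2r normrM normr_nat.
  by rewrite ler_piMr.
move=> /(lt_le_trans hb); rewrite (addrC _ (_ + _)).
have -> : b = n%:R + `|s| + (v + r) by rewrite /b; ring.
rewrite ltrD2l.
by apply: le_lt_trans; rewrite lerDr ltW.
Qed.

Lemma wpar_small e : 0 < e -> exists2 d, 0 < d &
  forall xi, 0 < `|xi| < d -> 0 < `|wpar xi| < e.
Proof.
move=> e0; pose b := 1 + e * (`|s| + 1).
have b0 : 0 < b by rewrite ltr_wpDr// mulr_ge0// ?addr_ge0// ltW.
pose d := rad 0 * (e * v / b) / (rad 0 + e * v / b).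
have q0 : 0 < e * v / b by rewrite divr_gt0// mulr_gt0.
have r00 := rad_gt0 0; have rq0 : 0 < rad 0 + e * v / b by rewrite addr_gt0.
have d0 : 0 < d by rewrite divr_gt0// mulr_gt0.
have dr : d <= rad 0 by rewrite ler_pdivrMr// ler_wpM2l ?ltW// ltrDr.
have dq : d <= e * v / b.
  by rewrite ler_pdivrMr// mulrC ler_wpM2l ?ltW// ltrDl.
exists d => // xi /andP[x0 hx].
have dx := wpar_den (lt_le_trans hx dr).
have x1 : `|xi| <= 1 := le_trans (ltW (lt_le_trans hx dr)) (rad_le1 0).
rewrite /wpar normf_div; have n0 : 0 < `|v - s * xi - xi ^+ 2| by rewrite normr_gt0.
rewrite divr_gt0//= ltr_pdivrMr//.
have : `|v| <= `|v - s * xi - xi ^+ 2| + `|xi| * (`|s| + 1).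
  have -> : `|v| = `|(v - s * xi - xi ^+ 2) + (s * xi + xi ^+ 2)|.
    by congr (`|_|); ring.
  apply: le_trans (ler_normD _ _) _; rewrite lerD2l.
  apply: le_trans (ler_normD _ _) _; rewrite !normrM mulrDr mulr1.
  by rewrite mulrC lerD2l ler_piMr.
rewrite (gtr0_norm v0) -(ler_pM2l e0) => hv.
have : `|xi| * b < e * v by rewrite -ltr_pdivlMr// (lt_le_trans hx).
move=> /lt_le_trans /(_ hv); have -> : `|xi| * b = `|xi| + e * (`|xi| * (`|s| + 1)) by rewrite /b; ring.
by rewrite (mulrDr e) ltrD2r.
Qed.

(** The rule for K-functions of a free convolution, read along the curve w = [wpar xi]: one more
    factor adds [zpar 0 xi] and subtracts 1/w. *)
Lemma zparS m xi : xi != 0 -> zpar m.+1 xi = zpar m xi + zpar 0 xi - (wpar xi)^-1.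
Proof. by move=> x0; rewrite /wpar /zpar invf_div -[m.+1]addn1 natrD; field. Qed.

(* The inverse of [wpar] near 0, so that [zpar m \o wroot] is a K-function. *)
Definition wroot (w : C) : C :=
  xget 0 [set xi : C | `|xi| < rad 1 /\ wpar xi = w]%classic.

Lemma wrootK xi : `|xi| < rad 1 -> wroot (wpar xi) = xi.
Proof.
move=> hx; apply: xget_unique => //= y [hy /wpar_inj]; exact.
Qed.

Lemma param_Kgerm m G : param m G -> Kgerm G (zpar m \o wroot).
Proof.
move=> [e e0 pe]; pose e' := e * rad 1 / (e + rad 1).
have r0 := rad_gt0 1; have er0 : 0 < e + rad 1 by rewrite addr_gt0.
have e'0 : 0 < e' by rewrite divr_gt0// mulr_gt0.
have e'e : e' <= e.
  by rewrite ler_pdivrMr// ler_wpM2l ?ltW// ltrDr.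
have e'r : e' <= rad 1.
  by rewrite ler_pdivrMr// mulrC ler_wpM2l ?ltW// ltrDl.
have [r rgt0 hr] := zpar_surj m e'0.
exists r => // z /hr[xi /andP[x0 xe] <-] /=.
by rewrite pe ?x0 ?(lt_le_trans xe)// wrootK// (lt_le_trans xe).
Qed.

Lemma wroot_zparS m : exists2 e, 0 < e & forall w, 0 < `|w| < e ->
  zpar m.+1 (wroot w) = zpar m (wroot w) + zpar 0 (wroot w) - w^-1.
Proof.
have [d d0 hd] := wpar_surj (rad_gt0 1).
exists d => // w /hd[xi /andP[]]; rewrite normr_gt0 => x0 xr <-.
by rewrite wrootK// zparS.
Qed.

(** The additivity of K-functions gives [K' (wpar xi) = zpar m.+1 xi], but [K'] is only a left
    inverse of [G']. For z = [zpar m.+1 xi] the value [G' z] is small by decay, hence equals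
    [wpar eta] for a small eta; applying [K'] gives [zpar m.+1 eta = z], and injectivity of [zpar]
    forces eta = xi. *)
Lemma param_step m (G G1 G' K K1 K' : C -> C) (e : C) :
  param m G -> param 0 G1 -> Kgerm G K -> Kgerm G1 K1 -> Kgerm G' K' ->
  0 < e -> (forall w, 0 < `|w| < e -> K' w = K w + K1 w - w^-1) ->
  decays G' -> param m.+1 G'.
Proof.
move=> [e1 e10 p1] [e2 e20 p2] [r1 r10 k1] [r2 r20 k2] [r3 r30 k3] e0 kk dec.
have [a1 a10 z1] := zpar_large m r10.
have [a2 a20 z2] := zpar_large 0 r20.
have [a3 a30 w3] := wpar_small e0.
pose min2 (x y : C) := x * y / (x + y).
have min2P x y : 0 < x -> 0 < y -> [/\ 0 < min2 x y, min2 x y <= x & min2 x y <= y].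
  move=> x0 y0; have xy0 : 0 < x + y by rewrite addr_gt0.
  split; first by rewrite divr_gt0// mulr_gt0.
    by rewrite ler_pdivrMr// ler_wpM2l ?ltW// ltrDr.
  by rewrite ler_pdivrMr// mulrC ler_wpM2l ?ltW// ltrDl.
have [b1 b10 [c11 c12]] : exists2 b, 0 < b & b <= e1 /\ b <= e2.
  by have [? ? ?] := min2P _ _ e10 e20; exists (min2 e1 e2).
have [b2 b20 [c21 c22]] : exists2 b, 0 < b & b <= a1 /\ b <= a2.
  by have [? ? ?] := min2P _ _ a10 a20; exists (min2 a1 a2).
have [b3 b30 [c31 c32]] : exists2 b, 0 < b & b <= a3 /\ b <= rad m.+1.
  by have [? ? ?] := min2P _ _ a30 (rad_gt0 m.+1); exists (min2 a3 (rad m.+1)).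
have [b4 b40 [c41 c42]] : exists2 b, 0 < b & b <= b1 /\ b <= b2.
  by have [? ? ?] := min2P _ _ b10 b20; exists (min2 b1 b2).
have [b b0 [d1 d2]] : exists2 b, 0 < b & b <= b4 /\ b <= b3.
  by have [? ? ?] := min2P _ _ b40 b30; exists (min2 b4 b3).
have key xi : 0 < `|xi| < b -> K' (wpar xi) = zpar m.+1 xi.
  case/andP=> x0 xb; have xn0 : xi != 0 by rewrite -normr_gt0.
  have s4 := lt_le_trans xb d1; have s3 := lt_le_trans xb d2.
  have s1 := lt_le_trans s4 c41; have s2 := lt_le_trans s4 c42.
  rewrite kk; last by apply: w3; rewrite x0 (lt_le_trans s3).
  rewrite -{1}p1 ?x0 ?(lt_le_trans s1)// -{1}p2 ?x0 ?(lt_le_trans s1)//.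
  rewrite k1; last by apply: z1; rewrite x0 (lt_le_trans s2).
  rewrite k2; last by apply: z2; rewrite x0 (lt_le_trans s2).
  by rewrite -zparS.
have [d d0 wd] := wpar_surj b0.
have [r r0 hr] := dec d d0.
have [f1 f10 z4] := zpar_large m.+1 r0.
have [f2 f20 z5] := zpar_large m.+1 r30.
have [f f0 [g1 g2]] : exists2 f, 0 < f & f <= f1 /\ f <= f2.
  by have [? ? ?] := min2P _ _ f10 f20; exists (min2 f1 f2).
have [h h0 [h1 h2]] : exists2 h, 0 < h & h <= b /\ h <= f.
  by have [? ? ?] := min2P _ _ b0 f0; exists (min2 b f).
exists h => // xi /andP[x0 hx].
have xb := lt_le_trans hx h1; have xf := lt_le_trans hx h2.
have := hr (zpar m.+1 xi) (z4 _ _); rewrite x0 (lt_le_trans xf)// => /(_ isT).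
move=> /wd[eta /andP[et0 etb] etE].
suff xe : xi = eta by rewrite -etE xe.
have le_rad y : `|y| < b -> `|y| < rad m.+1.
  by move=> ?; rewrite (lt_le_trans _ c32)// (lt_le_trans _ d2).
apply: (@zpar_inj m.+1); rewrite ?x0 ?et0 ?le_rad//.
rewrite -[RHS]key ?et0// etE k3//.
by apply: z5; rewrite x0 (lt_le_trans xf).
Qed.

End Germs.

(** * Cauchy transforms of compactly supported laws *)

(** Inversion is written as f times |f|^(-2), a real power; both sides vanish where f does. *)
Lemma measurable_funV (R : realType) (f : R -> R) :
  measurable_fun setT f -> measurable_fun setT (fun x => (f x)^-1).
Proof.
move=> mf; rewrite (_ : (fun x => _) = fun x => f x * `|f x| `^ (- 2)).
  apply: measurable_funM => //.
  by apply: (measurableT_comp (measurable_powR _)); exact: measurableT_comp.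
apply/funext => x; have [->|f0] := eqVneq (f x) 0; first by rewrite invr0 mul0r.
rewrite powRN powR_mulrn// real_normK ?num_real//.
by rewrite expr2 invfM mulrA divff// mul1r.
Qed.

Definition supp_in (R : realType) (nu : set R -> \bar R) (M : R) : Prop :=
  nu (~` `[- M, M]) = 0%E.

Lemma compactly_supportedP (R : realType) (nu : realProb R) :
  compactly_supported nu <-> exists2 M, 0 < M & supp_in nu M.
Proof.
split=> [[A [cA nuA]]|[M M0 hM]]; last first.
  by exists `[- M, M]%classic; split => //; exact: segment_compact.
have [B [_ hB]] := compact_bounded cA.
pose M := `|B| + 1; exists M; first by rewrite ltr_wpDl.
apply/eqP; rewrite -measure_le0 -nuA; apply: le_measure; rewrite ?inE//.
- by apply: measurableC; exact: measurable_itv.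
- by apply: measurableC; exact: compact_measurable.
- apply: subsetC => x Ax /=; rewrite in_itv/= -ler_norml.
  by apply: hB => //; rewrite /M (le_lt_trans (ler_norm B))// ltrDl.
Qed.

Section Supported.
Context (R : realType) (nu : realProb R) (M : R).
Hypothesis nuM : supp_in nu M.

Lemma supp_integrable (f : R -> R) c : measurable_fun setT f ->
  (forall x, `|x| <= M -> `|f x| <= c) -> nu.-integrable setT (EFin \o f).
Proof.
move=> mf fc; apply/integrableP; split; first exact/measurable_EFinP.
apply: (@le_lt_trans _ _ (\int[nu]_x (`|c|)%:E)%E); last first.
  by rewrite integral_cst//= probability_setT mule1 ltry.
apply: ae_ge0_le_integral => //.
- by apply: measurableT_comp => //; exact/measurable_EFinP.
- exists (~` `[- M, M]%classic); split => //.
    by apply: measurableC; exact: measurable_itv.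
  move=> x /= h; rewrite in_itv/= -ler_norml => xM; apply: h => _ /=.
  by rewrite lee_fin (le_trans (fc x xM))// ler_norm.
Qed.

Lemma supp_Rintegral (f : R -> R) : nu.-integrable setT (EFin \o f) ->
  \int[nu]_x f x = \int[nu]_(x in `[- M, M]) f x.
Proof.
move=> fi; rewrite /Rintegral.
rewrite (@negligible_integral _ _ _ nu setT (~` `[- M, M]%classic))//.
  by rewrite setTD setCK.
by apply: measurableC; exact: measurable_itv.
Qed.

Lemma supp_le_Rintegral (f g : R -> R) :
  nu.-integrable setT (EFin \o f) -> nu.-integrable setT (EFin \o g) ->
  (forall x, `|x| <= M -> f x <= g x) -> \int[nu]_x f x <= \int[nu]_x g x.
Proof.
move=> fi gi fg; rewrite !supp_Rintegral//.
have mM : measurable (`[- M, M]%classic : set (measurableTypeR R)).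
  exact: measurable_itv.
apply: le_Rintegral => //.
- exact: integrableS fi.
- exact: integrableS gi.
- by move=> x /=; rewrite in_itv/= -ler_norml => /fg.
Qed.

Lemma supp_eq_Rintegral (f g : R -> R) :
  nu.-integrable setT (EFin \o f) -> nu.-integrable setT (EFin \o g) ->
  (forall x, `|x| <= M -> f x = g x) -> \int[nu]_x f x = \int[nu]_x g x.
Proof.
move=> fi gi fg; apply: le_anti.
by rewrite !supp_le_Rintegral// => x /fg ->.
Qed.

Lemma prob_integrable_cst c : nu.-integrable setT (EFin \o cst c : R -> \bar R).
Proof. exact: finite_measure_integrable_cst. Qed.

Lemma prob_Rintegral_cst (c : R) : \int[nu]_x c = c.
Proof. by rewrite Rintegral_cst//= probability_setT/= mulr1. Qed.

Lemma supp_Rintegral_bound (f : R -> R) c : measurable_fun setT f ->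
  (forall x, `|x| <= M -> `|f x| <= c) -> `|\int[nu]_x f x| <= c.
Proof.
move=> mf fc; have fi := supp_integrable mf fc.
apply: le_trans (le_normr_Rintegral _ fi) _ => //.
rewrite -[leRHS]prob_Rintegral_cst; apply: supp_le_Rintegral.
- apply: (@supp_integrable _ c); first exact: measurableT_comp.
  by move=> x /fc; rewrite normr_id.
- exact: prob_integrable_cst.
- exact: fc.
Qed.

End Supported.

Lemma normCE (R : rcfType) (z : R[i]) : `|z| = (Normc.normc z)%:C%C.
Proof. by []. Qed.

(** * Size and decay of the Cauchy transform *)

Section Cauchy.
Context (R : realType).
Local Notation C := (R[i]).
Local Notation nm := (@Normc.normc R).

Lemma Re_inv (z : C) (t : R) : complex.Re ((z - t%:C%C)^-1) =
  (complex.Re z - t) * ((complex.Re z - t) ^+ 2 + complex.Im z ^+ 2)^-1.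
Proof. by case: z => a b /=; rewrite subr0. Qed.

Lemma Im_inv (z : C) (t : R) : complex.Im ((z - t%:C%C)^-1) =
  - complex.Im z * ((complex.Re z - t) ^+ 2 + complex.Im z ^+ 2)^-1.
Proof. by case: z => a b /=; rewrite subr0 mulNr. Qed.

Lemma measurable_Re_inv (z : C) :
  measurable_fun setT (fun t : R => complex.Re ((z - t%:C%C)^-1)).
Proof.
rewrite (_ : (fun t => _) = fun t => (complex.Re z - t) *
   ((complex.Re z - t) ^+ 2 + complex.Im z ^+ 2)^-1); last first.
  by apply/funext => t; rewrite Re_inv.
have m1 : measurable_fun setT (fun t : R => complex.Re z - t).
  by apply: measurable_funB => //.
apply: measurable_funM => //; apply: measurable_funV.
by apply: measurable_funD => //; exact: measurable_funX.
Qed.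

Lemma measurable_Im_inv (z : C) :
  measurable_fun setT (fun t : R => complex.Im ((z - t%:C%C)^-1)).
Proof.
rewrite (_ : (fun t => _) = fun t => - complex.Im z *
   ((complex.Re z - t) ^+ 2 + complex.Im z ^+ 2)^-1); last first.
  by apply/funext => t; rewrite Im_inv.
have m1 : measurable_fun setT (fun t : R => complex.Re z - t).
  by apply: measurable_funB => //.
apply: measurable_funM => //; apply: measurable_funV.
by apply: measurable_funD => //; exact: measurable_funX.
Qed.

Lemma Re_le_nm (z : C) : `|complex.Re z| <= nm z.
Proof.
case: z => a b /=; rewrite -sqrtr_sqr ler_wsqrtr// lerDl.
exact: sqr_ge0.
Qed.

Lemma Im_le_nm (z : C) : `|complex.Im z| <= nm z.
Proof.
case: z => a b /=; rewrite -sqrtr_sqr ler_wsqrtr// lerDr.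
exact: sqr_ge0.
Qed.

Lemma nm_le (z : C) : nm z <= `|complex.Re z| + `|complex.Im z|.
Proof.
case: z => a b /=; rewrite -(ler_pXn2r (n := 2)) ?nnegrE ?sqrtr_ge0 ?addr_ge0//.
rewrite sqr_sqrtr ?addr_ge0 ?sqr_ge0//.
rewrite sqrrD !real_normK ?num_real//.
by rewrite addrAC lerDl mulrn_wge0// mulr_ge0.
Qed.

Lemma nm_ge0 (z : C) : 0 <= nm z.
Proof. exact: le_trans (normr_ge0 _) (Re_le_nm z). Qed.

Lemma nm_real (x : R) : nm x%:C%C = `|x|.
Proof. by rewrite /= expr0n addr0 sqrtr_sqr. Qed.

Lemma nmB_ge (z : C) (t M : R) : `|t| <= M -> nm z - M <= nm (z - t%:C%C).
Proof.
move=> tM; rewrite lerBlDr -{1}(subrK t%:C%C z).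
by rewrite (le_trans (complex.le_normcD _ _))// lerD2l nm_real.
Qed.

Context (nu : realProb R) (M : R).
Hypotheses (M0 : 0 < M) (nuM : supp_in nu M).

Lemma nm_inv_le (z : C) (t : R) : M < nm z -> `|t| <= M ->
  nm (z - t%:C%C)^-1 <= (nm z - M)^-1.
Proof.
move=> Mz tM; rewrite Normc.normcV.
have d : 0 < nm z - M by rewrite subr_gt0.
by rewrite lef_pV2 ?posrE ?(lt_le_trans d)// nmB_ge.
Qed.

Lemma integrable_Re_inv (z : C) : M < nm z ->
  nu.-integrable setT (fun t => (complex.Re ((z - t%:C%C)^-1))%:E).
Proof.
move=> Mz; apply: (supp_integrable nuM (c := (nm z - M)^-1)).
  exact: measurable_Re_inv.
by move=> x xM; rewrite (le_trans (Re_le_nm _))// nm_inv_le.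
Qed.

Lemma integrable_Im_inv (z : C) : M < nm z ->
  nu.-integrable setT (fun t => (complex.Im ((z - t%:C%C)^-1))%:E).
Proof.
move=> Mz; apply: (supp_integrable nuM (c := (nm z - M)^-1)).
  exact: measurable_Im_inv.
by move=> x xM; rewrite (le_trans (Im_le_nm _))// nm_inv_le.
Qed.

Lemma cauchy_bound (z : C) : M < nm z ->
  nm (cauchy_transform nu z) <= 2 * (nm z - M)^-1.
Proof.
move=> Mz; apply: le_trans (nm_le _) _; rewrite mulr_natl mulr2n /=.
apply: lerD; apply: (supp_Rintegral_bound nuM).
- exact: measurable_Re_inv.
- by move=> x xM; rewrite (le_trans (Re_le_nm _))// nm_inv_le.
- exact: measurable_Im_inv.
- by move=> x xM; rewrite (le_trans (Im_le_nm _))// nm_inv_le.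
Qed.

Lemma Re_mul (z w : C) :
  complex.Re (z * w) = complex.Re z * complex.Re w - complex.Im z * complex.Im w.
Proof. by case: z w => ? ? []. Qed.

Lemma ReD (z w : C) : complex.Re (z + w) = complex.Re z + complex.Re w.
Proof. by case: z w => ? ? []. Qed.

(* [Re (z / (z - t))] is at least [1/2] on the support. *)
Lemma cauchy_neq0 (z : C) : 3 * M < nm z -> cauchy_transform nu z != 0.
Proof.
move=> Mz; have Mz1 : M < nm z by move: M0 Mz; lra.
suff : 2^-1 <= complex.Re (z * cauchy_transform nu z).
  apply: contraTneq => ->; rewrite mulr0/= -ltNge.
  by rewrite invr_gt0.
have iR := integrable_Re_inv Mz1; have iI := integrable_Im_inv Mz1.
rewrite Re_mul /= -RintegralZl// -RintegralZl//.
have iRz : nu.-integrable setT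
  (EFin \o (fun t => complex.Re z * complex.Re ((z - t%:C%C)^-1))).
  exact: (integrableZl measurableT (complex.Re z) iR).
have iIz : nu.-integrable setT
  (EFin \o (fun t => complex.Im z * complex.Im ((z - t%:C%C)^-1))).
  exact: (integrableZl measurableT (complex.Im z) iI).
rewrite -RintegralB//.
rewrite -[leLHS](prob_Rintegral_cst nu); apply: (supp_le_Rintegral nuM).
- exact: prob_integrable_cst.
- exact: (integrableB measurableT iRz iIz).
move=> t tM; rewrite -Re_mul.
have zt : z - t%:C%C != 0.
  rewrite -normr_gt0 normCE ltcR (lt_le_trans _ (nmB_ge z tM))//.
  by rewrite subr_gt0.
have -> : z * (z - t%:C%C)^-1 = 1 + t%:C%C / (z - t%:C%C).
  by field.
rewrite ReD /= -lerBlDl.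
have : `|complex.Re (t%:C%C / (z - t%:C%C))| <= 2^-1.
  rewrite (le_trans (Re_le_nm _))// Normc.normcM nm_real.
  rewrite (le_trans (y := M * (nm z - M)^-1))//.
    by rewrite ler_pM// ?nm_ge0// nm_inv_le.
  rewrite ler_pdivrMr ?subr_gt0// -ler_pdivrMl ?invr_gt0// invrK.
  lra.
rewrite ler_norml => /andP[h _].
by apply: le_trans h; lra.
Qed.

Lemma cauchy_decays : decays (cauchy_transform nu).
Proof.
move=> e e0; pose e' := complex.Re e.
have eE : e = e'%:C%C.
  by rewrite RRe_real// gtr0_real.
have e'0 : 0 < e' by move: e0; rewrite eE ltcR.
(* The term 3M is for [cauchy_neq0]; the rest makes the bound 2 / (|z| - M) smaller than e. *)
pose r := 3 * M + 2 / e'.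
have q0 : 0 < 2 / e' by rewrite divr_gt0.
have r0 : 0 < r by rewrite addr_gt0// mulr_gt0.
exists r%:C%C; first by rewrite ltcR.
move=> z; rewrite normCE ltcR => rz.
have h1 : 3 * M < nm z by rewrite (lt_trans _ rz)// ltrDl.
have h2 : M < nm z by move: M0 h1; lra.
rewrite normr_gt0 cauchy_neq0//= normCE eE ltcR.
apply: le_lt_trans (cauchy_bound h2) _.
rewrite ltr_pdivrMr ?subr_gt0// mulrC -ltr_pdivrMr//.
by move: rz M0; rewrite /r; move: (2 / e') (nm z) => x y; lra.
Qed.

End Cauchy.

Lemma is_K_functionP (R : realType) (nu : realProb R) (K : R[i] -> R[i]) :
  is_K_function nu K <-> Kgerm (cauchy_transform nu) K.
Proof.
split=> [[r hr]|[r r0 hr]].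
  exists (`|r| + 1)%:C%C; first by rewrite ltcR ltr_wpDl.
  move=> z hz; apply: hr; apply: lt_trans hz.
  by rewrite ltcR (le_lt_trans (ler_norm r))// ltrDl.
exists (complex.Re r) => z; rewrite RRe_real ?gtr0_real//; exact: hr.
Qed.

(** * The Cauchy transform determines the law *)

Section StepPolynomials.
Variable R : realType.

Lemma bernoulli_ge (a : R) n : 0 <= a -> 1 + n%:R * a <= (1 + a) ^+ n.
Proof.
move=> a0; elim: n => [|n IH]; first by rewrite mul0r addr0 expr0.
rewrite exprS (le_trans (y := (1 + a) * (1 + n%:R * a)))//; last first.
  by rewrite ler_pM2l// ltr_wpDr.
rewrite -[n.+1]addn1 natrD -subr_ge0.
have -> : (1 + a) * (1 + n%:R * a) - (1 + (n%:R + 1) * a) = n%:R * a ^+ 2 by ring.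
by rewrite mulr_ge0// sqr_ge0.
Qed.

Lemma bernoulli_le (a : R) n : 0 <= a <= 1 -> 1 - n%:R * a <= (1 - a) ^+ n.
Proof.
move=> /andP[a0 a1]; elim: n => [|n IH]; first by rewrite mul0r subr0 expr0.
rewrite exprS (le_trans (y := (1 - a) * (1 - n%:R * a)))//; last first.
  by rewrite ler_wpM2l// subr_ge0.
rewrite -[n.+1]addn1 natrD -subr_ge0.
have -> : (1 - a) * (1 - n%:R * a) - (1 - (n%:R + 1) * a) = n%:R * a ^+ 2 by ring.
by rewrite mulr_ge0// sqr_ge0.
Qed.

(* Tends to the indicator of [0, 1/2[ on [0, 1] away from 1/2. *)
Definition stepn (n : nat) (y : R) : R := (1 - y ^+ n) ^+ (n * 2 ^ n).

Lemma stepn_itv n y : 0 <= y <= 1 -> 0 <= stepn n y <= 1.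
Proof.
move=> /andP[y0 y1]; have h : 0 <= 1 - y ^+ n <= 1.
  by rewrite subr_ge0 exprn_ile1//= gerBl exprn_ge0.
by rewrite /stepn exprn_ge0 ?exprn_ile1//; case/andP: h.
Qed.

(** Multiplied by (1 + y^n)^(n 2^n), [stepn n y] stays at most 1, while that factor is at least 1 +
    n (2y)^n by Bernoulli. The factor n in the exponent brings the limit at y = 1/2 down to 0 as
    well, so that an atom at the jump does no harm in [eq_cdf]. *)
Lemma stepn_ge_half n y : 2^-1 <= y <= 1 -> stepn n y <= n.+1%:R^-1.
Proof.
move=> /andP[y2 y1]; have y0 : 0 <= y by rewrite (le_trans _ y2)// invr_ge0.
have yn0 : 0 <= y ^+ n by rewrite exprn_ge0.
have h1 : stepn n y * (1 + y ^+ n) ^+ (n * 2 ^ n) <= 1.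
  rewrite /stepn -exprMn exprn_ile1//.
    by apply: mulr_ge0; [rewrite subr_ge0 exprn_ile1|rewrite addr_ge0].
  by rewrite -subr_sqr expr1n gerBl sqr_ge0.
have h2 : n.+1%:R <= (1 + y ^+ n) ^+ (n * 2 ^ n).
  apply: le_trans (bernoulli_ge _ yn0).
  rewrite natrM natrX -mulrA -exprMn -[n.+1]add1n natrD lerD2l.
  rewrite -[leLHS]mulr1 ler_wpM2l// exprn_ege1//.
  by rewrite -ler_pdivrMl// mulr1.
have /andP[s0 _] : 0 <= stepn n y <= 1 by apply: stepn_itv; rewrite y0.
rewrite -[_^-1]mul1r ler_pdivlMr ?ltr0n//.
by apply: le_trans h1; rewrite ler_wpM2l.
Qed.

Lemma stepn_lt_half y : 0 <= y < 2^-1 -> stepn n y @[n --> \oo] --> (1 : R).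
Proof.
move=> /andP[y0 y2].
have y1 : y <= 1 by rewrite (le_trans (ltW y2))// invf_le1// ler1n.
(* With (2y)^n = w^n w^n, one factor absorbs n and the other still tends to 0. *)
pose w := Num.sqrt (2 * y).
have w0 : 0 <= w by rewrite sqrtr_ge0.
have w2 : w ^+ 2 = 2 * y by rewrite sqr_sqrtr// mulr_ge0.
have w1 : w < 1.
  rewrite -(@ltr_pXn2r _ 2)// ?nnegrE// w2 expr1n -ltr_pdivlMl//.
  by rewrite mulr1.
have d0 : 0 < 1 - w by rewrite subr_gt0.
(* [n w^(2n) <= w^n / (1 - w)], from [n (1 - w) w^n <= 1] *)
have nw n : n%:R * (2 * y) ^+ n <= (1 - w)^-1 * w ^+ n.
  rewrite -w2 -exprM mulnC exprM expr2 mulrA ler_wpM2r ?exprn_ge0//.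
  rewrite -[leRHS]mul1r ler_pdivlMr//.
  have h := bernoulli_ge n (ltW d0).
  have h3 : (1 + (1 - w)) ^+ n * w ^+ n <= 1.
    rewrite -exprMn exprn_ile1//; first by rewrite mulr_ge0// addr_ge0// ltW.
    have -> : (1 + (1 - w)) * w = 1 - (1 - w) ^+ 2 by ring.
    by rewrite gerBl sqr_ge0.
  apply: le_trans h3; rewrite mulrAC ler_wpM2r ?exprn_ge0//.
  by apply: le_trans h; rewrite lerDr.
apply: (@squeeze_cvgr _ _ _ _ (fun n => 1 - (1 - w)^-1 * w ^+ n) (cst 1)).
- near=> n; have := @stepn_itv n y; rewrite y0 y1 => /(_ isT)/andP[_ ->].
  rewrite andbT /stepn.
  apply: le_trans (bernoulli_le _ _); last by rewrite exprn_ge0// exprn_ile1.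
  by rewrite lerB// natrM natrX -mulrA -exprMn nw.
- rewrite -[X in _ --> X]subr0; apply: cvgB; first exact: cvg_cst.
  rewrite -(mulr0 (1 - w)^-1); apply: cvgM; first exact: cvg_cst.
  by apply: cvg_expr; rewrite ger0_norm.
- exact: cvg_cst.
Unshelve. all: by end_near. Qed.

End StepPolynomials.

(** * From equal Cauchy transforms to equal moments and distribution functions *)

Section Uniqueness.
Variable R : realType.

Lemma measurable_horner (p : {poly R}) : measurable_fun setT (fun x : R => p.[x]).
Proof. by apply: continuous_measurable_fun; exact: continuous_horner. Qed.

Lemma horner_bounded (p : {poly R}) (M : R) :
  exists c, forall x, `|x| <= M -> `|p.[x]| <= c.
Proof.
elim/poly_ind: p => [|p a [c hc]].
  by exists 0 => x _; rewrite horner0 normr0.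
exists (`|c| * `|M| + `|a|) => x xM; rewrite hornerMXaddC.
rewrite (le_trans (ler_normD _ _))// lerD2r normrM ler_pM//.
  by rewrite (le_trans (hc x xM))// ler_norm.
by rewrite (le_trans xM)// ler_norm.
Qed.

Lemma supp_integrable_horner (nu : realProb R) M (p : {poly R}) :
  supp_in nu M -> nu.-integrable setT (fun x => (p.[x])%:E).
Proof.
move=> nuM; have [c hc] := horner_bounded p M.
exact: (supp_integrable nuM (measurable_horner p) hc).
Qed.

Variables (nu1 nu2 : realProb R) (M : R).
Hypotheses (M0 : 0 < M) (s1 : supp_in nu1 M) (s2 : supp_in nu2 M).

Let cau (nu : realProb R) k z := \int[nu]_x (x ^+ k * (z - x)^-1).

Let cau_mf k (z : R) : measurable_fun setT (fun x : R => x ^+ k * (z - x)^-1).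
Proof.
apply: measurable_funM; first exact: measurable_funX.
by apply: measurable_funV; exact: measurable_funB.
Qed.

Let cau_bound k (z : R) : M < z -> forall x : R, `|x| <= M ->
  `|x ^+ k * (z - x)^-1| <= M ^+ k * (z - M)^-1.
Proof.
move=> Mz x xM; have zM : 0 < z - M by rewrite subr_gt0.
have zx : z - M <= z - x by rewrite lerD2l lerN2 (le_trans (ler_norm x)).
rewrite normrM normrX ler_pM//; first by rewrite lerXn2r ?nnegrE// ltW.
by rewrite normfV gtr0_norm ?lef_pV2 ?posrE// (lt_le_trans zM).
Qed.

Let cauS (nu : realProb R) k z : supp_in nu M -> M < z ->
  cau nu k.+1 z = z * cau nu k z - \int[nu]_x x ^+ k.
Proof.
move=> s Mz.
have i1 := supp_integrable s (@cau_mf k z) (cau_bound k Mz).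
have i2 : nu.-integrable setT (EFin \o (fun x : R => x ^+ k)).
  have := supp_integrable_horner 'X^k s.
  by apply: eq_integrable => // x _ /=; rewrite hornerXn.
rewrite /cau -RintegralZl// -RintegralB//; last first.
  exact: (integrableZl measurableT z i1).
apply: (supp_eq_Rintegral s).
- exact: (supp_integrable s (@cau_mf k.+1 z) (cau_bound k.+1 Mz)).
- exact: (integrableB measurableT (integrableZl measurableT z i1) i2).
move=> x xM; have zx : z - x != 0.
  rewrite subr_eq0 gt_eqF// (le_lt_trans _ Mz)//.
  by rewrite (le_trans (ler_norm x)).
by rewrite exprS; field.
Qed.

Hypothesis eq_cauchy : exists r, forall z : R, r < z ->
  cauchy_transform nu1 z%:C%C = cauchy_transform nu2 z%:C%C.

(** By [cauS], the moment of order j is z [cau] j z - [cau] j.+1 z, and the last term is O(1/z).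
    Equality of all [cau] k near infinity and equality of moments thus propagate each other,
    starting from the transform itself at real points. *)
Lemma eq_moments k : \int[nu1]_x x ^+ k = \int[nu2]_x x ^+ k.
Proof.
have [r0 hr0] := eq_cauchy.
pose r := Num.max r0 M.
have hr z : r < z -> M < z by move/(le_lt_trans _); apply; rewrite le_max lexx orbT.
have mom j : (forall z, r < z -> cau nu1 j z = cau nu2 j z) ->
    \int[nu1]_x x ^+ j = \int[nu2]_x x ^+ j.
  move=> hk; apply/eqP; rewrite -subr_eq0 -normr_le0; apply/ler_addgt0Pr => e e0.
  rewrite add0r.
  (* Large enough that 2 M^(j+1) / (z - M) is at most e. *)
  pose z := `|r| + M + 2 * M ^+ j.+1 / e + 1.
  have Mk : 0 < M ^+ j.+1 by rewrite exprn_gt0.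
  have q0 : 0 < 2 * M ^+ j.+1 / e by rewrite divr_gt0// mulr_gt0.
  have rz : r < z.
    have := ler_norm r; move: q0 M0; rewrite /z.
    by move: (2 * _ / e) `|r| => x y; lra.
  have -> : \int[nu1]_x x ^+ j - \int[nu2]_x x ^+ j =
      cau nu2 j.+1 z - cau nu1 j.+1 z.
    by rewrite !cauS ?hr// hk//; ring.
  apply: le_trans (ler_normB _ _) _.
  have b (nu : realProb R) : supp_in nu M -> `|cau nu j.+1 z| <= M ^+ j.+1 * (z - M)^-1.
    move=> s; apply: (supp_Rintegral_bound s); first exact: cau_mf.
    exact: cau_bound (hr _ rz).
  apply: le_trans (lerD (b _ s2) (b _ s1)) _.
  rewrite -mulr2n -mulr_natl mulrA ler_pdivrMr ?subr_gt0 ?hr//.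
  rewrite -ler_pdivrMl// (mulrC e^-1).
  rewrite /z; have := normr_ge0 r.
  by move: (2 * _ / e) `|r| => x y; lra.
apply (mom k); elim: k => [|k IH] z rz; last by rewrite !cauS ?hr// IH// mom.
have r0z : r0 < z by rewrite (le_lt_trans _ rz)// le_max lexx.
have h := congr1 (@complex.Re R) (hr0 z r0z); rewrite /= in h; rewrite /cau.
have e (nu : realProb R) :
    \int[nu]_t ((z - t) / ((z - t) ^+ 2 + (0 - 0) ^+ 2)) = cau nu 0 z.
  apply: eq_Rintegral => t _; rewrite subrr (expr0n _ 2) addr0 expr0 mul1r.
  have [->|n] := eqVneq (z - t) 0; first by rewrite mul0r invr0.
  by rewrite expr2 invfM mulrA divff// mul1r.
exact: etrans (esym (e nu1)) (etrans h (e nu2)).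
Qed.

Lemma eq_poly_integrals (p : {poly R}) :
  \int[nu1]_x p.[x] = \int[nu2]_x p.[x].
Proof.
(* The extra power of X lets the induction, which peels off the constant coefficient, pass a factor
   X along. *)
suff H : forall k, \int[nu1]_x (p * 'X^k).[x] = \int[nu2]_x (p * 'X^k).[x].
  by have := H 0; rewrite expr0 mulr1.
elim/poly_ind: p => [|p a IH] k.
  by rewrite mul0r; under eq_Rintegral do rewrite horner0;
    under [RHS]eq_Rintegral do rewrite horner0; rewrite !prob_Rintegral_cst.
have e (nu : realProb R) : supp_in nu M -> \int[nu]_x ((p * 'X + a%:P) * 'X^k).[x] =
    \int[nu]_x (p * 'X^(k.+1)).[x] + a * \int[nu]_x x ^+ k.
  move=> s.
  have i2 : nu.-integrable setT (EFin \o (fun x : R => x ^+ k)).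
    have := supp_integrable_horner 'X^k s.
    by apply: eq_integrable => // x _ /=; rewrite hornerXn.
  rewrite -RintegralZl// -RintegralD//.
  - by apply: eq_Rintegral => x _; rewrite !hornerE exprS; ring.
  - exact: supp_integrable_horner s.
  - exact: (integrableZl measurableT a i2).
by rewrite !e// IH eq_moments.
Qed.

(** Polynomials have equal integrals, and the [stepn] polynomials composed with a decreasing affine
    map sending c to 1/2 converge boundedly on the support to the indicator of the half-line right
    of c. *)
Lemma eq_cdf c : nu1 `]-oo, c]%classic = nu2 `]-oo, c]%classic.
Proof.
suff H : nu1 `]c, +oo[%classic = nu2 `]c, +oo[%classic.
  have E : (`]-oo, c]%classic : set R) = ~` `]c, +oo[%classic by rewrite setCitvr.
  have mc : measurable (`]c, +oo[%classic : set (measurableTypeR R)).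
    exact: measurable_itv.
  by rewrite E !probability_setC// H.
(* With this slope, [lin] maps [-M, M] into [0, 1]. *)
pose L := 2 * (`|c| + M).
have L0 : 0 < L by rewrite mulr_gt0// ltr_wpDl.
pose lin : {poly R} := (2^-1 + c / L)%:P - L^-1 *: 'X.
have linE x : lin.[x] = 2^-1 - (x - c) / L by rewrite !hornerE; ring.
have lin01 x : `|x| <= M -> 0 <= lin.[x] <= 1.
  move=> xM; rewrite linE.
  have : `|(x - c) / L| <= 2^-1.
    rewrite normrM normfV (gtr0_norm L0) ler_pdivrMr// /L mulKf//.
    by rewrite (le_trans (ler_normB _ _))// addrC lerD2l.
  by rewrite ler_norml => /andP[? ?]; apply/andP; split; lra.
pose q n : {poly R} := (1 - lin ^+ n) ^+ (n * 2 ^ n).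
have qE n x : (q n).[x] = stepn n lin.[x] by rewrite !(hornerE, horner_exp).
have key (nu : realProb R) : supp_in nu M ->
    (\int[nu]_x (q n).[x]) @[n --> \oo] --> fine (nu `]c, +oo[%classic).
  move=> s.
  have mc : measurable (`]c, +oo[%classic : set (measurableTypeR R)).
    exact: measurable_itv.
  have [] := @dominated_convergence _ _ _ nu setT measurableT
    (fun n x => ((q n).[x])%:E) (fun x => (\1_(`]c, +oo[%classic) x)%:E)
    (fun x => 1%:E).
  - by move=> n; apply/measurable_EFinP; exact: measurable_horner.
  - by apply/measurable_EFinP; exact: measurable_indic.
  - exists (~` `[- M, M]%classic); split => //.
      by apply: measurableC; exact: measurable_itv.
    move=> x /= h; rewrite in_itv/= -ler_norml => xM; apply: h => _ /=.
    apply/fine_cvgP; split; first by near=> n.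
    have := lin01 x xM; under eq_fun do rewrite /= qE.
    have [cx|xc] := ltP c x.
      rewrite indicE mem_set/=; last by rewrite in_itv/= cx.
      move=> /andP[l0 _].
      apply: stepn_lt_half; rewrite l0 linE gtrBl divr_gt0// subr_gt0//.
    rewrite indicE memNset/=; last by rewrite in_itv/= andbT ltNge xc.
    move=> /andP[l0 l1].
    apply: (@squeeze_cvgr _ _ _ _ (cst 0) (@harmonic R)).
    - near=> n; have := @stepn_itv _ n lin.[x]; rewrite l0 l1 => /(_ isT)/andP[-> _].
      rewrite /= stepn_ge_half// l1 andbT linE lerDl oppr_ge0.
      by rewrite pmulr_lle0 ?invr_gt0// subr_le0.
    - exact: cvg_cst.
    - exact: cvg_harmonic.
  - exact: (prob_integrable_cst nu 1).
  - exists (~` `[- M, M]%classic); split => //.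
      by apply: measurableC; exact: measurable_itv.
    move=> x /= h; rewrite in_itv/= -ler_norml => xM; apply: h => n _ /=.
    rewrite lee_fin qE; have /andP[h0 h1] := stepn_itv n (lin01 x xM).
    by rewrite ger0_norm.
  move=> _ _; rewrite integral_indic// setIT => h.
  have fn : nu `]c, +oo[%classic \is a fin_num by exact: fin_num_measure.
  by apply: fine_cvg; rewrite fineK.
have h1 := key _ s1; have h2 := key _ s2.
have mc : measurable (`]c, +oo[%classic : set (measurableTypeR R)).
  exact: measurable_itv.
have f1 := fin_num_measure nu1 _ mc; have f2 := fin_num_measure nu2 _ mc.
apply/eqP; rewrite -(fineK f1) -(fineK f2) eqe; apply/eqP; apply: (cvg_unique _ h1) => //=.
rewrite (_ : (fun n => _) = (fun n => \int[nu2]_x (q n).[x])); first exact: h2.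
by apply/funext => n; exact: eq_poly_integrals.
Unshelve. all: by end_near. Qed.

End Uniqueness.

(** * Laws on an arc with geometric Chebyshev moments *)

Section Chebyshev.
Variable R : realType.

(* [chebV k.+1] is U_k(x/2), U_k the Chebyshev polynomial of the second kind. *)
Fixpoint chebV (k : nat) : {poly R} :=
  match k with
  | 0 => 0
  | k'.+1 => match k' with 0 => 1 | k''.+1 => 'X * chebV k' - chebV k'' end
  end.

Lemma chebV0 x : (chebV 0).[x] = 0. Proof. by rewrite horner0. Qed.

Lemma chebV1 x : (chebV 1).[x] = 1. Proof. by rewrite /= hornerC. Qed.

Lemma chebVSS k x : (chebV k.+2).[x] = x * (chebV k.+1).[x] - (chebV k).[x].
Proof. by rewrite -[chebV k.+2]/('X * chebV k.+1 - chebV k) !hornerE. Qed.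

Lemma chebV_ind (P : nat -> Prop) :
  P 0%N -> P 1%N -> (forall k, P k -> P k.+1 -> P k.+2) -> forall k, P k.
Proof.
move=> P0 P1 PS k; suff: P k /\ P k.+1 by case.
by elim: k => [//|k [Pk Pk1]]; split => //; exact: PS.
Qed.

Lemma chebV_sin k th : sin th * (chebV k).[2 * cos th] = sin (k%:R * th).
Proof.
elim/chebV_ind: k => [||k IH1 IH2].
- by rewrite chebV0 mulr0 mul0r sin0.
- by rewrite chebV1 mulr1 mul1r.
rewrite chebVSS mulrBr IH1 mulrCA IH2.
have -> : k.+2%:R * th = k.+1%:R * th + th by rewrite -[k.+2]addn1 natrD; ring.
have -> : k%:R * th = k.+1%:R * th - th by rewrite -[k.+1]addn1 natrD; ring.
by rewrite sinB (sinD _ th); ring.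
Qed.

(** Twice the Chebyshev polynomial of the first kind; used for the moments when t^2 = 1. *)
Lemma chebV_cos k th :
  (chebV k.+2).[2 * cos th] - (chebV k).[2 * cos th] = 2 * cos (k.+1%:R * th).
Proof.
elim/chebV_ind: k => [||k IH1 IH2].
- by rewrite chebVSS chebV0 chebV1 !subr0 mulr1 mul1r.
- rewrite !chebVSS chebV0 chebV1.
  have -> : 2%:R * th = th *+ 2 by rewrite mulr_natl.
  by rewrite cos_mulr2n; ring.
have -> : (chebV k.+4).[2 * cos th] - (chebV k.+2).[2 * cos th] =
   2 * cos th * ((chebV k.+3).[2 * cos th] - (chebV k.+1).[2 * cos th]) -
   ((chebV k.+2).[2 * cos th] - (chebV k).[2 * cos th]).
  apply/eqP; rewrite -subr_eq0 (chebVSS k.+2); apply/eqP.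
  transitivity (2 * cos th * (chebV k.+1).[2 * cos th] - (chebV k).[2 * cos th]
    - (chebV k.+2).[2 * cos th]); first by ring.
  by rewrite -chebVSS subrr.
rewrite IH1 IH2.
have -> : k.+3%:R * th = k.+2%:R * th + th by rewrite -[k.+3]addn1 natrD; ring.
have -> : k.+1%:R * th = k.+2%:R * th - th by rewrite -[k.+2]addn1 natrD; ring.
by rewrite cosB (cosD _ th); ring.
Qed.

(** The counterpart of [chebV_sin] at t + 1/t, the position of the atom. *)
Lemma chebV_joukowski k (t : R) : t != 0 ->
  (t - t^-1) * (chebV k).[t + t^-1] = t ^+ k - t^-1 ^+ k.
Proof.
move=> t0; elim/chebV_ind: k => [||k IH1 IH2].
- by rewrite chebV0 !expr0 mulr0 subrr.
- by rewrite chebV1 mulr1 !expr1.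
rewrite chebVSS mulrBr mulrCA IH1 IH2 !exprVn !exprS.
by field; rewrite t0 expf_neq0.
Qed.

End Chebyshev.

(** * Integrals over the angles from 0 to pi *)

Section ArcIntegrals.
Variable R : realType.
Local Notation lam := (@lebesgue_measure R).
Local Notation arc := (`[0, pi]%classic : set R).

Definition arcint (f : R -> R) : R := \int[lam]_(th in arc) f th.

Lemma arc_integrable (f : R -> R) : continuous f ->
  lam.-integrable arc (EFin \o f).
Proof.
move=> cf; apply: continuous_compact_integrable; first exact: segment_compact.
exact: continuous_subspaceT.
Qed.

Lemma arcintD (f g : R -> R) : continuous f -> continuous g ->
  arcint (fun x => f x + g x) = arcint f + arcint g.
Proof. by move=> cf cg; rewrite /arcint RintegralD//; exact: arc_integrable. Qed.

Lemma arcintB (f g : R -> R) : continuous f -> continuous g ->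
  arcint (fun x => f x - g x) = arcint f - arcint g.
Proof. by move=> cf cg; rewrite /arcint RintegralB//; exact: arc_integrable. Qed.

Lemma arcintZ (a : R) (f : R -> R) : continuous f -> arcint (fun x => a * f x) = a * arcint f.
Proof. by move=> cf; rewrite /arcint RintegralZl//; exact: arc_integrable. Qed.

Lemma eq_arcint f g : (forall x, 0 <= x <= pi -> f x = g x) -> arcint f = arcint g.
Proof. by move=> fg; apply: eq_Rintegral => x; rewrite inE/= in_itv/=; exact: fg. Qed.

Lemma arcint_cst (c : R) : arcint (fun=> c) = pi * c.
Proof.
rewrite /arcint Rintegral_cst//= lebesgue_measure_itv/= lte_fin pi_gt0/=.
by rewrite subr0 mulrC.
Qed.

Lemma arcint_bound (f : R -> R) (c : R) : continuous f -> (forall x, `|f x| <= c) ->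
  `|arcint f| <= pi * c.
Proof.
move=> cf fc; apply: le_trans (le_normr_Rintegral _ _) _ => //.
  exact: arc_integrable.
rewrite -arcint_cst; apply: le_Rintegral => //.
- apply: arc_integrable => x; apply: cvg_norm; exact: cf.
- by apply: arc_integrable => x; exact: cvg_cst.
Qed.

Lemma continuous_cosM (a : R) : continuous (fun x => cos (a * x)).
Proof.
move=> x; apply: continuous_comp; last exact: continuous_cos.
by apply: cvgM; [exact: cvg_cst|exact: cvg_id].
Qed.

Lemma arcint_cos k : arcint (fun x => cos (k.+1%:R * x)) = 0.
Proof.
rewrite /arcint /Rintegral.
have dF (x : R) : is_derive x 1 (fun x : R => k.+1%:R^-1 * sin (k.+1%:R * x))
    (cos (k.+1%:R * x)).
  have d1 : is_derive x (1 : R) (k.+1%:R \*: @id R) (k.+1%:R *: (1 : R)).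
    exact: is_deriveZ.
  have d2 := is_derive1_comp (is_derive_sin (k.+1%:R * x)) d1.
  have d3 : is_derive x (1 : R) (k.+1%:R^-1 \*: (sin \o (k.+1%:R \*: @id R)))
      (k.+1%:R^-1 *: (cos (k.+1%:R * x) * (k.+1%:R *: 1))).
    exact: is_deriveZ.
  move: d3; rewrite /GRing.scale/= mulr1 mulrCA mulVf ?mulr1// pnatr_eq0//.
rewrite (@continuous_FTC2 _ _ (fun x => k.+1%:R^-1 * sin (k.+1%:R * x))).
- have kpi : sin (k.+1%:R * pi) = 0 :> R.
    elim: k.+1 => [|j IH]; first by rewrite mul0r sin0.
    by rewrite -addn1 natrD mulrDl mul1r sinDpi IH oppr0.
  by rewrite kpi !mulr0 sin0 mulr0 subee.
- exact: pi_gt0.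
- exact/continuous_subspaceT/continuous_cosM.
- have cF : continuous (fun x : R => k.+1%:R^-1 * sin (k.+1%:R * x)).
    move=> x; apply: cvgM; first exact: cvg_cst.
    apply: continuous_comp; last exact: continuous_sin.
    by apply: cvgM; [exact: cvg_cst|exact: cvg_id].
  split; last 2 first.
  - exact/cvg_at_right_filter/cF.
  - exact/cvg_at_left_filter/cF.
  by move=> x _; apply: ex_derive.
- by move=> x _; rewrite derive1E derive_val.
Qed.

End ArcIntegrals.

(** * Chebyshev moments of the arc densities *)

Section ArcMoments.
Variable R : realType.

(** This is |1 - t exp(i th)|^2. *)
Definition arcden (t th : R) : R := 1 - 2 * t * cos th + t ^+ 2.

(* For [t ^+ 2 = 1], where [arcden] vanishes at an endpoint, the factor
   [sin th ^+ 2 / arcden t th] is replaced by its continuous extension. *)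
Definition arcw (t th : R) : R :=
  if t ^+ 2 == 1 then pi^-1 * (1 + t * cos th)
  else 2 / pi * (sin th ^+ 2 / arcden t th).

Lemma arcden_ge t th : (1 - `|t|) ^+ 2 <= arcden t th.
Proof.
have c1 := cos_le1 th; have c2 := cos_geN1 th.
rewrite /arcden; have [t0|t0] := leP 0 t.
  rewrite -subr_ge0.
  have -> : 1 - 2 * t * cos th + t ^+ 2 - (1 - `|t|) ^+ 2 = 2 * t * (1 - cos th).
    by rewrite ger0_norm//; ring.
  by rewrite !mulr_ge0// subr_ge0.
rewrite -subr_ge0.
have -> : 1 - 2 * t * cos th + t ^+ 2 - (1 - `|t|) ^+ 2 = 2 * (- t) * (1 + cos th).
  by rewrite ltr0_norm//; ring.
rewrite !mulr_ge0// ?oppr_ge0 ?(ltW t0)//; lra.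
Qed.

Lemma arcden_gt0 t th : t ^+ 2 != 1 -> 0 < arcden t th.
Proof.
move=> t1; apply: lt_le_trans (arcden_ge t th).
rewrite lt_neqAle sqr_ge0 andbT eq_sym expf_neq0// subr_eq0.
by apply: contra t1 => /eqP t1; rewrite -real_normK ?num_real// -t1 expr1n.
Qed.

Lemma arcw_ge0 t th : 0 <= arcw t th.
Proof.
rewrite /arcw; case: ifPn => [/eqP t2|t1]; last first.
  by rewrite mulr_ge0 ?divr_ge0 ?pi_ge0 ?sqr_ge0// ltW// arcden_gt0.
rewrite mulr_ge0// ?invr_ge0 ?pi_ge0//.
have : (t * cos th) ^+ 2 <= 1.
  by rewrite exprMn t2 mul1r cos2sin2 gerBl sqr_ge0.
rewrite -real_normK ?num_real// expr_le1// ler_norml => /andP[h _].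
by move: h; lra.
Qed.

Lemma arcw_den t th : arcden t th * arcw t th = 2 / pi * sin th ^+ 2.
Proof.
have pi0 : pi != 0 :> R by rewrite gt_eqF// pi_gt0.
rewrite /arcw; case: ifPn => [/eqP t2|t1]; last first.
  have d0 := arcden_gt0 th t1; by rewrite mulrCA (mulrC (arcden _ _)) divfK// gt_eqF.
rewrite sin2cos2 /arcden t2.
have -> : cos th ^+ 2 = t ^+ 2 * cos th ^+ 2 by rewrite t2 mul1r.
by move: (pi^-1) => P; ring.
Qed.

(** Reduces the densities with |t| > 1 to those with |t| < 1. *)
Lemma arcwV t th : t != 0 -> t ^+ 2 != 1 -> arcw t^-1 th = t ^+ 2 * arcw t th.
Proof.
move=> t0 t1; have d0 := arcden_gt0 th t1.
have tV : t^-1 ^+ 2 != 1.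
  by rewrite exprVn; apply: contra t1 => /eqP h; rewrite -[t ^+ 2]invrK h invr1.
have dV := arcden_gt0 th tV.
rewrite /arcw (negbTE t1) (negbTE tV).
have -> : arcden t^-1 th = arcden t th / t ^+ 2 by rewrite /arcden; field.
by rewrite [RHS]mulrCA; congr (_ * _); field; rewrite t0 gt_eqF.
Qed.

Lemma continuous_arcden t : continuous (arcden t).
Proof.
move=> x; apply: cvgD; last exact: cvg_cst.
apply: cvgB; first exact: cvg_cst.
by apply: cvgM; [exact: cvg_cst|exact: continuous_cos].
Qed.

Lemma continuous_arcw t : continuous (arcw t).
Proof.
have [t1|t1] := boolP (t ^+ 2 == 1).
  have -> : arcw t = fun th => pi^-1 * (1 + t * cos th).
    by apply/funext => th; rewrite /arcw t1.
  move=> x; apply: cvgM; first exact: cvg_cst.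
  apply: cvgD; first exact: cvg_cst.
  by apply: cvgM; [exact: cvg_cst|exact: continuous_cos].
have -> : arcw t = fun th => 2 / pi * (sin th ^+ 2 / arcden t th).
  by apply/funext => th; rewrite /arcw (negbTE t1).
move=> x; apply: cvgM; first exact: cvg_cst.
apply: cvgM; first by apply: (@continuous_comp _ _ _ sin (fun y : R => y ^+ 2));
  [exact: continuous_sin|exact: exprn_continuous].
by apply: cvgV; [rewrite gt_eqF// arcden_gt0|exact: continuous_arcden].
Qed.

Lemma continuous_cheb k : continuous (fun th : R => (chebV R k).[2 * cos th]).
Proof.
move=> x; apply: (@continuous_comp _ _ _ (fun th : R => 2 * cos th)).
  by apply: cvgM; [exact: cvg_cst|exact: continuous_cos].
exact: continuous_horner.
Qed.

Definition arcmom t k := arcint (fun th => (chebV R k).[2 * cos th] * arcw t th).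

Lemma continuous_arcmom t k :
  continuous (fun th => (chebV R k).[2 * cos th] * arcw t th).
Proof.
by move=> x; apply: cvgM; [exact: continuous_cheb|exact: continuous_arcw].
Qed.

Lemma arcmom0 t : arcmom t 0 = 0.
Proof.
rewrite /arcmom -[RHS](mulr0 pi) -arcint_cst; apply: eq_arcint => x _.
by rewrite chebV0 mul0r.
Qed.

(** The left side is the integral with [arcden] inserted, by the recursion of [chebV]. It cancels
    the denominator of the density and leaves cos(k th) - cos((k+2) th) over pi, whose integral is
    nonzero only for k = 0. *)
Lemma arcmom_rec t k : (1 + t ^+ 2) * arcmom t k.+1
  - t * (arcmom t k.+2 + arcmom t k) = (k == 0%N)%:R.
Proof.
have c := @continuous_arcmom t.
have cZ a k' : continuous (fun th => a * ((chebV R k').[2 * cos th] * arcw t th)).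
  by move=> x; apply: cvgM; [exact: cvg_cst|exact: c].
rewrite mulrDr -!arcintZ// -arcintD// -arcintB//; last first.
  by move=> x; apply: cvgD; exact: cZ.
transitivity (arcint (fun th : R => pi^-1 * (cos (k%:R * th) - cos (k.+2%:R * th)))).
  apply: eq_arcint => th _.
  transitivity (arcden t th * arcw t th * (chebV R k.+1).[2 * cos th]).
    by rewrite /arcden chebVSS; ring.
  rewrite arcw_den.
  have -> : 2 / pi * sin th ^+ 2 * (chebV R k.+1).[2 * cos th] =
    pi^-1 * (2 * (sin th * (sin th * (chebV R k.+1).[2 * cos th]))) by ring.
  rewrite chebV_sin; congr (_ * _).
  have -> : k.+2%:R * th = k.+1%:R * th + th by rewrite -[k.+2]addn1 natrD; ring.
  have -> : k%:R * th = k.+1%:R * th - th by rewrite -[k.+1]addn1 natrD; ring.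
  by rewrite cosB (cosD _ th); ring.
have ck j : continuous (fun x : R => cos (j%:R * x)) by exact: continuous_cosM.
rewrite arcintZ; last by move=> x; apply: cvgB; exact: ck.
rewrite arcintB// arcint_cos subr0.
case: k => [|k] /=; last by rewrite arcint_cos mulr0.
rewrite (_ : arcint _ = pi) ?mulVf// ?gt_eqF ?pi_gt0//.
rewrite -[RHS]mulr1 -arcint_cst; apply: eq_arcint => x _.
by rewrite mul0r cos0.
Qed.

(** The defect from a geometric sequence of ratio t. The recursion of the moments has characteristic
    roots t and 1/t; removing the first leaves a recursion of order one. *)
Let err t k := arcmom t k.+1 - t * arcmom t k.

Let err_rec t k : err t k - t * err t k.+1 = (k == 0%N)%:R.
Proof. by rewrite -(arcmom_rec t k) /err; ring. Qed.

(** Iteration writes the defect as t^n times a later defect, and the defects are bounded: one sine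
    of the density turns the Chebyshev polynomial into a sine, which gives a bound independent of
    the degree. *)
Let err0_lt1 t k : `|t| < 1 -> err t k.+1 = 0.
Proof.
move=> t1; have d0 : 0 < (1 - `|t|) ^+ 2 by rewrite exprn_gt0// subr_gt0.
have t2 : t ^+ 2 != 1.
  by rewrite -real_normK ?num_real// lt_eqF// expr_lt1.
pose B := pi * (2 / pi / (1 - `|t|) ^+ 2).
have bJ j : `|arcmom t j| <= B.
  apply: arcint_bound => [|th]; first exact: continuous_arcmom.
  rewrite /arcw (negbTE t2).
  have -> : (chebV R j).[2 * cos th] * (2 / pi * (sin th ^+ 2 / arcden t th)) =
    2 / pi * ((sin th * (sin th * (chebV R j).[2 * cos th])) / arcden t th) by ring.
  have dd := arcden_gt0 th t2.
  rewrite normrM ger0_norm ?divr_ge0 ?pi_ge0// ler_pM2l ?divr_gt0 ?pi_gt0//.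
  rewrite chebV_sin normrM normfV (gtr0_norm dd).
  rewrite -[leRHS]mul1r; apply: ler_pM => //; first by rewrite invr_ge0 ltW.
    by rewrite normrM -[leRHS]mulr1 ler_pM ?sin_max.
  by rewrite lef_pV2 ?posrE// arcden_ge.
have bE j : `|err t j| <= 2 * B.
  rewrite (le_trans (ler_normB _ _))// mulr2n mulrDl mul1r lerD//.
  by rewrite normrM (le_trans _ (bJ j))// ler_piMl// ltW.
have iter n : err t k.+1 = t ^+ n * err t (k.+1 + n).
  elim: n => [|n ->]; first by rewrite expr0 mul1r addn0.
  have /eqP := err_rec t (k.+1 + n); rewrite subr_eq0 => /eqP ->.
  by rewrite exprSr addnS -mulrA.
have lim0 : (fun n => `|t| ^+ n * (2 * B)) @ \oo --> (0 : R).
  rewrite -(mul0r (2 * B)); apply: cvgM; last exact: cvg_cst.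
  by apply: cvg_expr; rewrite normr_id.
apply/eqP; rewrite -normr_le0; apply/ler_addgt0Pr => e e0; rewrite add0r.
have /cvgrPdist_lt /(_ e e0) [N _ /(_ N (leqnn N))] := lim0.
rewrite /= sub0r normrN => h.
have B0 : 0 <= 2 * B by rewrite (le_trans _ (bE 0%N)).
rewrite (iter N) normrM normrX (le_trans _ (ltW h))//.
by rewrite (ger0_norm (mulr_ge0 _ B0)) ?exprn_ge0// ler_wpM2l ?exprn_ge0.
Qed.

(** For |t| = 1 the previous iteration gains nothing, but then the integrand is a combination of
    cosines of positive frequency. *)
Let err0_eq1 t k : t ^+ 2 = 1 -> err t k.+1 = 0.
Proof.
move=> t2; have c := @continuous_arcmom t.
have pi0 : pi != 0 :> R by rewrite gt_eqF// pi_gt0.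
have cc j : continuous (fun x : R => cos (j%:R * x)) by exact: continuous_cosM.
rewrite /err /arcmom -arcintZ// -arcintB//; last first.
  by move=> x; apply: cvgM; [exact: cvg_cst|exact: c].
transitivity (arcint (fun th : R => pi^-1 *
    (cos (k.+1%:R * th) + t * cos (k.+2%:R * th)))).
  apply: eq_arcint => th _; rewrite /arcw t2 eqxx.
  have h1 := chebV_cos k th; have h2 := chebV_cos k.+1 th.
  have -> : cos (k.+1%:R * th) =
    ((chebV R k.+2).[2 * cos th] - (chebV R k).[2 * cos th]) / 2.
    by rewrite h1; field.
  have -> : cos (k.+2%:R * th) =
    ((chebV R k.+3).[2 * cos th] - (chebV R k.+1).[2 * cos th]) / 2.
    by rewrite h2; field.
  rewrite !chebVSS; set x := cos th; set a := (chebV R k.+1).[_].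
  set b := (chebV R k).[_].
  apply/eqP; rewrite -subr_eq0; apply/eqP.
  transitivity (pi^-1 * (1 - t ^+ 2) * (a * x)).
    by move: (pi^-1) => P; field.
  by rewrite t2 subrr mulr0 mul0r.
rewrite arcintZ; last first.
  move=> x; apply: cvgD; first exact: cc.
  by apply: cvgM; [exact: cvg_cst|exact: cc].
rewrite arcintD//; last by move=> x; apply: cvgM; [exact: cvg_cst|exact: cc].
by rewrite arcintZ// !arcint_cos mulr0 addr0 mulr0.
Qed.

Lemma arcmomE t k : t ^+ 2 <= 1 -> arcmom t k.+1 = t ^+ k.
Proof.
move=> t1; have E j : err t j.+1 = 0.
  move: t1; rewrite le_eqVlt => /predU1P[/err0_eq1//|t1].
  by apply: err0_lt1; rewrite -(@ltr_pXn2r _ 2)// ?nnegrE// expr1n real_normK ?num_real.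
elim: k => [|k IH].
  have := err_rec t 0; rewrite E mulr0 subr0 /err arcmom0 mulr0 subr0 => ->.
  by rewrite expr0.
by have /eqP := E k; rewrite /err subr_eq0 => /eqP ->; rewrite IH exprS.
Qed.

Definition atomw t : R := if t ^+ 2 <= 1 then 0 else 1 - t ^- 2.

Lemma atomw_ge0 t : 0 <= atomw t.
Proof.
rewrite /atomw; case: ifPn => //; rewrite -ltNge => t1.
by rewrite subr_ge0 invf_le1 ?ltW// (lt_trans _ t1).
Qed.

(* An atom at [t + 1/t] makes up for the mass that the arc loses when [1 < |t|]. *)
Lemma arcmom_atom t k :
  arcmom t k.+1 + atomw t * (chebV R k.+1).[t + t^-1] = t ^+ k.
Proof.
rewrite /atomw; case: ifPn => [t1|]; first by rewrite mul0r addr0 arcmomE.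
rewrite -ltNge => t1; have t0 : t != 0.
  by apply: contraTneq t1 => ->; rewrite expr0n/= ltr10.
have t2 : t ^+ 2 != 1 by rewrite gt_eqF.
have tV : t^-1 ^+ 2 <= 1 by rewrite exprVn invf_le1 ?ltW// (lt_trans _ t1).
have := arcmomE k tV; rewrite /arcmom.
rewrite (_ : arcint _ = t ^+ 2 * arcmom t k.+1); last first.
  rewrite -arcintZ; last exact: continuous_arcmom.
  by apply: eq_arcint => th _; rewrite arcwV// mulrCA.
rewrite -/(arcmom t k.+1) => h; have tt : t - t^-1 != 0.
  rewrite subr_eq0; apply: contra t2 => /eqP e.
  by rewrite expr2 {2}e divff.
(* The atom contributes t^k - t^(-k-2), and the arc t^(-k-2). *)
have -> : (chebV R k.+1).[t + t^-1] = (t ^+ k.+1 - t^-1 ^+ k.+1) / (t - t^-1).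
  by rewrite -chebV_joukowski// mulrC mulKf.
have -> : arcmom t k.+1 = t^-1 ^+ k / t ^+ 2 by rewrite -h mulrC mulKf// expf_neq0.
have -> : 1 - t ^- 2 = (t - t^-1) / t by field.
rewrite !exprVn !exprS; move: (t - t^-1) tt (expf_neq0 k t0) => d d0.
by move: (t ^+ k) => a a0; field; rewrite ?t0 ?d0 ?a0.
Qed.

End ArcMoments.

(** * Integration against a measure with density *)

Section DensityIntegral.
Context d (T : measurableType d) (R : realType).
Variables (mu m : {measure set T -> \bar R}) (w : T -> R).
Hypotheses (mw : measurable_fun setT w) (w0 : forall x, 0 <= w x).
Hypothesis mE : forall E, measurable E -> m E = (\int[mu]_(x in E) (w x)%:E)%E.
Local Open Scope ereal_scope.
Import HBNNSimple.

Let integral_density_nnsfun (h : {nnsfun T >-> R}) :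
  \int[m]_x (h x)%:E = \int[mu]_x ((h x)%:E * (w x)%:E).
Proof.
have mi (r : R) : measurable_fun setT (\1_(h @^-1` [set r]) : T -> R).
  exact: measurable_indic.
under [LHS]eq_integral do rewrite fimfunE -fsumEFin//.
rewrite ge0_integral_fsum//; last 2 first.
  - by move=> r; exact/measurable_EFinP/measurableT_comp.
  - by move=> n x _; rewrite EFinM nnfun_muleindic_ge0.
under [RHS]eq_integral.
  move=> x _; rewrite fimfunE -fsumEFin// ge0_mule_fsuml; last first.
    by move=> r; rewrite EFinM nnfun_muleindic_ge0.
  over.
rewrite ge0_integral_fsum//; last 2 first.
  - move=> r; apply: emeasurable_funM; last exact/measurable_EFinP.
    by apply/measurable_EFinP; exact: measurableT_comp.
  - move=> n x _; apply: mule_ge0; last by rewrite lee_fin.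
    by rewrite EFinM nnfun_muleindic_ge0.
apply: eq_fsbigr => r _; rewrite integralZl_indic_nnsfun//=.
have mr : measurable (h @^-1` [set r]) by exact: measurable_sfunP.
rewrite integral_indic// setIT mE//.
have [r0|r0] := leP 0%R r; last first.
  have -> : h @^-1` [set r] = set0.
    by apply/seteqP; split => // x /= hx; move: r0; rewrite -hx ltNge fun_ge0.
  by rewrite integral_set0 mule0; under eq_integral do rewrite indic0 mulr0 mul0e;
    rewrite integral0.
rewrite -ge0_integralZl//; last 2 first.
  - by apply/measurable_funTS/measurable_EFinP.
  - by move=> x _; rewrite lee_fin.
rewrite integral_mkcond; apply: eq_integral => x _.
rewrite patchE indicE; case: ifPn => _; first by rewrite mulr1.
by rewrite mulr0 mul0e.
Qed.

Lemma integral_density (f : T -> \bar R) : measurable_fun setT f ->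
  (forall x, 0 <= f x) -> \int[m]_x f x = \int[mu]_x (f x * (w x)%:E).
Proof.
move=> mf f0; pose f_ := nnsfun_approx measurableT mf.
transitivity (limn (fun n => \int[m]_x (f_ n x)%:E)).
  rewrite -monotone_convergence//=.
  - apply: eq_integral => x _; apply/esym/cvg_lim => //.
    exact: cvg_nnsfun_approx.
  - by move=> n; exact/measurable_EFinP.
  - by move=> n x _; rewrite lee_fin.
  - by move=> x _ i j ij; rewrite lee_fin; exact/lefP/nd_nnsfun_approx.
under eq_fun do rewrite integral_density_nnsfun.
rewrite -monotone_convergence//=.
- apply: eq_integral => x _; apply/cvg_lim => //.
  by apply: cvgeZr => //; exact: cvg_nnsfun_approx.
- move=> n; apply: emeasurable_funM; exact/measurable_EFinP.
- by move=> n x _; rewrite mule_ge0// lee_fin.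
- move=> x _ i j ij; rewrite lee_wpmul2r ?lee_fin//.
  exact/lefP/nd_nnsfun_approx.
Qed.

End DensityIntegral.

(** * Arc laws with their atoms, as measures on the line *)

Section ArcMeasure.
Variable R : realType.
Local Notation lam := (@lebesgue_measure R).
Local Notation arc := (`[0, pi]%classic : set R).

Definition arcwI (t th : R) : R := arcw t th * \1_arc th.

Lemma arcwI_ge0 t th : 0 <= arcwI t th.
Proof. by rewrite mulr_ge0 ?arcw_ge0. Qed.

Lemma measurable_arcwI t : measurable_fun setT (arcwI t).
Proof.
apply: measurable_funM.
  by apply: continuous_measurable_fun; exact: continuous_arcw.
by apply: measurable_indic; exact: measurable_itv.
Qed.

Definition arcd (t : R) (E : set (measurableTypeR R)) : \bar R :=
  (\int[lam]_(th in E) (arcwI t th)%:E)%E.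

Let arcd0 t : arcd t set0 = 0%E. Proof. exact: integral_set0. Qed.

Let arcd_ge0 t E : (0 <= arcd t E)%E.
Proof. by apply: integral_ge0 => x _; rewrite lee_fin arcwI_ge0. Qed.

Let arcd_sigma_additive t : semi_sigma_additive (arcd t).
Proof.
move=> F mF tF mUF; apply: cvg_toP.
  apply: ereal_nondecreasing_is_cvgn => m n mn.
  by apply: lee_sum_nneg_natr => // k _ _; exact: arcd_ge0.
rewrite /arcd ge0_integral_bigcup//=.
- by apply/measurable_funTS/measurable_EFinP; exact: measurable_arcwI.
- by move=> x _; rewrite lee_fin arcwI_ge0.
Qed.

HB.instance Definition _ t := isMeasure.Build _ _ _ (arcd t)
  (arcd0 t) (arcd_ge0 t) (@arcd_sigma_additive t).

Lemma arcdE t E : arcd t E = (\int[lam]_(th in E `&` arc) (arcw t th)%:E)%E.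
Proof.
rewrite /arcd [RHS]integral_mkcondr; apply: eq_integral => x _.
rewrite patchE /arcwI indicE; case: ifPn => _; first by rewrite mulr1.
by rewrite mulr0.
Qed.

Lemma integral_arcd t (f : R -> \bar R) : measurable_fun setT f ->
  (forall x, 0 <= f x)%E ->
  (\int[arcd t]_x f x = \int[lam]_(x in arc) (f x * (arcw t x)%:E))%E.
Proof.
move=> mf f0.
rewrite (@integral_density _ _ _ lam (arcd t) (arcwI t))//.
- rewrite [RHS]integral_mkcond; apply: eq_integral => x _.
  rewrite patchE /arcwI indicE; case: ifPn => _; first by rewrite mulr1.
  by rewrite mulr0 mule0.
- exact: measurable_arcwI.
- exact: arcwI_ge0.
Qed.

Definition arcmap (a b th : R) : R := a * (2 * cos th) + b.

Lemma continuous_arcmap a b : continuous (arcmap a b).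
Proof.
move=> x; apply: cvgD; last exact: cvg_cst.
apply: cvgM; first exact: cvg_cst.
by apply: cvgM; [exact: cvg_cst|exact: continuous_cos].
Qed.

Lemma measurable_arcmap a b :
  measurable_fun (setT : set (measurableTypeR R)) (arcmap a b : _ -> measurableTypeR R).
Proof. by apply: continuous_measurable_fun; exact: continuous_arcmap. Qed.

Definition arcp (t a b : R) : set (measurableTypeR R) -> \bar R :=
  pushforward (arcd t) (arcmap a b : measurableTypeR R -> measurableTypeR R).

Let arcp0 t a b : arcp t a b set0 = 0%E.
Proof. by rewrite /arcp /pushforward preimage_set0 measure0. Qed.

Let arcp_ge0 t a b E : (0 <= arcp t a b E)%E.
Proof. exact: arcd_ge0. Qed.

Let arcp_sigma_additive t a b : semi_sigma_additive (arcp t a b).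
Proof.
move=> F mF tF mUF.
have mp (A : set (measurableTypeR R)) : measurable A ->
    measurable (arcmap a b @^-1` A : set (measurableTypeR R)).
  by move=> mA; rewrite -[X in measurable X]setTI; exact: measurable_arcmap.
rewrite /arcp /pushforward preimage_bigcup.
apply: measure_semi_sigma_additive.
- by move=> n; exact: mp.
- apply/trivIsetP => /= i j _ _ ij; rewrite -preimage_setI.
  by move/trivIsetP : tF => /(_ _ _ _ _ ij) ->//; rewrite preimage_set0.
- by rewrite -preimage_bigcup; exact: mp.
Qed.

HB.instance Definition _ t a b := isMeasure.Build _ _ _ (arcp t a b)
  (arcp0 t a b) (arcp_ge0 t a b) (@arcp_sigma_additive t a b).

Definition atomx (t a b : R) : R := a * (t + t^-1) + b.

(** For a = 1 and b = 0 this is the law with Chebyshev moments t^k: the semicircle law if t = 0,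
    otherwise an affine image of the Marchenko-Pastur law of rate t^(-2), whose atom appears when
    the rate is below 1. *)
Definition fpm (t a b : R) : set (measurableTypeR R) -> \bar R :=
  measure_add (arcp t a b)
    (mscale (NngNum (atomw_ge0 t)) (@dirac _ (measurableTypeR R) (atomx t a b) R)).

HB.instance Definition _ t a b := Measure.on (fpm t a b).

Lemma fpmE t a b E : fpm t a b E =
  (arcd t (arcmap a b @^-1` E) + (atomw t)%:E * \d_(atomx t a b) E)%E.
Proof. by rewrite /fpm measure_addE. Qed.

Lemma integral_fpm t a b (f : R -> \bar R) : measurable_fun setT f ->
  (forall x, 0 <= f x)%E ->
  (\int[fpm t a b]_x f x =
   \int[lam]_(x in arc) (f (arcmap a b x) * (arcw t x)%:E)
   + (atomw t)%:E * f (atomx t a b))%E.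
Proof.
move=> mf f0; rewrite ge0_integral_measure_add//.
rewrite ge0_integral_mscale// integral_dirac// diracT mul1e.
congr (_ + _)%E; rewrite -(@integral_arcd t (f \o arcmap a b)); last 2 first.
- by apply: measurableT_comp => //; exact: measurable_arcmap.
- by move=> x; exact: f0.
have := @ge0_integral_pushforward _ _ (measurableTypeR R) (measurableTypeR R) R
  (arcmap a b) (measurable_arcmap a b) (arcd t) setT f measurableT mf (fun y _ => f0 y).
rewrite preimage_setT => <-.
by apply: eq_measure_integral => //; exact: measurable_arcmap.
Qed.

End ArcMeasure.

(** * Mixtures of two arc laws *)

Section Mixture.
Variable R : realType.
Local Notation lam := (@lebesgue_measure R).
Local Notation arc := (`[0, pi]%classic : set R).
Variables (t r a b al : R) (al0 : 0 <= al) (al1 : 0 <= 1 - al).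

Let ab1 : al + (1 - al) = 1. Proof. by rewrite addrC subrK. Qed.

Definition fmix : set (measurableTypeR R) -> \bar R :=
  measure_add (mscale (NngNum al0) (fpm t a b))
    (mscale (NngNum al1) (fpm r a b)).

HB.instance Definition _ := Measure.on fmix.

Lemma fmixE E : fmix E =
  (al%:E * fpm t a b E + (1 - al)%:E * fpm r a b E)%E.
Proof. by rewrite /fmix measure_addE. Qed.

Lemma integral_fmix (f : R -> \bar R) : measurable_fun setT f ->
  (forall x, 0 <= f x)%E ->
  (\int[fmix]_x f x = al%:E * \int[fpm t a b]_x f x +
     (1 - al)%:E * \int[fpm r a b]_x f x)%E.
Proof.
by move=> mf f0; rewrite ge0_integral_measure_add// !ge0_integral_mscale.
Qed.

(** Real-valued form of the right side of [integral_fpm], which also makes sense for functions of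
    any sign. *)
Definition fval (s : R) (f : R -> R) : R :=
  arcint (fun th => f (arcmap a b th) * arcw s th) + atomw s * f (atomx s a b).

Lemma integral_fpm_fval s (f : R -> R) : measurable_fun setT f ->
  (forall x, 0 <= f x) -> continuous (f \o arcmap a b) ->
  (\int[fpm s a b]_x (f x)%:E = (fval s f)%:E)%E.
Proof.
move=> mf f0 cf; rewrite integral_fpm//; last first.
  exact/measurable_EFinP.
rewrite /fval EFinD EFinM; congr (_ + _)%E.
rewrite /arcint /Rintegral fineK//.
apply: integrable_fin_num => //; apply: arc_integrable => x.
by apply: cvgM; [exact: cf|exact: continuous_arcw].
Qed.

Lemma fval1 s : fval s (fun=> 1) = 1.
Proof.
rewrite -[RHS](expr0 s) -(arcmom_atom s 0) /fval /arcmom chebV1.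
by congr (_ + _); apply: eq_arcint => x _; rewrite chebV1.
Qed.

Lemma fpm_setT s : fpm s a b setT = 1%E.
Proof.
rewrite -[LHS]mul1e -integral_cst//.
by rewrite (@integral_fpm_fval s (fun=> 1))// ?fval1// => x; exact: cvg_cst.
Qed.

Let fmix_setT : fmix setT = 1%E.
Proof. by rewrite fmixE !fpm_setT !mule1 -EFinD ab1. Qed.

HB.instance Definition _ := @Measure_isProbability.Build _ _ R fmix fmix_setT.

Definition fmix_bound : R :=
  `|a| * 2 + `|atomx t a b| + `|atomx r a b| + `|b|.

Lemma arcmap_bound th : `|arcmap a b th| <= fmix_bound.
Proof.
have h : `|a * (2 * cos th)| <= `|a| * 2.
  rewrite normrM ler_wpM2l// normrM ger0_norm// -[leRHS]mulr1 ler_wpM2l//.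
  exact: cos_max.
rewrite /arcmap (le_trans (ler_normD _ _))// lerD2r /fmix_bound -!addrA.
by rewrite (le_trans h)// lerDl !addr_ge0.
Qed.

Lemma atomx_bound1 : `|atomx t a b| <= fmix_bound.
Proof.
rewrite /fmix_bound; have := normr_ge0 (atomx r a b).
have := normr_ge0 a; have := normr_ge0 b; lra.
Qed.

Lemma atomx_bound2 : `|atomx r a b| <= fmix_bound.
Proof.
rewrite /fmix_bound; have := normr_ge0 (atomx t a b).
have := normr_ge0 a; have := normr_ge0 b; lra.
Qed.

(** The bounds on atoms are asked only where the weight is positive: in [fpow_supp] the formal
    position of a weightless atom lies outside the interval for large m. *)
Lemma fmix_supp M : (forall th, `|arcmap a b th| <= M) ->
  (0 < atomw t -> `|atomx t a b| <= M) ->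
  (0 < atomw r -> `|atomx r a b| <= M) -> supp_in fmix M.
Proof.
move=> hM h1 h2; have e s : (0 < atomw s -> `|atomx s a b| <= M) ->
    fpm s a b (~` `[- M, M]%classic) = 0%E.
  move=> hs; rewrite fpmE.
  have -> : arcmap a b @^-1` (~` `[- M, M]%classic) = set0.
    apply/seteqP; split => // x /= []; rewrite in_itv/= -ler_norml.
    exact: hM.
  rewrite measure0 add0e diracE.
  have := atomw_ge0 s; rewrite le_eqVlt => /predU1P[<-|/hs hx].
    by rewrite mul0e.
  by rewrite memNset ?mule0//= => -[]; rewrite in_itv/= -ler_norml.
by rewrite /supp_in fmixE !e// !mule0 adde0.
Qed.

(** [integral_fmix] is for nonnegative functions. On the support p + c is nonnegative for a suitable
    constant c, hence equal to its truncation at 0; total mass 1 then allows c to be subtracted on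
    both sides. *)
Lemma fmix_poly (p : {poly R}) : \int[fmix]_x p.[x] =
  al * fval t (horner p) + (1 - al) * fval r (horner p).
Proof.
pose M := fmix_bound.
have s : supp_in fmix M.
  apply: fmix_supp; first exact: arcmap_bound.
    by move=> _; exact: atomx_bound1.
  by move=> _; exact: atomx_bound2.
have [c hc] := horner_bounded p M.
pose f x := Num.max (p.[x] + c) 0.
have fE x : `|x| <= M -> f x = p.[x] + c.
  move=> /hc; rewrite ler_norml => /andP[h _].
  by rewrite /f max_l// addrC -lerBlDl sub0r.
have mf : measurable_fun setT f.
  apply: measurable_maxr => //; apply: measurable_funD => //.
  exact: measurable_horner.
have f0 x : 0 <= f x by rewrite /f le_max lexx orbT.
have cp : continuous (fun th => p.[arcmap a b th]).
  move=> x; apply: (@continuous_comp _ _ _ (arcmap a b)).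
    exact: continuous_arcmap.
  exact: continuous_horner.
have cf : continuous (f \o arcmap a b).
  rewrite (_ : _ \o _ = fun th => p.[arcmap a b th] + c).
    by move=> x; apply: cvgD; [exact: cp|exact: cvg_cst].
  by apply/funext => th /=; rewrite fE// arcmap_bound.
have ip := supp_integrable_horner p s.
have ic : fmix.-integrable setT (EFin \o cst c : _ -> \bar R).
  exact: (prob_integrable_cst fmix c).
have ifm : fmix.-integrable setT (EFin \o f).
  have [c' hc'] := horner_bounded (p + c%:P) M.
  apply: (supp_integrable s mf (c := c')) => x xM.
  by rewrite fE//; have := hc' x xM; rewrite !hornerE.
have E1 : \int[fmix]_x f x = \int[fmix]_x p.[x] + c.
  rewrite -[in RHS](prob_Rintegral_cst fmix c) -RintegralD//.
  apply: (supp_eq_Rintegral s) => //; exact: (integrableD measurableT ip ic).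
have fv u : `|atomx u a b| <= M -> fval u f = fval u (horner p) + c.
  move=> hu; rewrite /fval fE//.
  have -> : arcint (fun th => f (arcmap a b th) * arcw u th) =
     arcint (fun th => p.[arcmap a b th] * arcw u th) + c * arcint (fun th => 1 * arcw u th).
    rewrite -arcintZ; last first.
      by move=> x; apply: cvgM; [exact: cvg_cst|exact: continuous_arcw].
    rewrite -arcintD.
    - by apply: eq_arcint => x _; rewrite fE ?arcmap_bound//; ring.
    - by move=> x; apply: cvgM; [exact: cp|exact: continuous_arcw].
    - move=> x; apply: cvgM; first exact: cvg_cst.
      by apply: cvgM; [exact: cvg_cst|exact: continuous_arcw].
  have := fval1 u; rewrite /fval.
  set I := arcint (fun th => 1 * _); move=> I1; rewrite -[in RHS](mulr1 c) -I1.
  by ring.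
have h1 := fv t (atomx_bound1); have h2 := fv r (atomx_bound2).
have E2 : \int[fmix]_x f x =
    al * fval t f + (1 - al) * fval r f.
  by rewrite /Rintegral integral_fmix ?integral_fpm_fval//; exact/measurable_EFinP.
move: E1; rewrite E2 h1 h2; set X := Rintegral _ _ _.
have -> : al * (fval t (horner p) + c) + (1 - al) * (fval r (horner p) + c) =
  al * fval t (horner p) + (1 - al) * fval r (horner p) + c by ring.
by move=> /addIr ->.
Qed.

End Mixture.

(** * From Chebyshev moments to the Cauchy transform *)

Lemma geometric_bound_eq0 (R : realType) (x K : R) :
  (forall N, `|x| <= K * 4^-1 ^+ N) -> x = 0.
Proof.
move=> h; apply/eqP; rewrite -normr_le0; apply/ler_addgt0Pr => e e0; rewrite add0r.
have lim0 : (fun n => K * (4^-1 : R) ^+ n) @ \oo --> (0 : R).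
  rewrite -(mulr0 K); apply: cvgM; first exact: cvg_cst.
  by apply: cvg_expr; rewrite ger0_norm ?invr_ge0// invf_lt1// ltr1n.
have /cvgrPdist_lt /(_ e e0) [N _ /(_ N (leqnn N))] := lim0.
rewrite /= sub0r normrN => hN.
by rewrite (le_trans (h N))// (le_trans (ler_norm _))// ltW.
Qed.

Section ChebyshevSeries.
Variable R : realType.
Local Notation C := (R[i]).
Local Notation nm := (@Normc.normc R).
Local Notation "x %:C" := (x%:C)%C.

Lemma nmM (x y : C) : nm (x * y) = nm x * nm y.
Proof. exact: Normc.normcM. Qed.

Lemma nmX (x : C) n : nm (x ^+ n) = nm x ^+ n.
Proof.
elim: n => [|n IH]; first by rewrite !expr0 Normc.normc1.
by rewrite !exprS nmM IH.
Qed.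

Lemma nmV (x : C) : nm x^-1 = (nm x)^-1.
Proof. exact: Normc.normcV. Qed.

Lemma nmD (x y : C) : nm (x + y) <= nm x + nm y.
Proof. exact: complex.le_normcD. Qed.

Lemma nmN (x : C) : nm (- x) = nm x.
Proof. exact: complex.normcN. Qed.

Lemma nmB (x y : C) : nm (x - y) <= nm x + nm y.
Proof. by rewrite -(nmN y) nmD. Qed.

Lemma nm1B_ge (x : C) : nm x <= 2^-1 -> 2^-1 <= nm (1 - x).
Proof.
move=> hx; have := nmD (1 - x) x; rewrite subrK Normc.normc1.
by move: (nm (1 - x)) (nm x) hx => p q; lra.
Qed.

Lemma nm_neq0 (x : C) : 0 < nm x -> x != 0.
Proof. by apply: contraTneq => ->; rewrite Normc.normc0 ltxx. Qed.

Lemma chebV_bound (Y : R) k (y : R) : 0 <= Y -> `|y| <= Y ->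
  `|(chebV R k).[y]| <= (Y + 1) ^+ k.
Proof.
move=> Y0 yY; elim/chebV_ind: k => [||k IH1 IH2].
- by rewrite chebV0 normr0 expr0.
- by rewrite chebV1 normr1 expr1 lerDr.
rewrite chebVSS (le_trans (ler_normB _ _))// normrM.
apply: (@le_trans _ _ (Y * (Y + 1) ^+ k.+1 + (Y + 1) ^+ k)).
  by rewrite lerD// ler_pM.
have -> : Y * (Y + 1) ^+ k.+1 + (Y + 1) ^+ k = (Y * (Y + 1) + 1) * (Y + 1) ^+ k.
  by rewrite exprS; ring.
have -> : (Y + 1) ^+ k.+2 = (Y * (Y + 1) + 1 + Y) * (Y + 1) ^+ k.
  by rewrite !exprS; ring.
by rewrite ler_wpM2r ?exprn_ge0 ?addr_ge0// lerDl.
Qed.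

Lemma chebV_gen (u : C) (y : R) N :
  (1 - u * y%:C + u ^+ 2) * (\sum_(k < N) u ^+ k * ((chebV R k.+1).[y])%:C) =
  1 - u ^+ N * ((chebV R N.+1).[y])%:C + u ^+ N.+1 * ((chebV R N).[y])%:C.
Proof.
elim: N => [|N IH].
  by rewrite big_ord0 mulr0 chebV0 chebV1 expr0 mulr1 mulr0 addr0 subrr.
rewrite big_ord_recr/= mulrDr IH.
have -> : ((chebV R N.+2).[y])%:C =
    y%:C * ((chebV R N.+1).[y])%:C - ((chebV R N).[y])%:C.
  by rewrite -rmorphM -rmorphB -chebVSS.
by rewrite !exprS; ring.
Qed.

Lemma geom_gen (t u : C) N :
  (1 - t * u) * (\sum_(k < N) u ^+ k * t ^+ k) = 1 - u ^+ N * t ^+ N.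
Proof.
elim: N => [|N IH]; first by rewrite big_ord0 mulr0 !expr0 mulr1 subrr.
by rewrite big_ord_recr/= mulrDr IH !exprS; ring.
Qed.

Variables (nu : realProb R) (M a b t r : R).
Hypotheses (M0 : 0 < M) (nuM : supp_in nu M) (a0 : 0 < a).
Hypotheses (t0 : 0 < t) (r0 : 0 < r).

Let h (k : nat) : R := (t * t ^+ k + r * (- r) ^+ k) / (t + r).
Let lin : {poly R} := a^-1 *: 'X - (b / a)%:P.

Hypothesis moments : forall k, \int[nu]_x (chebV R k.+1 \Po lin).[x] = h k.

Let Y : R := (M + `|b|) / a.
(** For |u| < e all ratios |u| (Y + 1), |u| t, |u| r are at most 1/4: the denominators then stay
    above 1/2 and the remainder after N terms is O(4^(-N)). *)
Let e : R := (4 * (Y + 1 + t + r))^-1.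

Let linE x : lin.[x] = (x - b) / a.
Proof. by rewrite !hornerE; ring. Qed.

Let Y0 : 0 <= Y. Proof. by rewrite divr_ge0 ?ltW// ltr_wpDr. Qed.

Let linY x : `|x| <= M -> `|lin.[x]| <= Y.
Proof.
move=> xM; rewrite linE normrM normfV (gtr0_norm a0) ler_pM2r ?invr_gt0//.
by rewrite (le_trans (ler_normB _ _))// lerD2r.
Qed.

Let S0 : 0 < Y + 1 + t + r.
Proof. by have := Y0; move: t0 r0; lra. Qed.

Let e0 : 0 < e.
Proof. by rewrite invr_gt0 mulr_gt0. Qed.

Let eM : e * (Y + 1 + t + r) = 4^-1.
Proof.
by rewrite /e invfM -mulrA mulVf ?mulr1// gt_eqF.
Qed.

(** The sum of the u^(k+1) h(k), by partial fractions. *)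
Let F (u : C) : C := u / ((1 - t%:C * u) * (1 + r%:C * u)).
(** Equals u ([zz u] - x) / a, and is the reciprocal of the generating function of the Chebyshev
    polynomials at [lin.[x]]. *)
Let Q (u : C) (x : R) : C := 1 - u * (lin.[x])%:C + u ^+ 2.
Let rem (u : C) (N : nat) (x : R) : C :=
  u ^+ N.+1 * (((chebV R N.+1).[lin.[x]])%:C - u * ((chebV R N).[lin.[x]])%:C) / Q u x
  - u ^+ N.+1 / (t + r)%:C * ((t * t ^+ N)%:C / (1 - t%:C * u)
       + (r * (- r) ^+ N)%:C / (1 + r%:C * u)).

Let small u : nm u < e -> [/\ nm u * (Y + 1) <= 4^-1, nm u <= 4^-1,
  nm u * t <= 4^-1 & nm u * r <= 4^-1].
Proof.
move=> ue; have u0 := nm_ge0 u.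
have : nm u * (Y + 1 + t + r) <= 4^-1.
  by rewrite -eM ler_wpM2r// ltW.
rewrite !mulrDr mulr1.
have : 0 <= nm u * Y by rewrite mulr_ge0.
have : 0 <= nm u * t by rewrite mulr_ge0// ltW.
have : 0 <= nm u * r by rewrite mulr_ge0// ltW.
move: (nm u * Y) (nm u * t) (nm u * r) u0 => A1 A2 A3; move: (nm u) => A4.
by move=> ? ? ? ? ?; split; lra.
Qed.

Let den_t u : nm u < e -> 2^-1 <= nm (1 - t%:C * u).
Proof.
case/small => _ _ h1 _; apply: nm1B_ge.
rewrite nmM nm_real gtr0_norm// mulrC (le_trans h1)//.
by rewrite lef_pV2 ?posrE// ler_nat.
Qed.

Let den_r u : nm u < e -> 2^-1 <= nm (1 + r%:C * u).
Proof.
case/small => _ _ _ h1; rewrite -[_ * _]opprK; apply: nm1B_ge.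
rewrite nmN nmM nm_real gtr0_norm// mulrC (le_trans h1)//.
by rewrite lef_pV2 ?posrE// ler_nat.
Qed.

Let den_Q u x : nm u < e -> `|x| <= M -> 2^-1 <= nm (Q u x).
Proof.
case/small => h1 h2 _ _ /linY xY; have -> : Q u x = 1 - (u * (lin.[x])%:C - u ^+ 2) by rewrite /Q; ring.
apply: nm1B_ge.
rewrite (le_trans (nmB _ _))// nmM nm_real nmX expr2.
have u0 := nm_ge0 u.
have : nm u * `|lin.[x]| <= nm u * Y by rewrite ler_wpM2l.
have : nm u * nm u <= nm u * 4^-1 by rewrite ler_wpM2l.
move: h1; rewrite mulrDr mulr1.
move: (nm u * `|_|) (nm u * nm u) (nm u * Y) h2 u0 => A1 A2 A3.
by move: (nm u) => A4; lra.
Qed.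

Let nz (z : C) : 2^-1 <= nm z -> z != 0.
Proof. by move=> hz; apply: nm_neq0; apply: lt_le_trans hz; rewrite invr_gt0. Qed.

(** An exact identity for every N, obtained from the two finite generating functions, so no infinite
    series is integrated. By [moments] each term of the sum has integral 0. *)
Let expansion u N x : nm u < e -> `|x| <= M ->
  u / Q u x - F u =
  (\sum_(k < N) u ^+ k.+1 * ((chebV R k.+1).[lin.[x]] - h k)%:C) + rem u N x.
Proof.
move=> ue xM; have dQ := nz (den_Q ue xM).
have dt := nz (den_t ue); have dr := nz (den_r ue).
have tr : (t + r)%:C != 0 by rewrite fmorph_eq0 gt_eqF// addr_gt0.
pose S1 : C := \sum_(k < N) u ^+ k * ((chebV R k.+1).[lin.[x]])%:C.
pose S2 : C := \sum_(k < N) u ^+ k * t%:C ^+ k.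
pose S3 : C := \sum_(k < N) u ^+ k * (- r%:C) ^+ k.
have -> : \sum_(k < N) u ^+ k.+1 * ((chebV R k.+1).[lin.[x]] - h k)%:C =
    u * (S1 - (t%:C * S2 + r%:C * S3) / (t + r)%:C).
  rewrite /S1 /S2 /S3 !mulr_sumr -big_split/= mulr_suml -sumrB mulr_sumr.
  apply: eq_bigr => k _; rewrite /h rmorphB/= fmorph_div/= !rmorphD/= !rmorphM/=.
  rewrite !rmorphXn/= rmorphN/= exprS; field.
  by rewrite -rmorphD.
have e1 : S1 = (1 - u ^+ N * ((chebV R N.+1).[lin.[x]])%:C
    + u ^+ N.+1 * ((chebV R N).[lin.[x]])%:C) / Q u x.
  by rewrite -chebV_gen mulrAC divff// mul1r.
have e2 : S2 = (1 - u ^+ N * t%:C ^+ N) / (1 - t%:C * u).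
  by rewrite -geom_gen mulrAC divff// mul1r.
have e3 : S3 = (1 - u ^+ N * (- r%:C) ^+ N) / (1 + r%:C * u).
  have E : 1 + r%:C * u = 1 - - r%:C * u by rewrite mulNr opprK.
  by rewrite E -geom_gen mulrAC divff -?E// mul1r.
rewrite e1 e2 e3 /rem /F !rmorphM/= !rmorphXn/= !rmorphN/= !exprS rmorphD/=.
move: tr dQ dt dr; rewrite rmorphD/=.
move: (t%:C) (r%:C) (Q u x) => tc rc q tr dQ dt dr.
by field; rewrite dQ dt dr tr.
Qed.

Let rem_bound u N x : nm u < e -> `|x| <= M -> nm (rem u N x) <= 4 * 4^-1 ^+ N.
Proof.
move=> ue xM; have [h1 h2 h3 h4] := small ue; have u0 := nm_ge0 u.
have dQ := den_Q ue xM; have dt := den_t ue; have dr := den_r ue.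
have inv2 z : 2^-1 <= nm z -> nm z^-1 <= 2.
  move=> hz; rewrite nmV -[leRHS]invrK lef_pV2 ?posrE ?invr_gt0//.
  by apply: lt_le_trans hz; rewrite invr_gt0.
have tr0 : 0 < t + r by rewrite addr_gt0.
have pw (c : R) : 0 <= c -> nm u * c <= 4^-1 -> nm u ^+ N * c ^+ N <= 4^-1 ^+ N.
  by move=> c0 hc; rewrite -exprMn lerXn2r ?nnegrE ?mulr_ge0 ?invr_ge0.
have q0 : 0 <= 4^-1 ^+ N :> R by rewrite exprn_ge0// invr_ge0.
apply: le_trans (nmB _ _) _.
have b1 : nm (u ^+ N.+1 * (((chebV R N.+1).[lin.[x]])%:C -
     u * ((chebV R N).[lin.[x]])%:C) / Q u x) <= 2 * 4^-1 ^+ N.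
  rewrite nmM mulrC; apply: ler_pM; rewrite ?nm_ge0 ?inv2// nmM nmX.
  have cN k := chebV_bound k Y0 (linY xM).
  have : nm (((chebV R N.+1).[lin.[x]])%:C - u * ((chebV R N).[lin.[x]])%:C) <=
      (Y + 1) ^+ N.+1 + nm u * (Y + 1) ^+ N.
    apply: le_trans (nmB _ _) _; rewrite nmM !nm_real.
    by rewrite lerD// ler_wpM2l.
  move=> /(ler_wpM2l (exprn_ge0 N.+1 u0)) /le_trans; apply.
  have -> : nm u ^+ N.+1 * ((Y + 1) ^+ N.+1 + nm u * (Y + 1) ^+ N) =
    (nm u * (Y + 1) + nm u * nm u) * (nm u ^+ N * (Y + 1) ^+ N).
    by rewrite !exprS; ring.
  have p1 : nm u ^+ N * (Y + 1) ^+ N <= 4^-1 ^+ N by apply: pw; rewrite ?addr_ge0.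
  rewrite -[leRHS]mul1r; apply: ler_pM => //.
  - by rewrite !addr_ge0 ?mulr_ge0 ?addr_ge0.
  - by rewrite mulr_ge0 ?exprn_ge0 ?addr_ge0.
  have : nm u * nm u <= 4^-1 * 4^-1 by apply: ler_pM.
  by move: (nm u * nm u) (nm u * (Y + 1)) h1 => A1 A2; lra.
have b2 : nm (u ^+ N.+1 / (t + r)%:C * ((t * t ^+ N)%:C / (1 - t%:C * u)
       + (r * (- r) ^+ N)%:C / (1 + r%:C * u))) <= 2 * 4^-1 ^+ N.
  have c1 : nm ((t * t ^+ N)%:C / (1 - t%:C * u)
       + (r * (- r) ^+ N)%:C / (1 + r%:C * u)) <= 2 * (t * t ^+ N + r * r ^+ N).
    apply: le_trans (nmD _ _) _; rewrite !nmM !nm_real !normrM !normrX normrN.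
    rewrite (gtr0_norm t0) (gtr0_norm r0) mulrDr lerD// mulrC.
      by apply: ler_pM; rewrite ?inv2 ?nm_ge0// mulr_ge0 ?exprn_ge0// ltW.
    by apply: ler_pM; rewrite ?inv2 ?nm_ge0// mulr_ge0 ?exprn_ge0// ltW.
  rewrite nmM (le_trans (ler_wpM2l (nm_ge0 _) c1))//.
  rewrite nmM nmX nmV nm_real (gtr0_norm tr0).
  have -> : nm u ^+ N.+1 / (t + r) * (2 * (t * t ^+ N + r * r ^+ N)) =
    2 * (nm u * ((t * (nm u ^+ N * t ^+ N) + r * (nm u ^+ N * r ^+ N)) / (t + r))).
    by rewrite exprS; ring.
  rewrite ler_pM2l// -[leRHS]mul1r; apply: ler_pM => //.
  - rewrite divr_ge0 ?(ltW tr0)//.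
    by rewrite addr_ge0// !mulr_ge0 ?exprn_ge0// ltW.
  - by rewrite (le_trans h2)// invf_le1// ler1n.
  by rewrite ler_pdivrMr// mulrDr lerD// [leRHS]mulrC ler_pM2l//; apply: pw => //; exact: ltW.
by move: (lerD b1 b2); rewrite -mulrDl -natrD.
Qed.

Let zz (u : C) : C := a%:C * (u + u^-1) + b%:C.

Let resolventE u x : u != 0 -> nm u < e -> `|x| <= M ->
  (zz u - x%:C)^-1 = (a^-1)%:C * (u / Q u x).
Proof.
move=> un ue xM; have dQ := nz (den_Q ue xM).
have ac : a%:C != 0 by rewrite fmorph_eq0 gt_eqF.
have -> : zz u - x%:C = a%:C * (Q u x / u).
  have -> : x%:C = a%:C * (lin.[x])%:C + b%:C.
    by rewrite -rmorphM -rmorphD linE; congr (_%:C); field; rewrite gt_eqF.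
  by rewrite /zz /Q; field.
by rewrite invfM invf_div fmorphV.
Qed.

(** Treats real and imaginary part at once, as a real-linear functional bounded by the modulus.
    After integration the finite sum disappears, and the remainder can be made arbitrarily small. *)
Let coordinate (phi : C -> R) u :
  (forall z w, phi (z + w) = phi z + phi w) ->
  (forall z x, phi (z * x%:C) = phi z * x) ->
  (forall z, `|phi z| <= nm z) ->
  measurable_fun setT (fun x : R => phi ((zz u - x%:C)^-1)) ->
  u != 0 -> nm u < e ->
  \int[nu]_x phi ((zz u - x%:C)^-1) = phi ((a^-1)%:C * F u).
Proof.
move=> pD pZ pb mphi un ue.
have phi0 : phi 0 = 0 by have := pZ 0 0; rewrite !mulr0.
(* The image of the finite sum under phi, as a real polynomial in x. *)
pose P N : {poly R} := \sum_(k < N) phi (u ^+ k.+1) *: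
  ((chebV R k.+1 \Po lin) - (h k)%:P).
have iP N : nu.-integrable setT (EFin \o (fun x => (P N).[x])).
  exact: supp_integrable_horner nuM.
have P0 N : \int[nu]_x (P N).[x] = 0.
  elim: N => [|N IH].
    rewrite -[RHS](prob_Rintegral_cst nu); apply: eq_Rintegral => x _.
    by rewrite /P big_ord0 horner0.
  pose q : {poly R} := (chebV R N.+1 \Po lin) - (h N)%:P.
  have iq : nu.-integrable setT (EFin \o (fun x => q.[x])).
    exact: supp_integrable_horner nuM.
  have q0 : \int[nu]_x q.[x] = 0.
    have i1 : nu.-integrable setT (EFin \o (fun x => (chebV R N.+1 \Po lin).[x])).
      exact: supp_integrable_horner nuM.
    have i2 := prob_integrable_cst nu (h N).
    transitivity (\int[nu]_x ((chebV R N.+1 \Po lin).[x] - h N)).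
      by apply: eq_Rintegral => x _; rewrite /q !hornerE.
    by rewrite RintegralB// moments prob_Rintegral_cst subrr.
  transitivity (\int[nu]_x ((P N).[x] + phi (u ^+ N.+1) * q.[x])).
    by apply: eq_Rintegral => x _; rewrite /P big_ord_recr/= hornerD hornerZ.
  rewrite RintegralD//; last exact: (integrableZl measurableT _ iq).
  by rewrite RintegralZl// IH q0 mulr0 addr0.
have PE N x : (P N).[x] =
    phi (\sum_(k < N) u ^+ k.+1 * ((chebV R k.+1).[lin.[x]] - h k)%:C).
  elim: N => [|N IH]; first by rewrite /P !big_ord0 horner0 phi0.
  rewrite /P !big_ord_recr/= hornerD pD -IH hornerZ pZ.
  by rewrite hornerD hornerN hornerC horner_comp.
apply/eqP; rewrite -subr_eq0; apply/eqP.
apply: (@geometric_bound_eq0 _ _ (a^-1 * 4)) => N.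
have key x : `|x| <= M -> phi ((zz u - x%:C)^-1) =
    phi ((a^-1)%:C * F u) + a^-1 * (P N).[x] + a^-1 * phi (rem u N x).
  move=> xM; rewrite resolventE// PE.
  have -> : u / Q u x = F u + (u / Q u x - F u) by ring.
  rewrite (expansion N ue xM).
  by rewrite ![(a^-1)%:C * _]mulrC !pZ !pD; ring.
have ia : nu.-integrable setT (EFin \o (fun x => phi ((zz u - x%:C)^-1))).
  have [c hc] := horner_bounded (P N) M.
  apply: (supp_integrable nuM mphi
    (c := `|phi ((a^-1)%:C * F u)| + a^-1 * c + a^-1 * (4 * 4^-1 ^+ N))).
  move=> x xM; rewrite key//.
  apply: le_trans (ler_normD _ _) _; apply: lerD.
    apply: le_trans (ler_normD _ _) _; rewrite lerD2l normrM.
    rewrite gtr0_norm ?invr_gt0// ler_pM2l ?invr_gt0//; exact: hc.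
  rewrite normrM gtr0_norm ?invr_gt0// ler_pM2l ?invr_gt0//.
  exact: le_trans (pb _) (rem_bound N ue xM).
have ic := prob_integrable_cst nu (phi ((a^-1)%:C * F u)).
have iaP := integrableZl measurableT a^-1 (iP N).
pose D x := phi ((zz u - x%:C)^-1) - phi ((a^-1)%:C * F u) - a^-1 * (P N).[x].
have -> : \int[nu]_x phi ((zz u - x%:C)^-1) - phi ((a^-1)%:C * F u) =
    \int[nu]_x D x.
  rewrite /D RintegralB//; last exact: (integrableB measurableT ia ic).
  rewrite RintegralB// prob_Rintegral_cst RintegralZl//.
  by rewrite P0 mulr0 subr0.
rewrite -mulrA; apply: (supp_Rintegral_bound nuM).
  apply: measurable_funB; first exact: measurable_funB.
  by apply: measurable_funM => //; exact: measurable_horner.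
move=> x xM; have -> : D x = a^-1 * phi (rem u N x) by rewrite /D key//; ring.
rewrite normrM gtr0_norm ?invr_gt0// ler_pM2l ?invr_gt0//.
exact: le_trans (pb _) (rem_bound N ue xM).
Qed.

Lemma cauchy_of_chebyshev_moments : exists2 d : R, 0 < d &
  forall u : C, u != 0 -> nm u < d ->
  cauchy_transform nu (a%:C * (u + u^-1) + b%:C) =
  (a^-1)%:C * (u / ((1 - t%:C * u) * (1 + r%:C * u))).
Proof.
exists e => // u un ue; rewrite /cauchy_transform -/(zz u) -/(F u).
have hR := @coordinate (@complex.Re R) u.
have hI := @coordinate (@complex.Im R) u.
rewrite hR//; last 4 first.
- exact: ReD.
- by move=> [x1 x2] x /=; rewrite !mulr0 subr0.
- exact: Re_le_nm.
- exact: measurable_Re_inv.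
rewrite hI//; last 4 first.
- by move=> [x1 x2] [y1 y2].
- by move=> [x1 x2] x /=; rewrite !mulr0 add0r.
- exact: Im_le_nm.
- exact: measurable_Im_inv.
by case: (_ * F u).
Qed.

End ChebyshevSeries.

(** * The explicit form of the free powers *)

Section Moments.
Variable R : realType.

Definition afflin (a b : R) : {poly R} := a^-1 *: 'X - (b / a)%:P.

Lemma fval_cheb (a b s : R) k : a != 0 ->
  fval a b s (horner (chebV R k.+1 \Po afflin a b)) = s ^+ k.
Proof.
move=> a0; rewrite -(arcmom_atom s k) /fval /arcmom.
have lE y : (afflin a b).[a * y + b] = y.
  by rewrite /afflin !hornerE; field; rewrite a0.
congr (_ + _ * _); last by rewrite horner_comp /atomx lE.
by apply: eq_arcint => x _; rewrite horner_comp /arcmap lE.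
Qed.

Lemma fmix_cheb (a b t r : R) (al0 : 0 <= t / (t + r))
    (al1 : 0 <= 1 - t / (t + r)) k : a != 0 -> t + r != 0 ->
  \int[fmix t (- r) a b al0 al1]_x (chebV R k.+1 \Po afflin a b).[x] =
  (t * t ^+ k + r * (- r) ^+ k) / (t + r).
Proof.
by move=> a0 tr0; rewrite fmix_poly !fval_cheb//; field.
Qed.

Lemma fval_cube (a b s : R) : a != 0 -> fval a b s (horner 'X^3) =
  a ^+ 3 * (s ^+ 3 + 2 * s) + 3 * a ^+ 2 * b * (s ^+ 2 + 1)
  + 3 * a * b ^+ 2 * s + b ^+ 3.
Proof.
move=> a0.
have h k : fval a b s (horner (chebV R k.+1 \Po afflin a b)) = s ^+ k.
  exact: fval_cheb.
have fvD (f g : {poly R}) (c : R) : fval a b s (horner (f + c *: g)) =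
    fval a b s (horner f) + c * fval a b s (horner g).
  have cp (p : {poly R}) : continuous (fun th => p.[arcmap a b th] * arcw s th).
    move=> x; apply: cvgM; last exact: continuous_arcw.
    apply: (@continuous_comp _ _ _ (arcmap a b)); first exact: continuous_arcmap.
    exact: continuous_horner.
  rewrite /fval !hornerE -addrA; rewrite (_ : arcint _ =
    arcint (fun th => f.[arcmap a b th] * arcw s th) +
    c * arcint (fun th => g.[arcmap a b th] * arcw s th)); first by ring.
  rewrite -arcintZ// -arcintD//.
    by apply: eq_arcint => x _; rewrite hornerD hornerZ mulrDl mulrA.
  by move=> x; apply: cvgM; [exact: cvg_cst|exact: cp].
(* Here (a y + b)^3 is expanded with y^2 = V3 + V1 and y^3 = V4 + 2 V2, where Vk is [chebV k]. The
   term V1 is split in two because [fvD] needs a leading summand without coefficient; hence the -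
   1. *)
have E : 'X^3 = (chebV R 1 \Po afflin a b) + (b ^+ 3 + 3 * a ^+ 2 * b - 1) *: (chebV R 1 \Po afflin a b)
    + (2 * a ^+ 3 + 3 * a * b ^+ 2) *: (chebV R 2 \Po afflin a b)
    + (3 * a ^+ 2 * b) *: (chebV R 3 \Po afflin a b)
    + (a ^+ 3) *: (chebV R 4 \Po afflin a b).
  rewrite /= !(comp_polyB, comp_polyM, comp_polyX, comp_polyC, rmorph1, rmorph0).
  have xE : 'X = a *: afflin a b + b%:P.
    rewrite /afflin scalerBr scalerA divff// scale1r -mul_polyC -polyCM.
    by rewrite mulrCA divff// mulr1 subrK.
  rewrite {1}xE; move: (afflin a b) => l.
  rewrite -!mul_polyC !(polyCD, polyCM, polyCB, polyC_exp, polyCN).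
  by ring.
rewrite E !fvD !h; ring.
Qed.

End Moments.

(** * The explicit law: support, third moment and transform *)

Section ExplicitLaw.
Variables (R : realType) (p q : R).
Hypotheses (p0 : 0 < p) (q0 : 0 < q) (pq1 : p + q = 1).
Local Notation C := (R[i]).
Local Notation nm := (@Normc.normc R).
Local Notation "x %:C" := (x%:C)%C.

Definition vpar : R := (p * q)^-1.
Definition spar : R := (q - p) * vpar.

Lemma vpar_gt0 : 0 < vpar. Proof. by rewrite invr_gt0 mulr_gt0. Qed.

Lemma vpar_ge1 : 1 <= vpar.
Proof.
rewrite -[X in X <= _]invr1 lef_pV2 ?posrE ?mulr_gt0// -pq1.
have : p * q <= p by rewrite ler_piMr ?ltW//; move: pq1 p0; lra.
by move: q0; move: (p * q) => x; lra.
Qed.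

Lemma sparE : spar = p^-1 - q^-1.
Proof. by rewrite /spar /vpar; field; rewrite !gt_eqF. Qed.

Lemma spar_le : `|spar| <= vpar.
Proof.
rewrite normrM (gtr0_norm vpar_gt0) ler_piMl ?(ltW vpar_gt0)//.
by rewrite ler_norml; move: p0 q0 pq1 => *; apply/andP; split; lra.
Qed.

Section Level.
Variable m : nat.

(* The level [m] is that of the free power with [m.+2] factors. *)
Definition kap : R := Num.sqrt (m.+1%:R * (p * q)).

Lemma kap_gt0 : 0 < kap.
Proof. by rewrite sqrtr_gt0 !mulr_gt0. Qed.

Lemma kap2 : kap ^+ 2 = m.+1%:R * (p * q).
Proof. by rewrite sqr_sqrtr// ltW// !mulr_gt0. Qed.

Definition tpar : R := q / kap.
Definition rpar : R := p / kap.
Definition sigpar : R := m.+1%:R / kap.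

Lemma tpar_gt0 : 0 < tpar. Proof. by rewrite divr_gt0// kap_gt0. Qed.
Lemma rpar_gt0 : 0 < rpar. Proof. by rewrite divr_gt0// kap_gt0. Qed.
Lemma sigpar_gt0 : 0 < sigpar. Proof. by rewrite divr_gt0// kap_gt0. Qed.

Lemma tpar_rpar : tpar + rpar = kap^-1.
Proof. by rewrite -mulrDl (addrC q) pq1 mul1r. Qed.

Lemma weight_tpar : tpar / (tpar + rpar) = q.
Proof. by rewrite tpar_rpar invrK divfK// gt_eqF// kap_gt0. Qed.

Let al0 : 0 <= tpar / (tpar + rpar). Proof. by rewrite weight_tpar ltW. Qed.

Let al1 : 0 <= 1 - tpar / (tpar + rpar).
Proof. by rewrite weight_tpar -pq1 addrK ltW. Qed.

Definition fpow : realProb R := fmix tpar (- rpar) sigpar (- spar) al0 al1.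

Let M1 : m.+1%:R != 0 :> R. Proof. by rewrite pnatr_eq0. Qed.

Lemma sigpar2 : sigpar ^+ 2 = m.+1%:R * vpar.
Proof.
rewrite /sigpar expr_div_n kap2 /vpar; move: (m.+1%:R) M1 => x x0.
by field; rewrite x0 !gt_eqF.
Qed.

Lemma tpar2 : tpar ^+ 2 = q / (m.+1%:R * p).
Proof.
rewrite /tpar expr_div_n kap2; move: (m.+1%:R) M1 => x x0.
by field; rewrite x0 !gt_eqF.
Qed.

Lemma rpar2 : rpar ^+ 2 = p / (m.+1%:R * q).
Proof.
rewrite /rpar expr_div_n kap2; move: (m.+1%:R) M1 => x x0.
by field; rewrite x0 !gt_eqF.
Qed.

Lemma sig_tpar : sigpar * tpar = p^-1.
Proof.
have k0 : kap != 0 by rewrite gt_eqF// kap_gt0.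
rewrite /tpar /sigpar mulrACA -invfM -expr2 kap2.
by move: (m.+1%:R) M1 => x x0; field; rewrite x0 !gt_eqF.
Qed.

Lemma sig_rpar : sigpar * rpar = q^-1.
Proof.
have k0 : kap != 0 by rewrite gt_eqF// kap_gt0.
rewrite /rpar /sigpar mulrACA -invfM -expr2 kap2.
by move: (m.+1%:R) M1 => x x0; field; rewrite x0 !gt_eqF.
Qed.

Lemma sig_tparV : sigpar / tpar = m.+1%:R / q.
Proof.
have k0 : kap != 0 by rewrite gt_eqF// kap_gt0.
by rewrite /tpar /sigpar; field; rewrite k0 gt_eqF.
Qed.

Lemma sig_rparV : sigpar / rpar = m.+1%:R / p.
Proof.
have k0 : kap != 0 by rewrite gt_eqF// kap_gt0.
by rewrite /rpar /sigpar; field; rewrite k0 gt_eqF.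
Qed.

(** With n = m.+2 factors, the atom sits at n times the atom 1/q of the two-point law; likewise
    below for - 1/p. *)
Lemma atomx_tpar : atomx tpar sigpar (- spar) = m.+2%:R / q.
Proof.
rewrite /atomx mulrDr sig_tpar sig_tparV sparE -[m.+2]addn1 natrD.
by move: (m.+1%:R) => x; field; rewrite !gt_eqF.
Qed.

Lemma atomx_rpar : atomx (- rpar) sigpar (- spar) = - (m.+2%:R / p).
Proof.
rewrite /atomx invrN -opprD mulrN mulrDr sig_rpar sig_rparV sparE.
rewrite -[m.+2]addn1 natrD.
by move: (m.+1%:R) => x; field; rewrite !gt_eqF.
Qed.

Let N : R := Num.sqrt m.+2%:R.

Let N2 : N ^+ 2 = m.+2%:R. Proof. by rewrite sqr_sqrtr. Qed.

Let N1 : 1 <= N.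
Proof.
by rewrite -(@ler_pXn2r _ 2)// ?nnegrE ?sqrtr_ge0// N2 expr1n ler1n.
Qed.

(** The arc part reaches at most 2 [sigpar] + |s|, of order sqrt(n). An atom lies at distance n/q or
    n/p, but has positive weight only if n p < 1, respectively n q < 1; then sqrt(n) p, respectively
    sqrt(n) q, is at most 1, and the distance is at most v sqrt(n). *)
Lemma fpow_supp : supp_in fpow (3 * vpar * N).
Proof.
have v1 := vpar_ge1; have v0 := vpar_gt0.
have N0 : 0 < N by apply: lt_le_trans N1.
have vN : vpar <= vpar * N by rewrite ler_peMr// ltW.
have vN0 : 0 < vpar * N by rewrite mulr_gt0.
have atom (x y : R) : 0 < x -> 0 < y -> vpar = (x * y)^-1 -> m.+2%:R * x < 1 ->
    m.+2%:R / y <= 3 * vpar * N.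
  move=> x0 y0 vE hx.
  have Nx : N * x <= 1.
    rewrite (le_trans _ (ltW hx))// ler_pM2r// -N2 expr2 ler_peMr//.
    exact: ltW.
  apply: (@le_trans _ _ (vpar * N)); last first.
    by rewrite -mulrA ler_peMl ?(ltW vN0)// ler1n.
  have -> : vpar * N = N / x / y by rewrite vE invfM; ring.
  by rewrite ler_pM2r ?invr_gt0// ler_pdivlMr// -N2 expr2 -mulrA ler_piMr// ltW.
apply: fmix_supp.
- move=> th; rewrite /arcmap (le_trans (ler_normD _ _))// normrN.
  apply: (@le_trans _ _ (2 * sigpar + vpar)).
    rewrite lerD ?spar_le// normrM (gtr0_norm sigpar_gt0) mulrC ler_pM2r ?sigpar_gt0//.
    by rewrite normrM ger0_norm// -[leRHS]mulr1 ler_pM2l// cos_max.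
  have sN : sigpar <= vpar * N.
    rewrite -(@ler_pXn2r _ 2)// ?nnegrE ?(ltW sigpar_gt0) ?(ltW vN0)//.
    rewrite sigpar2 exprMn N2 expr2 mulrC -mulrA ler_pM2l//.
    rewrite (le_trans (y := m.+2%:R))// ?ler_nat// ler_peMl//.
  by move: sN vN; rewrite -mulrA; move: sigpar (vpar * N) vpar => x y z; lra.
- move=> h; rewrite atomx_tpar ger0_norm ?divr_ge0 ?(ltW q0)//.
  apply: (atom p) => //.
  move: h; rewrite /atomw; case: ifPn; rewrite ?ltxx// -ltNge tpar2 => h _.
  move: h; rewrite ltr_pdivlMr ?mulr_gt0// mul1r => h.
  rewrite -[m.+2]addn1 natrD mulrDl mul1r.
  by move: h pq1; move: (m.+1%:R * p) => y; lra.
- move=> h; rewrite atomx_rpar normrN ger0_norm ?divr_ge0 ?(ltW p0)//.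
  apply: (atom q) => //; first by rewrite mulrC.
  move: h; rewrite /atomw sqrrN; case: ifPn; rewrite ?ltxx// -ltNge rpar2 => h _.
  move: h; rewrite ltr_pdivlMr ?mulr_gt0// mul1r => h.
  rewrite -[m.+2]addn1 natrD mulrDl mul1r.
  by move: h pq1; move: (m.+1%:R * q) => y; lra.
Qed.

(** This is n times the third moment of the two-point law: for centered laws the third moment is the
    third free cumulant, which is additive. *)
Lemma fpow_cube : \int[fpow]_x x ^+ 3 = - (m.+2%:R * vpar * spar).
Proof.
have s0 : sigpar != 0 by rewrite gt_eqF// sigpar_gt0.
transitivity (\int[fpow]_x ('X^3 : {poly R}).[x]).
  by apply: eq_Rintegral => x _; rewrite hornerXn.
rewrite fmix_poly !fval_cube//.
have -> : 1 - tpar / (tpar + rpar) = rpar / (tpar + rpar).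
  rewrite weight_tpar tpar_rpar invrK divfK; last by rewrite gt_eqF// kap_gt0.
  by rewrite -pq1 addrK.
have t0 := tpar_gt0; have r0 := rpar_gt0; have sg := sigpar_gt0.
have tE : tpar = p^-1 / sigpar by rewrite -sig_tpar mulrAC divff// mul1r.
have rE : rpar = q^-1 / sigpar by rewrite -sig_rpar mulrAC divff// mul1r.
(* To be used with A = 1/p, B = 1/q and x = [sigpar], so that A / x and B / x are the two parameters
   and A - B is s. *)
have cube (A B x : R) : x != 0 -> A + B != 0 ->
   A / x / (A / x + B / x) * (x ^+ 3 * ((A / x) ^+ 3 + 2 * (A / x))
     + 3 * x ^+ 2 * - (A - B) * ((A / x) ^+ 2 + 1)
     + 3 * x * (- (A - B)) ^+ 2 * (A / x) + (- (A - B)) ^+ 3)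
   + B / x / (A / x + B / x) * (x ^+ 3 * ((- (B / x)) ^+ 3 + 2 * (- (B / x)))
     + 3 * x ^+ 2 * - (A - B) * ((- (B / x)) ^+ 2 + 1)
     + 3 * x * (- (A - B)) ^+ 2 * (- (B / x)) + (- (A - B)) ^+ 3)
   = - ((x ^+ 2 + A * B) * (A - B)).
  move=> x0 AB.
  have -> : A / x / (A / x + B / x) = A / (A + B).
    by rewrite -mulrDl invfM invrK mulrACA mulVf// mulr1.
  have -> : B / x / (A / x + B / x) = B / (A + B).
    by rewrite -mulrDl invfM invrK mulrACA mulVf// mulr1.
  by field; rewrite ?x0 ?AB.
rewrite sparE tE rE cube//; last first.
  by rewrite gt_eqF// addr_gt0// invr_gt0.
rewrite sigpar2 -invfM -/vpar; congr (- (_ * _)).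
by rewrite -[m.+2%:R]natr1 mulrDl mul1r.
Qed.

Lemma fpow_param : param vpar%:C spar%:C m.+1 (cauchy_transform fpow).
Proof.
have k0 := kap_gt0; have s0 := sigpar_gt0.
have M0 : 0 < 3 * vpar * N.
  by rewrite !mulr_gt0 ?vpar_gt0// (lt_le_trans _ N1).
have [d d0 hd] := cauchy_of_chebyshev_moments M0 fpow_supp s0 tpar_gt0 rpar_gt0
  (fun k => fmix_cheb (- spar) al0 al1 k (lt0r_neq0 s0)
    (lt0r_neq0 (addr_gt0 tpar_gt0 rpar_gt0))).
have kc0 : kap%:C != 0 by rewrite fmorph_eq0 gt_eqF.
have pc0 : p%:C != 0 by rewrite fmorph_eq0 gt_eqF.
have qc0 : q%:C != 0 by rewrite fmorph_eq0 gt_eqF.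
have vE : vpar%:C = (p%:C * q%:C)^-1 by rewrite -rmorphM -fmorphV.
have sE : spar%:C = (q%:C - p%:C) * vpar%:C by rewrite -rmorphB -rmorphM.
have tE : tpar%:C = q%:C / kap%:C by rewrite -fmorphV -rmorphM.
have rE : rpar%:C = p%:C / kap%:C by rewrite -fmorphV -rmorphM.
have ME : m.+1%:R%:C = kap%:C ^+ 2 / (p%:C * q%:C).
  rewrite -rmorphXn kap2 -rmorphM -fmorphV -rmorphM; congr (_%:C).
  by rewrite mulfK// mulf_neq0// gt_eqF.
have gE : sigpar%:C = kap%:C / (p%:C * q%:C).
  rewrite /sigpar rmorphM fmorphV /= ME.
  by move: (kap%:C) kc0 (p%:C) pc0 (q%:C) qc0 => ? ? ? ? ? ?; field; apply/and3P.
exists (d / kap)%:C; first by rewrite ltcR divr_gt0.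
move=> xi /andP[]; rewrite normr_gt0 => x0.
rewrite normCE ltcR ltr_pdivlMr// => hx.
have u0 : kap%:C * xi != 0 by rewrite mulf_neq0.
have ud : nm (kap%:C * xi) < d by rewrite nmM nm_real gtr0_norm// mulrC.
have := hd _ u0 ud.
have -> : sigpar%:C * (kap%:C * xi + (kap%:C * xi)^-1) + (- spar)%:C =
    zpar vpar%:C spar%:C m.+1 xi.
  rewrite /zpar gE rmorphN/= vE.
  have -> : m.+1%:R = m.+1%:R%:C :> C by rewrite rmorph_nat.
  rewrite ME; move: (spar%:C) (kap%:C) kc0 (p%:C) pc0 (q%:C) qc0.
  by move=> s k kn P Pn Q Qn; field; rewrite ?kn ?Pn ?Qn ?x0.
move=> ->; rewrite /wpar.
have -> : vpar%:C - spar%:C * xi - xi ^+ 2 =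
    (p%:C * q%:C)^-1 * ((1 - tpar%:C * (kap%:C * xi)) * (1 + rpar%:C * (kap%:C * xi))).
  rewrite sE vE tE rE; move: (kap%:C) kc0 (p%:C) pc0 (q%:C) qc0.
  by move=> k kn P Pn Q Qn; field; rewrite ?kn ?Pn ?Qn.
set X := (1 - _) * _; rewrite fmorphV/= gE [in RHS]invfM [in RHS]invrK.
move: X^-1 => {}X.
move: (kap%:C) kc0 (p%:C) pc0 (q%:C) qc0 => k kn P Pn Q Qn.
by field; rewrite ?kn ?Pn ?Qn.
Qed.

End Level.
End ExplicitLaw.

(** * The two-point law and its free powers *)

Section TwoPoints.
Variables (R : realType) (p q : R) (mu : realProb R).
Hypotheses (p0 : 0 < p) (q0 : 0 < q) (pq1 : p + q = 1).
Hypotheses (mu_p : mu [set - p^-1] = p%:E) (mu_q : mu [set q^-1] = q%:E).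
Local Notation C := (R[i]).
Local Notation nm := (@Normc.normc R).
Local Notation "x %:C" := (x%:C)%C.
Local Notation v := (vpar p q).
Local Notation s := (spar p q).

Let ma : measurable ([set - p^-1] : set (measurableTypeR R)).
Proof. exact: measurable_set1. Qed.

Let mb : measurable ([set q^-1] : set (measurableTypeR R)).
Proof. exact: measurable_set1. Qed.

Let ab : [disjoint [set - p^-1] & [set q^-1] : set (measurableTypeR R)].
Proof.
apply/disj_setPS => x [/= -> h].
have : - p^-1 < q^-1.
  by rewrite (lt_trans (y := 0))// ?oppr_lt0 invr_gt0.
by rewrite h ltxx.
Qed.

Let mab : measurable ([set - p^-1] `|` [set q^-1] : set (measurableTypeR R)).
Proof. exact: measurableU. Qed.

Lemma two_points_null : mu (~` ([set - p^-1] `|` [set q^-1])) = 0%E.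
Proof.
rewrite probability_setC// measureU//; last exact/disj_set2P.
rewrite [X in (1 - X)%E](_ : _ = p%:E + q%:E)%E; last by congr (_ + _)%E.
by rewrite -(EFinD p q) pq1 -EFinB subrr.
Qed.

Let pV : p^-1 <= v.
Proof.
rewrite /vpar lef_pV2 ?posrE ?mulr_gt0// ler_piMr ?ltW//.
by move: pq1 p0; lra.
Qed.

Let qV : q^-1 <= v.
Proof.
rewrite /vpar lef_pV2 ?posrE ?mulr_gt0// ler_piMl ?ltW//.
by move: pq1 q0; lra.
Qed.

Lemma two_points_supp M : v <= M -> supp_in mu M.
Proof.
move=> vM; apply/eqP; rewrite -measure_le0 -two_points_null.
apply: le_measure; rewrite ?inE//.
- by apply: measurableC; exact: measurable_itv.
- exact: measurableC.
apply: subsetC => x /= [->|->]; rewrite in_itv/= -ler_norml ?normrN.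
  by rewrite ger0_norm ?invr_ge0 ?(ltW p0)// (le_trans pV).
by rewrite ger0_norm ?invr_ge0 ?(ltW q0)// (le_trans qV).
Qed.

Lemma two_points_Rintegral (f : R -> R) : mu.-integrable setT (EFin \o f) ->
  \int[mu]_x f x = f (- p^-1) * p + f q^-1 * q.
Proof.
move=> fi.
have E : \int[mu]_x f x = \int[mu]_(x in [set - p^-1] `|` [set q^-1]) f x.
  rewrite /Rintegral (@negligible_integral _ _ _ mu setT
    (~` ([set - p^-1] `|` [set q^-1])))//.
  - by rewrite setTD setCK.
  - exact: measurableC.
  - exact: two_points_null.
rewrite E Rintegral_setU//; last exact: integrableS fi.
congr (_ + _).
  transitivity (\int[mu]_(x in [set - p^-1]) f (- p^-1)).
    by apply: eq_Rintegral => x; rewrite inE => ->.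
  by rewrite Rintegral_cst//; congr (_ * _); exact: (congr1 fine mu_p).
transitivity (\int[mu]_(x in [set q^-1]) f q^-1).
  by apply: eq_Rintegral => x; rewrite inE => ->.
by rewrite Rintegral_cst//; congr (_ * _); exact: (congr1 fine mu_q).
Qed.

Lemma two_points_cube : \int[mu]_x x ^+ 3 = - (v * s).
Proof.
have := supp_integrable_horner 'X^3 (two_points_supp (lexx v)).
under eq_fun do rewrite hornerXn.
move=> /two_points_Rintegral ->; rewrite sparE// /vpar.
have -> : q = 1 - p by rewrite -pq1 addrAC subrr add0r.
have p1 : 1 - p != 0 by rewrite -pq1 addrAC subrr add0r gt_eqF.
by field; rewrite p1 gt_eqF.
Qed.

Lemma two_points_param : param v%:C s%:C 0 (cauchy_transform mu).
Proof.
have v0 := vpar_gt0 p0 q0.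
have vc0 : 0 < v%:C by rewrite ltcR.
(* The number v bounds 1/p and 1/q, so |z| > v keeps z off both atoms. *)
have [e e0 he] := zpar_large s%:C vc0 0 vc0.
exists e => // xi hxi; have := he _ hxi; rewrite normCE ltcR.
case/andP: hxi; rewrite normr_gt0 => x0 _.
set z := zpar _ _ _ _ => hz.
have sv := two_points_supp (lexx v).
have zt (t : R) : `|t| <= v -> z - t%:C != 0.
  move=> tv; apply: nm_neq0; apply: lt_le_trans (nmB_ge z tv).
  by rewrite subr_gt0.
have n1 : `|- p^-1| <= v by rewrite normrN gtr0_norm ?invr_gt0.
have n2 : `|q^-1| <= v by rewrite gtr0_norm ?invr_gt0.
rewrite /cauchy_transform (two_points_Rintegral (integrable_Re_inv sv hz)).
rewrite (two_points_Rintegral (integrable_Im_inv sv hz)).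
have d1 := zt _ n1; have d2 := zt _ n2.
transitivity ((z - (- p^-1)%:C)^-1 * p%:C + (z - (q^-1)%:C)^-1 * q%:C).
  case: (_^-1) => x1 y1; case: (_^-1) => x2 y2.
  by apply/eqP; rewrite eq_complex /= !mulr0 !subr0 !add0r !eqxx.
have pc0 : p%:C != 0 by rewrite fmorph_eq0 gt_eqF.
have qc0 : q%:C != 0 by rewrite fmorph_eq0 gt_eqF.
have vE : v%:C = (p%:C * q%:C)^-1 by rewrite -rmorphM -fmorphV.
have sE : s%:C = p%:C^-1 - q%:C^-1.
  by rewrite -!fmorphV -rmorphB sparE.
have E1 : z - (- p^-1)%:C = (1 + p%:C * xi) / (p%:C * q%:C * xi).
  rewrite /z /zpar vE sE rmorphN/= fmorphV/= mul0r addr0.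
  by move: (p%:C) pc0 (q%:C) qc0 => P Pn Q Qn; field; rewrite ?Pn ?Qn ?x0.
have E2 : z - (q^-1)%:C = (1 - q%:C * xi) / (p%:C * q%:C * xi).
  rewrite /z /zpar vE sE fmorphV/= mul0r addr0.
  by move: (p%:C) pc0 (q%:C) qc0 => P Pn Q Qn; field; rewrite ?Pn ?Qn ?x0.
have f1 : 1 + p%:C * xi != 0.
  by apply: contraNneq d1 => h; rewrite E1 h mul0r.
have f2 : 1 - q%:C * xi != 0.
  by apply: contraNneq d2 => h; rewrite E2 h mul0r.
have pqc : p%:C + q%:C = 1 by rewrite -rmorphD pq1.
rewrite E1 E2 /wpar.
have -> : v%:C - s%:C * xi - xi ^+ 2 =
    (1 + p%:C * xi) * (1 - q%:C * xi) / (p%:C * q%:C).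
  rewrite vE sE.
  by move: (p%:C) pc0 (q%:C) qc0 => P Pn Q Qn; field; rewrite ?Pn ?Qn ?x0.
rewrite !invf_div.
transitivity (xi * (p%:C * q%:C) * (p%:C + q%:C) / ((1 + p%:C * xi) * (1 - q%:C * xi))).
  move: f1 f2 pc0 qc0; move: (p%:C) (q%:C) => P Q f1 f2 Pn Qn.
  by field; rewrite f1 f2.
by rewrite pqc mulr1 -mulrA.
Qed.

(** The induction keeps just what [param_step] consumes; the free powers are compared with the
    explicit laws only afterwards. *)
Lemma power_param k : let nu := free_convolution_power mu k.+1 in
  compactly_supported nu /\ param v%:C s%:C k (cauchy_transform nu).
Proof.
have v0 := vpar_gt0 p0 q0.
have vc0 : 0 < v%:C by rewrite ltcR.
rewrite /free_convolution_power /=; elim: k => [|k [cs pk]] /=.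
  split; last exact: two_points_param.
  by apply/compactly_supportedP; exists v => //; exact: two_points_supp.
set nu := iter _ _ _ in cs pk *.
(* Without an element in the set, the value of [get] would be arbitrary. The law [fpow] at level k
   has k.+2 factors, one more than [nu]. *)
have ex : exists nu', is_free_convolution nu mu nu'.
  exists (fpow p0 q0 pq1 k); split.
    apply/compactly_supportedP; exists (3 * v * Num.sqrt k.+2%:R).
      by rewrite !mulr_gt0// sqrtr_gt0.
    exact: fpow_supp.
  exists (zpar v%:C s%:C k \o wroot v%:C s%:C), (zpar v%:C s%:C 0 \o wroot v%:C s%:C),
    (zpar v%:C s%:C k.+1 \o wroot v%:C s%:C); split.
  - exact/is_K_functionP/param_Kgerm.
  - exact/is_K_functionP/param_Kgerm/two_points_param.
  - exact/is_K_functionP/param_Kgerm/fpow_param.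
  have [e e0 he] := wroot_zparS s%:C vc0 k.
  have eE : e = (complex.Re e)%:C by rewrite RRe_real// gtr0_real.
  exists (complex.Re e); first by rewrite -ltcR -eE.
  by move=> w; rewrite -eE; exact: he.
have [cs' [K1 [K2 [K [h1 h2 h3 [e e0 he]]]]]] := getPex ex.
split; first exact: cs'.
move/is_K_functionP : h1 => h1; move/is_K_functionP : h2 => h2.
move/is_K_functionP : h3 => h3.
have ec0 : 0 < e%:C by rewrite ltcR.
have [M M0 hM] := (compactly_supportedP _).1 cs'.
apply: (param_step vc0 pk two_points_param h1 h2 h3 ec0 he).
exact: cauchy_decays M0 hM.
Qed.

(** Both laws have the same [param], and every large real z lies on the common curve, so the two
    transforms agree there and [eq_cdf] applies. *)
Lemma power_cdf k y :
  free_convolution_power mu k.+2 `]-oo, y]%classic = fpow p0 q0 pq1 k `]-oo, y]%classic.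
Proof.
have v0 := vpar_gt0 p0 q0.
have vc0 : 0 < v%:C by rewrite ltcR.
have [/compactly_supportedP[M1 M10 s1] [e1 e10 h1]] := power_param k.+1.
have s2 := fpow_supp p0 q0 pq1 k; have [e2 e20 h2] := fpow_param p0 q0 pq1 k.
set M2 := 3 * _ * _ in s2.
have M20 : 0 < M2 by rewrite !mulr_gt0// sqrtr_gt0.
have supp_le (nu : realProb R) (a b : R) : supp_in nu a -> a <= b -> supp_in nu b.
  move=> sa ab'; apply/eqP; rewrite -measure_le0 -sa; apply: le_measure; rewrite ?inE//.
  - by apply: measurableC; exact: measurable_itv.
  - by apply: measurableC; exact: measurable_itv.
  apply: subsetC => x /=; rewrite !in_itv/= -!ler_norml => /le_trans; exact.
apply: (@eq_cdf _ _ _ (M1 + M2)).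
- by rewrite addr_gt0.
- by apply: (supp_le _ _ _ s1); rewrite lerDl ltW.
- by apply: (supp_le _ _ _ s2); rewrite lerDr ltW.
pose e := e1 * e2 / (e1 + e2).
have ee : 0 < e1 + e2 by rewrite addr_gt0.
have e0 : 0 < e by rewrite divr_gt0// mulr_gt0.
have l1 : e <= e1 by rewrite ler_pdivrMr// ler_wpM2l ?ltW// ltrDr.
have l2 : e <= e2 by rewrite ler_pdivrMr// mulrC ler_wpM2l ?ltW// ltrDl.
have [r r0 hr] := zpar_surj s%:C vc0 k.+1 e0.
exists (complex.Re r) => z hz.
have [|xi /andP[x0 xe] <-] := hr z%:C.
  rewrite normCE nm_real (lt_le_trans (y := z%:C))//; last by rewrite lecR ler_norm.
  by rewrite -(RRe_real (gtr0_real r0)) ltcR.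
by rewrite h1 ?x0 ?(lt_le_trans xe)// h2 ?x0 ?(lt_le_trans xe).
Qed.

End TwoPoints.

(** * Distance to the semicircle law *)

Section CubicMoment.
Variable R : realType.
Local Notation lam := (@lebesgue_measure R).

Lemma cube_root (y : R) : exists c, c ^+ 3 = y.
Proof.
have h (z : R) : 0 <= z -> (z `^ 3^-1) ^+ 3 = z.
  by move=> z0; rewrite -powR_mulrn ?powR_ge0// -powRrM mulVf// powRr1.
have [y0|y0] := leP 0 y; first by exists (y `^ 3^-1); exact: h.
exists (- (- y) `^ 3^-1); rewrite exprNn h ?oppr_ge0 ?(ltW y0)//.
by rewrite -signr_odd expr1 mulN1r opprK.
Qed.

Lemma ltr_cube (x y : R) : (x ^+ 3 < y ^+ 3) = (x < y).
Proof.
have lt (a b : R) : a < b -> a ^+ 3 < b ^+ 3.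
  move=> ab; rewrite -subr_gt0.
  have -> : b ^+ 3 - a ^+ 3 = (b - a) * ((b + a / 2) ^+ 2 + 3 / 4 * a ^+ 2) by field.
  apply: mulr_gt0; first by rewrite subr_gt0.
  have q2 : 0 <= 3 / 4 * a ^+ 2 by rewrite mulr_ge0 ?sqr_ge0// divr_ge0.
  have [a0|a0] := eqVneq a 0.
    move: ab; rewrite a0 mul0r addr0 expr0n/= mulr0 addr0 => b0.
    by rewrite exprn_gt0.
  rewrite ltr_wpDl ?sqr_ge0// mulr_gt0 ?divr_gt0//.
  by rewrite lt_neqAle sqr_ge0 andbT eq_sym sqrf_eq0.
apply/idP/idP => [|/lt//]; rewrite !ltNge; apply: contra.
by rewrite le_eqVlt => /predU1P[->//|/lt/ltW].
Qed.

Section Shifted.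
Variables (M : R) (M0 : 0 < M).

Definition shifted_cube (x : R) : R := Num.max (x ^+ 3 + M ^+ 3) 0.

Lemma measurable_shifted_cube :
  measurable_fun (setT : set (measurableTypeR R)) shifted_cube.
Proof.
by apply: measurable_maxr => //; apply: measurable_funD.
Qed.

Definition cubeRV : {mfun measurableTypeR R >-> R} :=
  @mfun_Sub _ _ (measurableTypeR R) _ shifted_cube (mem_set measurable_shifted_cube).

Lemma shifted_cube_ge0 x : 0 <= shifted_cube x.
Proof. by rewrite /shifted_cube le_max lexx orbT. Qed.

Lemma shifted_cubeE x : `|x| <= M -> shifted_cube x = x ^+ 3 + M ^+ 3.
Proof.
rewrite ler_norml => /andP[h _]; rewrite /shifted_cube max_l//.
rewrite -lerBlDr sub0r leNgt -[X in _ < X]mulN1r.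
have -> : -1 * M ^+ 3 = (- M) ^+ 3 by ring.
by rewrite ltr_cube -leNgt.
Qed.

(* [shifted_cube] is nonnegative, which lets the layer cake formula apply, and it
   agrees with [x ^+ 3 + M ^+ 3] on the support. *)
Lemma expectation_cube (nu : realProb R) : supp_in nu M ->
  (\int[nu]_x (shifted_cube x)%:E = (\int[nu]_x x ^+ 3 + M ^+ 3)%:E)%E.
Proof.
move=> s.
have i3 : nu.-integrable setT (EFin \o (fun x : R => x ^+ 3)).
  have := supp_integrable_horner 'X^3 s.
  by apply: eq_integrable => // x _ /=; rewrite hornerXn.
have ic := prob_integrable_cst nu (M ^+ 3).
have is_ : nu.-integrable setT (EFin \o shifted_cube).
  apply: (supp_integrable s (c := M ^+ 3 + M ^+ 3)).
    exact: measurable_shifted_cube.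
  move=> x xM; rewrite shifted_cubeE// (le_trans (ler_normD _ _))//.
  rewrite !normrX (gtr0_norm M0) lerD2r lerXn2r ?nnegrE//; exact: ltW.
rewrite -[RHS]/((_ + M ^+ 3)%:E); apply/eqP.
rewrite -(fineK (integrable_fin_num _ is_))// eqe; apply/eqP.
rewrite -[in RHS](prob_Rintegral_cst nu (M ^+ 3)) -RintegralD//.
apply: (supp_eq_Rintegral s) => //; first exact: (integrableD measurableT i3 ic).
exact: shifted_cubeE.
Qed.

(** By the layer cake formula both integrals are integrals of tails over r >= 0. Tails differ by at
    most D at each level, and above 2 M^3, the maximum of [shifted_cube] on the support, the tail of
    [nu1] vanishes. *)
Lemma ccdf_cube_le (nu1 nu2 : realProb R) (D : R) :
  supp_in nu1 M -> supp_in nu2 M ->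
  (forall x, `|fine (nu1 `]-oo, x]%classic) - fine (nu2 `]-oo, x]%classic)| <= D) ->
  (\int[nu1]_x (shifted_cube x)%:E <=
   \int[nu2]_x (shifted_cube x)%:E + (D * (2 * M ^+ 3))%:E)%E.
Proof.
move=> s1 s2 hD.
have D0 : 0 <= D by apply: le_trans (hD 0).
have E (nu : realProb R) : (\int[nu]_x (shifted_cube x)%:E =
    \int[lam]_(r in `[0%R, +oo[) ccdf (cubeRV : {RV nu >-> R}) r)%E.
  by rewrite -ge0_expectation_ccdf ?expectation_def//; exact: shifted_cube_ge0.
rewrite !E.
have mc (nu : realProb R) : measurable_fun setT (ccdf (cubeRV : {RV nu >-> R})).
  exact: ccdf_measurable.
pose K : set R := `[0, 2 * M ^+ 3]%classic.
have mK : measurable K by exact: measurable_itv.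
have KE : (\int[lam]_(r in `[0%R, +oo[) (D%:E * (\1_K r)%:E) = (D * (2 * M ^+ 3))%:E)%E.
  rewrite ge0_integralZl//; last first.
    by apply/measurable_EFinP/measurable_funTS/measurable_indic.
  rewrite integral_indic//= setIidl; last first.
    by move=> x /=; rewrite !in_itv/= andbT => /andP[].
  rewrite /K lebesgue_measure_itv/= lte_fin mulr_gt0 ?exprn_gt0//.
  by rewrite sube0 EFinM.
rewrite -KE -ge0_integralD//; last 3 first.
- by apply: measurable_funTS; exact: mc.
- by move=> x _; rewrite mule_ge0 ?lee_fin.
- apply: measurable_funeM.
  by apply/measurable_EFinP/measurable_funTS/measurable_indic.
apply: ge0_le_integral => //.
- by apply: measurable_funTS; exact: mc.
- apply: emeasurable_funD; first by apply: measurable_funTS; exact: mc.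
  apply: measurable_funeM.
  by apply/measurable_EFinP/measurable_funTS/measurable_indic.
move=> r; rewrite /= in_itv/= andbT => r0.
have cE (nu : realProb R) : ccdf (cubeRV : {RV nu >-> R}) r =
    nu [set x | r < shifted_cube x].
  rewrite /ccdf /distribution /pushforward; congr (nu _).
  by apply/seteqP; split => x /=; rewrite in_itv/= andbT.
rewrite !cE.
(* The cube is increasing, so the level set is a half-line, to which the bound on distribution
   functions applies. *)
have [c hc] := cube_root (r - M ^+ 3).
have SE : [set x | r < shifted_cube x] = ~` `]-oo, c]%classic.
  rewrite setCitvl; apply/seteqP; split => x /=; rewrite in_itv/= andbT.
    rewrite /shifted_cube lt_max (ltNge r 0) r0 orbF.
    by rewrite -ltrBlDr -hc ltr_cube.
  by rewrite -ltr_cube hc ltrBlDr /shifted_cube lt_max => ->.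
have mI : measurable (`]-oo, c]%classic : set (measurableTypeR R)).
  exact: measurable_itv.
have [rK|rK] := leP r (2 * M ^+ 3).
  rewrite indicE mem_set; last by rewrite /K/= in_itv/= r0.
  rewrite mule1 SE !probability_setC//.
  have f1 := fin_num_measure nu1 _ mI; have f2 := fin_num_measure nu2 _ mI.
  rewrite -(fineK f1) -(fineK f2) -!EFinB -EFinD lee_fin.
  have := hD c; rewrite ler_norml => /andP[].
  by move: (fine _) (fine _) => x y; lra.
suff -> : nu1 [set x | r < shifted_cube x] = 0%E.
  by rewrite adde_ge0 ?mule_ge0 ?lee_fin.
apply/eqP; rewrite -measure_le0 -s1; apply: le_measure; rewrite ?inE//.
- by rewrite SE; apply: measurableC.
- by apply: measurableC; exact: measurable_itv.
move=> x /= hx; rewrite in_itv/= -ler_norml => /[dup] xM /shifted_cubeE e.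
move: hx; rewrite e; apply/negP; rewrite -leNgt.
apply: le_trans (ltW rK); rewrite mulr2n mulrDl mul1r lerD2r.
rewrite leNgt ltr_cube -leNgt; exact: le_trans (ler_norm x) xM.
Qed.

End Shifted.

Lemma cube_moment_le (nu1 nu2 : realProb R) (M D : R) : 0 < M ->
  supp_in nu1 M -> supp_in nu2 M ->
  (forall x, `|fine (nu1 `]-oo, x]%classic) - fine (nu2 `]-oo, x]%classic)| <= D) ->
  `|\int[nu1]_x x ^+ 3 - \int[nu2]_x x ^+ 3| <= D * (2 * M ^+ 3).
Proof.
move=> M0 s1 s2 hD.
have hD' x : `|fine (nu2 `]-oo, x]%classic) - fine (nu1 `]-oo, x]%classic)| <= D.
  by rewrite distrC.
have := ccdf_cube_le M0 s1 s2 hD; have := ccdf_cube_le M0 s2 s1 hD'.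
rewrite !expectation_cube// -!EFinD !lee_fin.
move: (Rintegral _ _ _) (Rintegral _ _ _) (D * _) => x y z h1 h2.
by rewrite ler_norml; apply/andP; split; lra.
Qed.

End CubicMoment.

(** * The semicircle law in angular form *)

Section Semicircle.
Variable R : realType.
Local Notation lam := (@lebesgue_measure R).
Local Notation arc := (`[0, pi]%classic : set R).
Local Notation seg := (`[- 2, 2]%classic : set R).

Definition semi_density (y : R) : R := (2 * pi)^-1 * Num.sqrt (4 - y ^+ 2).

Lemma continuous_semi_density : continuous semi_density.
Proof.
move=> x; apply: cvgM; first exact: cvg_cst.
apply: (@continuous_comp _ _ _ (fun y : R => 4 - y ^+ 2)).
  by apply: cvgB; [exact: cvg_cst|exact: exprn_continuous].
exact: sqrt_continuous.
Qed.

Lemma semi_density_ge0 y : 0 <= semi_density y.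
Proof. by rewrite mulr_ge0 ?sqrtr_ge0// invr_ge0 mulr_ge0// pi_ge0. Qed.

Lemma semi_density_le1 y : semi_density y <= 1.
Proof.
have p2 := pi_ge2 R; have p0 := pi_gt0 R.
rewrite /semi_density mulrC ler_pdivrMr ?mulr_gt0// mul1r.
apply: (@le_trans _ _ 2); last by move: p2; lra.
rewrite -[leRHS](@ger0_norm _ 2)// -sqrtr_sqr ler_wsqrtr//.
have -> : 2 ^+ 2 = 4 :> R by ring.
by rewrite gerBl sqr_ge0.
Qed.

Lemma semicircle_lawE (A : set R) :
  semicircle_law A = (\int[lam]_(x in A `&` seg) (semi_density x)%:E)%E.
Proof.
rewrite /semicircle_law [RHS]integral_mkcondr; apply: eq_integral => x _.
rewrite patchE /semicircle_pdf indicE -/(semi_density x).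
by case: ifPn => _; rewrite ?mulr1 ?mulr0.
Qed.

Lemma arcw0 th : arcw 0 th = 2 / pi * sin th ^+ 2 :> R.
Proof.
rewrite /arcw expr0n/= eq_sym oner_eq0 /arcden expr0n/= mulr0 mul0r.
by rewrite subr0 addr0 divr1.
Qed.

Lemma derive_2cos (x : R) : is_derive x 1 (fun y : R => 2 * cos y) (- (2 * sin x)).
Proof.
have d : is_derive x (1 : R) (2 \*: (@cos R)) (2 *: (- sin x)).
  exact: is_deriveZ.
by move: d; rewrite /GRing.scale/= mulrN.
Qed.

(** Substitution y = 2 cos th: the square root and the differential each give 2 sin th, and together
    [arcw 0]. *)
Lemma semi_arc (al : R) : 0 <= al <= pi ->
  (\int[lam]_(x in `[(- 2)%R, (2 * cos al)%R]) (semi_density x)%:E =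
   \int[lam]_(x in `[al, pi]) (arcw 0 x)%:E)%E.
Proof.
move=> /andP[al0 alpi].
have dE : derive1 (fun y : R => 2 * cos y) = fun y => - (2 * sin y).
  apply/funext => y; have d := derive_2cos y.
  by rewrite derive1E derive_val.
have cF : continuous (fun y : R => 2 * cos y).
  by move=> x; apply: cvgM; [exact: cvg_cst|exact: continuous_cos].
have cdF : continuous (fun y : R => - (2 * sin y)).
  by move=> x; apply: cvgN; apply: cvgM; [exact: cvg_cst|exact: continuous_sin].
have := @integration_by_substitution_decreasing R (fun y => 2 * cos y)
  semi_density al pi alpi.
rewrite dE cospi mulrN1 => ->.
- apply: eq_integral => x; rewrite inE/= in_itv/= => /andP[alx xpi].
  have x0 : 0 <= x by apply: le_trans alx.
  congr (_%:E); rewrite arcw0.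
  transitivity (semi_density (2 * cos x) * - - (2 * sin x)); first by [].
  rewrite /semi_density.
  have -> : 4 - (2 * cos x) ^+ 2 = (2 * sin x) ^+ 2.
    by rewrite !exprMn sin2cos2; ring.
  rewrite sqrtr_sqr ger0_norm; last by rewrite mulr_ge0// sin_ge0_pi// x0.
  rewrite opprK invfM; by move: (pi^-1) => P; field.
- move=> x y; rewrite !in_itv/= => /andP[x0 x1] /andP[y0 y1] xy.
  rewrite ltr_pM2l// ltr_cos// ?in_itv/= ?x1 ?y1 ?andbT.
    exact: le_trans al0 y0.
  exact: le_trans al0 x0.
- by move=> x _; exact: cdF.
- by apply/cvg_ex; exists (- (2 * sin al)); exact/cvg_at_right_filter/cdF.
- by apply/cvg_ex; exists (- (2 * sin pi)); exact/cvg_at_left_filter/cdF.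
- split.
  + by move=> x _; apply: ex_derive; exact: derive_2cos.
  + exact/cvg_at_right_filter/cF.
  + exact/cvg_at_left_filter/cF.
- exact/continuous_subspaceT/continuous_semi_density.
Qed.

Definition arc_below (a b y : R) : set R := arcmap a b @^-1` `]-oo, y]%classic.

Lemma arc_belowE (a b y : R) : 0 < a -> arc_below a b y = arc_below 1 0 ((y - b) / a).
Proof.
move=> a0; apply/seteqP; split => th; rewrite /arc_below/= !in_itv/= /arcmap.
  by rewrite mul1r addr0 ler_pdivlMr// mulrC lerBrDr.
by rewrite mul1r addr0 ler_pdivlMr// mulrC lerBrDr.
Qed.

(** Puts the semicircle law on the angles, where it is compared with [arcd s] on one and the same
    set. *)
Lemma semicircle_cdf (x : R) :
  semicircle_law `]-oo, x]%classic = arcd 0 (arc_below 1 0 x).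
Proof.
rewrite semicircle_lawE arcdE.
have mem th : arc_below 1 0 x th = (2 * cos th <= x) :> Prop.
  by rewrite /arc_below/= in_itv/= /arcmap mul1r addr0.
have top : (\int[lam]_(y in seg) (semi_density y)%:E =
    \int[lam]_(th in arc) (arcw 0 th)%:E)%E.
  by rewrite -semi_arc ?lexx ?pi_ge0// cos0 mulr1.
have [x2|x2] := leP 2 x.
  rewrite setIidr; last first.
    move=> y /=; rewrite !in_itv/= => /andP[_ y2]; exact: le_trans y2 x2.
  rewrite setIidr//; last first.
    move=> th _; rewrite mem; apply: (le_trans _ x2).
    by rewrite -[leRHS]mulr1 ler_pM2l// cos_le1.
have [x2'|x2'] := ltP x (- 2).
  rewrite (_ : _ `&` _ = set0); last first.
    apply/seteqP; split => // y /=; rewrite !in_itv/= => -[yx /andP[y2 _]].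
    by move: (le_lt_trans yx x2'); rewrite ltNge y2.
  rewrite [in RHS](_ : _ `&` _ = set0); last first.
    apply/seteqP; split => // th [] /=; rewrite mem => h _.
    have c := cos_geN1 th; move: h x2' c; lra.
  by rewrite !integral_set0.
have xc : -1 <= x / 2 <= 1.
  by apply/andP; split; [rewrite ler_pdivlMr// mulN1r|rewrite ler_pdivrMr// mul1r ltW].
pose al := acos (x / 2).
have alb : 0 <= al <= pi by rewrite acos_ge0// acos_lepi.
have xE : x = 2 * cos al.
  by rewrite /al acosK ?in_itv//= mulrC divfK.
have -> : `]-oo, x] `&` `[- 2, 2] = `[- 2, 2 * cos al]%classic :> set R.
  apply/seteqP; split => y /=; rewrite -xE !in_itv/=.
    by move=> [-> /andP[-> _]].
  by move=> /andP[-> h]; split => //; rewrite (le_trans h (ltW x2)).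
have -> : arc_below 1 0 x `&` arc = `[al, pi]%classic.
  apply/seteqP; split => th.
    move=> [] /=; rewrite mem xE ler_pM2l// !in_itv/= => h /andP[t0 t1].
    rewrite t1 andbT leNgt; apply/negP => ht.
    by move: h; apply/negP; rewrite -ltNge ltr_cos// in_itv/= ?t0.
  move=> /=; rewrite !in_itv/= => /andP[t0 t1].
  have th0 : 0 <= th by case/andP: alb => a0 _; exact: le_trans t0.
  split; last by rewrite th0.
  rewrite mem xE ler_pM2l//; move: t0; rewrite le_eqVlt => /predU1P[->//|ht].
  by rewrite ltW// ltr_cos// in_itv/= ?th0.
exact: semi_arc.
Qed.

Lemma arcd_setT : arcd 0 setT = 1%E :> \bar R.
Proof.
rewrite arcdE setTI.
have := arcmomE (t := 0 : R) 0; rewrite expr0n/= expr0 => /(_ ler01) h.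
rewrite -[RHS]/((1 : R)%:E) -h /arcmom /arcint /Rintegral.
have e : (\int[lam]_(th in arc) ((chebV R 1).[2 * cos th] * arcw 0 th)%:E =
   \int[lam]_(th in arc) (arcw 0 th)%:E)%E.
  by apply: eq_integral => x _; rewrite chebV1 mul1r.
rewrite e fineK//; apply: integrable_fin_num => //.
exact/arc_integrable/continuous_arcw.
Qed.

Definition Phi (x : R) : R := distribution_function (@semicircle_law R) x.

Lemma arc_below_measurable a b y : measurable (arc_below a b y : set (measurableTypeR R)).
Proof.
by rewrite -[X in measurable X]setTI; apply: measurable_arcmap.
Qed.

Lemma arcd0_le1 E : measurable (E : set (measurableTypeR R)) -> (arcd 0 E <= 1 :> \bar R)%E.
Proof.
by move=> mE; rewrite -arcd_setT; apply: le_measure; rewrite ?inE.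
Qed.

Lemma PhiE x : ((Phi x)%:E = arcd 0 (arc_below 1 0 x))%E.
Proof.
rewrite /Phi /distribution_function semicircle_cdf fineK// ge0_fin_numE//.
by rewrite (le_lt_trans (arcd0_le1 (arc_below_measurable _ _ _)))// ltry.
Qed.

Lemma Phi_ge0 x : 0 <= Phi x.
Proof. by rewrite -lee_fin PhiE. Qed.

Lemma Phi_le1 x : Phi x <= 1.
Proof. by rewrite -lee_fin PhiE arcd0_le1//; exact: arc_below_measurable. Qed.

Lemma Phi_gt2 x : 2 <= x -> Phi x = 1.
Proof.
move=> x2; apply/eqP; rewrite -eqe PhiE -arcd_setT; apply/eqP; congr (arcd _ _).
apply/seteqP; split => // th _; rewrite /arc_below/= in_itv/= /arcmap mul1r addr0.
by rewrite (le_trans _ x2)// -[leRHS]mulr1 ler_pM2l//; exact: cos_le1.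
Qed.

Lemma Phi_ltN2 x : x < - 2 -> Phi x = 0.
Proof.
move=> x2; apply/eqP; rewrite -eqe PhiE (_ : arc_below 1 0 x = set0) ?measure0//.
apply/seteqP; split => // th; rewrite /arc_below/= in_itv/= /arcmap mul1r addr0.
by have := cos_geN1 th; move: x2; lra.
Qed.

Lemma Phi_lipschitz x y : `|Phi x - Phi y| <= `|x - y|.
Proof.
wlog xy : x y / x <= y.
  move=> h; have [|/ltW] := leP x y; first exact: h.
  by move/h; rewrite distrC (distrC y).
have mon : Phi x <= Phi y.
  rewrite -lee_fin !PhiE; apply: le_measure; rewrite ?inE; try exact: arc_below_measurable.
  by move=> th; rewrite /arc_below/= !in_itv/= => /le_trans; exact.
rewrite !ler0_norm ?subr_le0// !opprB lerBlDr.
have PE z : ((Phi z)%:E = \int[lam]_(t in `]-oo, z]) (semicircle_pdf t)%:E)%E.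
  by rewrite PhiE -semicircle_cdf.
have mpdf : measurable_fun setT (@semicircle_pdf R).
  apply: measurable_funM; last by apply: measurable_indic; exact: measurable_itv.
  exact: (continuous_measurable_fun continuous_semi_density).
have pdf0 z : 0 <= semicircle_pdf z :> R.
  by rewrite mulr_ge0// ?semi_density_ge0.
rewrite -lee_fin EFinD !PE.
have -> : (`]-oo, y]%classic : set R) = `]-oo, x]%classic `|` `]x, y]%classic.
  by rewrite -itv_bndbnd_setU// bnd_simp.
rewrite ge0_integral_setU//; last 3 first.
- by apply/measurable_funTS/measurable_EFinP.
- by move=> z _; rewrite lee_fin.
- apply/disj_setPS => z /= []; rewrite !in_itv/= => zx /andP[xz _].
  by move: xz; rewrite ltNge zx.
rewrite addeC leeD2r//.
apply: (@le_trans _ _ (\int[lam]_(t in `]x, y]) cst 1%E t)%E).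
  apply: ge0_le_integral => //.
  - by move=> z _; rewrite lee_fin.
  - by apply/measurable_funTS/measurable_EFinP.
  - move=> z _; rewrite lee_fin /semicircle_pdf -/(semi_density z) indicE.
    by case: (_ \in _); rewrite ?mulr1 ?semi_density_le1// mulr0.
rewrite integral_cst//= mul1e lebesgue_measure_itv/=.
by case: ifPn => _; rewrite ?lexx// lee_fin subr_ge0.
Qed.

Lemma Phi_leN2 x : x <= - 2 -> Phi x = 0.
Proof.
rewrite le_eqVlt => /predU1P[->|/Phi_ltN2//]; apply/eqP; rewrite -normr_le0.
apply/ler_addgt0Pr => e e0; rewrite add0r.
have := Phi_lipschitz (- 2) (- 2 - e); rewrite (Phi_ltN2 (x := - 2 - e)) ?gtrBl//.
have -> : - 2 - (- 2 - e) = e :> R by ring.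
by rewrite subr0 (gtr0_norm e0).
Qed.

Lemma arcd_le (s s' c : R) (E : set R) : 0 <= c ->
  measurable (E : set (measurableTypeR R)) ->
  (forall th, arcw s th <= arcw s' th + c) ->
  (arcd s E <= arcd s' E + (pi * c)%:E)%E.
Proof.
move=> c0 mE h; rewrite !arcdE.
have mEa : measurable (E `&` arc : set (measurableTypeR R)).
  by apply: measurableI => //; exact: measurable_itv.
have ma (u : R) D : measurable_fun D (fun th => (arcw u th)%:E).
  apply/measurable_funTS/measurable_EFinP.
  by apply: continuous_measurable_fun; exact: continuous_arcw.
apply: (@le_trans _ _ (\int[lam]_(th in E `&` arc) ((arcw s' th)%:E + c%:E))%E).
  apply: ge0_le_integral => //.
  - by move=> x _; rewrite lee_fin arcw_ge0.
  - exact: ma.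
  - by apply: emeasurable_funD => //; exact: ma.
  - by move=> x _; rewrite lee_fin.
rewrite ge0_integralD//; [|by move=> x _; rewrite lee_fin arcw_ge0|exact: ma].
rewrite leeD2l// integral_cst//= mulrC EFinM lee_wpmul2l ?lee_fin//.
apply: (@le_trans _ _ (lam arc)).
  by apply: le_measure; rewrite ?inE//; exact: measurable_itv.
by rewrite lebesgue_measure_itv/= lte_fin pi_gt0 sube0.
Qed.

(** Since 1 - [arcden s th] = s (2 cos th - s) is at most 3 |s| and [arcden] is at least 1/4, the
    quotient is at most 12 |s|; the factor 2/pi of the density makes it 24/pi. *)
Lemma arcw_close (s th : R) : `|s| <= 2^-1 ->
  `|arcw s th - arcw 0 th| <= 24 / pi * `|s|.
Proof.
move=> hs; have s0 := normr_ge0 s.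
have s2 : s ^+ 2 <= 4^-1.
  rewrite -real_normK ?num_real//.
  have -> : 4^-1 = 2^-1 ^+ 2 :> R by field.
  by rewrite lerXn2r ?nnegrE ?invr_ge0.
have s1 : s ^+ 2 != 1 by apply: contraTneq s2 => ->; rewrite -ltNge; lra.
have d0 := arcden_gt0 th s1.
have d1 : 4^-1 <= arcden s th.
  apply: le_trans (arcden_ge s th).
  have -> : 4^-1 = 2^-1 ^+ 2 :> R by field.
  by rewrite lerXn2r ?nnegrE ?invr_ge0//; lra.
rewrite arcw0 /arcw (negbTE s1) -mulrBr.
have -> : sin th ^+ 2 / arcden s th - sin th ^+ 2 =
    sin th ^+ 2 * ((1 - arcden s th) / arcden s th).
  by field; rewrite gt_eqF.
rewrite normrM (gtr0_norm (divr_gt0 _ (pi_gt0 R)))//.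
have -> : 24 / pi * `|s| = 2 / pi * (12 * `|s|) :> R.
  by move: (pi^-1) => P; ring.
rewrite ler_pM2l ?divr_gt0 ?pi_gt0// normrM -[leRHS]mul1r ler_pM//.
  by rewrite normrX expr_le1// sin_max.
rewrite normf_div (gtr0_norm d0) ler_pdivrMr//.
apply: (@le_trans _ _ (12 * `|s| * 4^-1)); last by rewrite ler_wpM2l ?mulr_ge0.
have -> : 1 - arcden s th = s * (2 * cos th - s) by rewrite /arcden; ring.
rewrite normrM mulrAC mulrC ler_wpM2r//.
rewrite (le_trans (ler_normB _ _))// normrM ger0_norm//.
have := cos_max th; lra.
Qed.

(** For |s| <= 1/2 there is no atom, and integrating [arcw_close] over an arc of length pi cancels
    the 1/pi. *)
Lemma fpm_cdf_close (s a b y : R) : 0 < a -> `|s| <= 2^-1 ->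
  `|fine (fpm s a b `]-oo, y]%classic) - Phi ((y - b) / a)| <= 24 * `|s|.
Proof.
move=> a0 hs.
have at0 : atomw s = 0.
  rewrite /atomw ifT// -real_normK ?num_real// expr_le1//.
  by rewrite (le_trans hs)// invf_le1// ler1n.
rewrite fpmE at0 mul0e adde0 -/(arc_below a b y) arc_belowE//.
set z := _ / a; have mz := arc_below_measurable 1 0 z.
have c0 : 0 <= 24 / pi * `|s| by rewrite mulr_ge0// divr_ge0// pi_ge0.
have h1 : (arcd s (arc_below 1 0 z) <= arcd 0 (arc_below 1 0 z) + (pi * (24 / pi * `|s|))%:E)%E.
  apply: arcd_le => // th.
  by have := arcw_close th hs; rewrite ler_norml => /andP[_]; rewrite lerBlDl.
have h2 : (arcd 0 (arc_below 1 0 z) <= arcd s (arc_below 1 0 z) + (pi * (24 / pi * `|s|))%:E)%E.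
  apply: arcd_le => // th.
  have := arcw_close th hs; rewrite ler_norml => /andP[h _]; move: h.
  by move: (24 / pi * _) => c; lra.
have E : pi * (24 / pi * `|s|) = 24 * `|s|.
  by rewrite mulrCA mulrA -[24 / pi * pi]mulrA mulVf ?mulr1// gt_eqF// pi_gt0.
rewrite E in h1 h2.
have fs : arcd s (arc_below 1 0 z) \is a fin_num.
  rewrite ge0_fin_numE//; apply: le_lt_trans h1 _.
  by rewrite -PhiE -EFinD ltry.
rewrite -PhiE in h1 h2; move: h1 h2; rewrite -(fineK fs) -!EFinD !lee_fin.
move: (fine _) (Phi z) (24 * _) => u w c h1 h2.
by rewrite /= ler_norml; apply/andP; split; lra.
Qed.

End Semicircle.

(** * Rescaling and comparison of distribution functions *)

Section Comparison.
Variable R : realType.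

Lemma rescale_cdf (nu : set R -> \bar R) (a x : R) : 0 < a ->
  distribution_function (rescale nu a) x = fine (nu `]-oo, a * x]%classic).
Proof.
move=> a0; rewrite /distribution_function /rescale; congr (fine (nu _)).
apply/seteqP; split => y /=; rewrite in_itv/=.
  by move=> [z]; rewrite in_itv/= => zx <-; rewrite ler_pM2l.
by move=> h; exists (y / a); rewrite ?in_itv/= ?ler_pdivrMr 1?mulrC ?divfK ?gt_eqF.
Qed.

Lemma prob_cdf_bounds (nu : realProb R) y : 0 <= fine (nu `]-oo, y]%classic) <= 1.
Proof.
have mI : measurable (`]-oo, y]%classic : set (measurableTypeR R)).
  exact: measurable_itv.
by rewrite -!lee_fin fineK ?fin_num_measure// measure_ge0 probability_le1.
Qed.

Lemma prob_cdf_le (nu : realProb R) y z : y <= z ->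
  fine (nu `]-oo, y]%classic) <= fine (nu `]-oo, z]%classic).
Proof.
move=> yz.
have mI u : measurable (`]-oo, u]%classic : set (measurableTypeR R)).
  exact: measurable_itv.
rewrite -lee_fin !fineK ?fin_num_measure//; apply: le_measure; rewrite ?inE//.
by move=> x /=; rewrite !in_itv/= => /le_trans; exact.
Qed.

Lemma half_weight : 0 <= 2^-1 :> R. Proof. by rewrite invr_ge0. Qed.

Lemma half_weight' : 0 <= 1 - 2^-1 :> R.
Proof. by rewrite subr_ge0 invf_le1// ler1n. Qed.

(* With parameters 0 both components are the semicircle law of radius [2 * a]. *)
Definition semi_prob (a : R) : realProb R := fmix 0 0 a 0 half_weight half_weight'.

Lemma atomw0 : atomw 0 = 0 :> R.
Proof. by rewrite /atomw expr0n/= ler01. Qed.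

Lemma semi_prob_cdf a y : 0 < a ->
  fine (semi_prob a `]-oo, y]%classic) = Phi (y / a).
Proof.
move=> a0; rewrite -[RHS]/(fine (Phi (y / a))%:E); congr fine.
rewrite /semi_prob [LHS]fmixE !fpmE atomw0 mul0e adde0.
rewrite -/(arc_below a 0 y) arc_belowE// subr0 -PhiE -!EFinM -EFinD.
by rewrite -mulrDl addrC subrK mul1r.
Qed.

Lemma semi_prob_supp a M : 0 < a -> 2 * a <= M -> supp_in (semi_prob a) M.
Proof.
move=> a0 aM; apply: fmix_supp; rewrite ?atomw0 ?ltxx// => th.
rewrite /arcmap addr0 (le_trans _ aM)// mulrC normrM (gtr0_norm a0).
rewrite ler_pM2r// normrM ger0_norm// -[leRHS]mulr1 ler_pM2l//.
exact: cos_max.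
Qed.

Lemma semi_prob_cube a : 0 < a -> \int[semi_prob a]_x x ^+ 3 = 0.
Proof.
move=> a0; transitivity (\int[semi_prob a]_x ('X^3 : {poly R}).[x]).
  by apply: eq_Rintegral => x _; rewrite hornerXn.
by rewrite fmix_poly !fval_cube ?gt_eqF//; field.
Qed.

Lemma fmix_cdf_close (t r a b al y : R) (al0 : 0 <= al) (al1 : 0 <= 1 - al) :
  0 < a -> `|t| <= 2^-1 -> `|r| <= 2^-1 ->
  `|fine (fmix t r a b al0 al1 `]-oo, y]%classic) - Phi ((y - b) / a)|
    <= 24 * (`|t| + `|r|).
Proof.
move=> a0 ht hr; have h1 := fpm_cdf_close b y a0 ht.
have h2 := fpm_cdf_close b y a0 hr; move: h1 h2.
have mI : measurable (`]-oo, y]%classic : set (measurableTypeR R)).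
  exact: measurable_itv.
have f s : fpm s a b `]-oo, y]%classic \is a fin_num.
  rewrite ge0_fin_numE ?measure_ge0// (le_lt_trans (y := 1%E)) ?ltry//.
  by rewrite -(fpm_setT a b s); apply: le_measure; rewrite ?inE.
rewrite fmixE -(fineK (f t)) -(fineK (f r)) -!EFinM -EFinD /=.
move: (fine _) (fine _) (Phi _) => w u z h1 h2.
have -> : al * u + (1 - al) * w - z = al * (u - z) + (1 - al) * (w - z) by ring.
rewrite (le_trans (ler_normD _ _))// !normrM (ger0_norm al0) (ger0_norm al1).
have n2 := normr_ge0 (u - z); have n1 := normr_ge0 (w - z).
rewrite mulrDr lerD//.
  by rewrite (le_trans _ h1)// ler_piMl// -subr_ge0.
by rewrite (le_trans _ h2)// ler_piMl// gerBl.
Qed.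

End Comparison.

(** * The two bounds *)

Section Rate.
Variables (R : realType) (p q : R) (mu : realProb R).
Hypotheses (p0 : 0 < p) (q0 : 0 < q) (pq1 : p + q = 1).
Hypotheses (mu_p : mu [set - p^-1] = p%:E) (mu_q : mu [set q^-1] = q%:E).
Local Notation v := (vpar p q).
Local Notation s := (spar p q).
Local Notation A n := (Num.sqrt (n%:R / (p * q))).
Local Notation N n := (Num.sqrt n%:R : R).

(** The explicit family starts at two factors; for n = 1 the law is [mu] itself. *)
Lemma power_law n : (0 < n)%N -> exists E : realProb R,
  [/\ supp_in E (3 * v * N n), \int[E]_x x ^+ 3 = - (n%:R * v * s) &
      forall y, free_convolution_power mu n `]-oo, y]%classic = E `]-oo, y]%classic].
Proof.
have v0 := vpar_gt0 p0 q0.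
case: n => [//|[_|k _]].
  exists mu; split => //.
    apply: (two_points_supp p0 q0 pq1 mu_p mu_q).
    by rewrite sqrtr1 mulr1; move: v0; lra.
  by rewrite (two_points_cube p0 q0 pq1 mu_p mu_q) mul1r.
exists (fpow p0 q0 pq1 k); split.
- exact: fpow_supp.
- exact: fpow_cube.
- exact: power_cdf mu_p mu_q k.
Qed.

Lemma scale_gt0 n : (0 < n)%N -> 0 < A n.
Proof. by move=> n0; rewrite sqrtr_gt0 divr_gt0 ?mulr_gt0// ltr0n. Qed.

Lemma scale2 n : A n ^+ 2 = n%:R * v.
Proof. by rewrite sqr_sqrtr// mulr_ge0// ltW// vpar_gt0. Qed.

Lemma scale_le n : A n <= v * N n.
Proof.
have v1 := vpar_ge1 p0 q0 pq1; have v0 := vpar_gt0 p0 q0.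
rewrite -(@ler_pXn2r _ 2)// ?nnegrE ?mulr_ge0 ?sqrtr_ge0// ?(ltW v0)//.
rewrite scale2 exprMn sqr_sqrtr// mulrC ler_wpM2r// expr2 ler_peMl//; exact: ltW.
Qed.

(** The law is compared, before rescaling, with the semicircle law of the same variance, on an
    interval of radius M = 3 v sqrt(n). Third moments give n v |s| <= D (2 M^3) = 54 D v^3 n^(3/2),
    whence the constant. *)
Lemma rate_lower n D : (0 < n)%N ->
  (forall x, `|fine (free_convolution_power mu n `]-oo, A n * x]%classic) - Phi x| <= D) ->
  `|s| / (54 * v ^+ 2) * (N n)^-1 <= D.
Proof.
move=> n0 hD; have [E [sE cE FE]] := power_law n0.
have v0 := vpar_gt0 p0 q0; have a0 := scale_gt0 n0.
have nr : 0 < n%:R :> R by rewrite ltr0n.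
have N0 : 0 < N n by rewrite sqrtr_gt0.
have M0 : 0 < 3 * v * N n by rewrite !mulr_gt0.
have sS : supp_in (semi_prob (A n)) (3 * v * N n).
  apply: semi_prob_supp => //; have := scale_le n; rewrite -mulrA.
  have : 0 < v * N n by rewrite mulr_gt0.
  by move: (A n) (v * N n) => x y; lra.
have := @cube_moment_le _ E (semi_prob (A n)) _ D M0 sE sS.
rewrite cE semi_prob_cube// subr0 normrN (normrM _ s) gtr0_norm ?mulr_gt0// => h.
have {}h : n%:R * v * `|s| <= D * (2 * (3 * v * N n) ^+ 3).
  apply: h => x; rewrite -FE semi_prob_cdf//.
  by have := hD (x / A n); rewrite mulrCA divff ?mulr1// gt_eqF.
have E2 : n%:R = N n ^+ 2 by rewrite sqr_sqrtr.
move: h; rewrite {1}E2.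
have -> : D * (2 * (3 * v * N n) ^+ 3) = N n ^+ 2 * v * (D * (54 * v ^+ 2 * N n)) by ring.
rewrite -mulrA -[leRHS]mulrA -mulrA ler_pM2l ?exprn_gt0// ler_pM2l// => h.
rewrite -mulrA -invfM ler_pdivrMr; last by rewrite !mulr_gt0// exprn_gt0.
by rewrite -[54 * _ * _]mulrA.
Qed.

Lemma succ_inv_le k : k.+1%:R^-1 <= 2 / k.+2%:R :> R.
Proof.
rewrite ler_pdivlMr// mulrC ler_pdivrMr// -natrM ler_nat mul2n -addnn.
by rewrite addSn addnS !ltnS leq_addl.
Qed.

Lemma kapV_le k : (kap p q k)^-1 <= 2 * v / N k.+2.
Proof.
have v0 := vpar_gt0 p0 q0; have v1 := vpar_ge1 p0 q0 pq1.
have N0 : 0 < N k.+2 by rewrite sqrtr_gt0.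
have K0 := kap_gt0 p0 q0 k.
rewrite -(@ler_pXn2r _ 2)// ?nnegrE ?divr_ge0 ?mulr_ge0 ?invr_ge0 ?(ltW v0) ?(ltW N0) ?(ltW K0)//.
rewrite exprVn kap2// invfM -/v exprMn exprVn sqr_sqrtr//.
rewrite (le_trans (ler_wpM2r (ltW v0) (succ_inv_le k)))//.
have -> : 2 / k.+2%:R * v = 2 * v / k.+2%:R by rewrite mulrAC.
rewrite ler_pM2r ?invr_gt0// expr2 ler_peMl ?mulr_ge0 ?(ltW v0)//.
- by move: v1; lra.
- exact: ltW.
- exact: ltW.
Qed.

(** With K = [kap], the density costs 24/K, the shift s / [sigpar] at most 1/K, and the ratio of
    dilations |x| (u - 1), which is why |x| <= 2 is asked. As 1/K and u - 1 are both at most 2 v /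
    sqrt(n), the total is (25 + 2) times 2 v / sqrt(n). *)
Lemma fpow_close k x : (kap p q k)^-1 <= 2^-1 -> `|x| <= 2 ->
  `|fine (fpow p0 q0 pq1 k `]-oo, A k.+2 * x]%classic) - Phi x| <= 54 * v / N k.+2.
Proof.
move=> hk hx.
have v0 := vpar_gt0 p0 q0; have v1 := vpar_ge1 p0 q0 pq1.
have K0 := kap_gt0 p0 q0 k; have S0 := sigpar_gt0 p0 q0 k.
have a0 : 0 < A k.+2 by exact: scale_gt0.
have t0 := tpar_gt0 p0 q0 k; have r0 := rpar_gt0 p0 q0 k.
have trE := tpar_rpar pq1 k.
set K := kap p q k in hk K0 trE *; set sg := sigpar p q k in S0 *.
have ht : `|tpar p q k| <= 2^-1.
  by rewrite gtr0_norm// (le_trans _ hk)// -trE lerDl ltW.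
have hr : `|- rpar p q k| <= 2^-1.
  by rewrite normrN gtr0_norm// (le_trans _ hk)// -trE lerDr ltW.
set y := A _ * x.
have h1 : `|fine (fpow p0 q0 pq1 k `]-oo, y]%classic) - Phi ((y - - s) / sg)| <= 24 * K^-1.
  by rewrite -trE -(gtr0_norm t0) -(gtr0_norm r0) -(normrN (rpar _ _ _)); exact: fmix_cdf_close.
have h2 := Phi_lipschitz ((y - - s) / sg) x.
have kv := kapV_le k; rewrite -/K in kv.
have sK : `|s / sg| <= K^-1.
  have -> : s / sg = (q - p) / K.
    have -> : sg = K * v.
      apply: (mulIf (lt0r_neq0 K0)); rewrite divfK ?gt_eqF// mulrAC -expr2 kap2//.
      by rewrite -mulrA divff ?mulr1// gt_eqF// mulr_gt0.
    by rewrite /spar; move: v v0 => w w0; field; rewrite !gt_eqF.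
  rewrite normrM normfV (gtr0_norm K0) ler_piMl ?invr_ge0 ?(ltW K0)//.
  by rewrite ler_norml; apply/andP; split; move: p0 q0 pq1; lra.
(* Ratio of the dilation of the theorem to that of the arc; its square is n / (n - 1) with n =
   k.+2. *)
pose u := A k.+2 / sg.
have u0 : 0 < u by rewrite divr_gt0.
have u2 : u ^+ 2 = 1 + k.+1%:R^-1.
  rewrite exprMn exprVn scale2 sigpar2// -[k.+2]addn1 natrD.
  by move: k.+1%:R (ltr0Sn R k) => z z0; field; rewrite !gt_eqF.
have kV0 : 0 < k.+1%:R^-1 :> R by rewrite invr_gt0.
have u1 : 1 <= u.
  by rewrite -(@ler_pXn2r _ 2)// ?nnegrE ?(ltW u0)// expr1n u2 lerDl ltW.
have u3 : u - 1 <= k.+1%:R^-1.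
  rewrite -(lerD2l 1) -u2 addrC subrK expr2 ler_peMl//; exact: ltW.
have k2 : k.+1%:R^-1 <= 2 * v / N k.+2.
  rewrite (le_trans (succ_inv_le k))// -mulrA ler_pM2l//.
  have N1 : 1 <= N k.+2 by rewrite -(@ler_pXn2r _ 2)// ?nnegrE// expr1n sqr_sqrtr ?ler1n.
  have N0 : 0 < N k.+2 by apply: lt_le_trans N1.
  rewrite ler_pdivlMr// mulrC -[in X in _ / X](sqr_sqrtr (ler0n R k.+2)) expr2 invfM mulrA.
  by rewrite divff ?gt_eqF// mul1r (le_trans _ v1)// invf_le1.
have h3 : `|(y - - s) / sg - x| <= 2 * (u - 1) + K^-1.
  have -> : (y - - s) / sg - x = x * (u - 1) + s / sg.
    by rewrite /y /u; field; rewrite gt_eqF.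
  rewrite (le_trans (ler_normD _ _))// lerD// normrM.
  by rewrite (ger0_norm (x := u - 1)) ?subr_ge0// ler_wpM2r// subr_ge0.
rewrite -[_ - _](subrKA (Phi ((y - - s) / sg))) (le_trans (ler_normD _ _))//.
rewrite (le_trans (lerD h1 (le_trans h2 h3)))//.
move: kv u3 k2; rewrite -!mulrA.
by move: (v / _) => w; move: (K^-1) (k.+1%:R^-1) => a b; lra.
Qed.

(** Outside [-2, 2] the semicircle function is constant, so by monotonicity the error is at most the
    one at the nearer endpoint, where [fpow_close] applies. *)
Lemma rate_upper n x : (0 < n)%N ->
  `|fine (free_convolution_power mu n `]-oo, A n * x]%classic) - Phi x| <= 54 * v / N n.
Proof.
have v0 := vpar_gt0 p0 q0; have v1 := vpar_ge1 p0 q0 pq1.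
case: n => [//|n _].
(* Two distribution functions never differ by more than 1; this settles n = 1 and the small n for
   which 1 / [kap] exceeds 1/2. *)
have triv : 1 <= 54 * v / N n.+1 ->
    `|fine (free_convolution_power mu n.+1 `]-oo, A n.+1 * x]%classic) - Phi x| <= 54 * v / N n.+1.
  apply: le_trans.
  have /andP[] := prob_cdf_bounds (free_convolution_power mu n.+1) (A n.+1 * x).
  move: (fine _) (Phi_ge0 x) (Phi_le1 x) => y; move: (Phi x) => z.
  by rewrite ler_norml => *; apply/andP; split; lra.
case: n triv => [|k] triv.
  by apply: triv; rewrite sqrtr1 divr1; move: v1; lra.
have [hk|hk] := leP ((kap p q k)^-1) 2^-1; last first.
  apply: triv; have := kapV_le k; move: hk; rewrite -!mulrA.
  by move: (v / _) (kap _ _ _)^-1 => w z; lra.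
rewrite (power_cdf p0 q0 pq1 mu_p mu_q).
have a0 : 0 < A k.+2 by exact: scale_gt0.
have /andP[F0 F1] := prob_cdf_bounds (fpow p0 q0 pq1 k) (A k.+2 * x).
have [x2|x2] := ltP 2 x.
  have := @fpow_close k 2 hk; rewrite ger0_norm// lexx => /(_ isT).
  apply: le_trans; rewrite !Phi_gt2 ?(ltW x2)// !ler0_norm ?subr_le0//.
    by rewrite !opprB lerD2l lerN2 prob_cdf_le// ler_pM2l// ltW.
  by case/andP: (prob_cdf_bounds (fpow p0 q0 pq1 k) (A k.+2 * 2)).
have [x2'|x2'] := ltP x (- 2).
  have := @fpow_close k (- 2) hk; rewrite normrN ger0_norm// lexx => /(_ isT).
  apply: le_trans; rewrite !Phi_leN2 ?(ltW x2')// !subr0 !ger0_norm//.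
    by rewrite prob_cdf_le// ler_pM2l// ltW.
  by case/andP: (prob_cdf_bounds (fpow p0 q0 pq1 k) (A k.+2 * - 2)).
by apply: fpow_close => //; rewrite ler_norml x2'.
Qed.

End Rate.

Theorem proposition18 (R : realType) (p q : R) (hp : 0 < p < 1)
    (hq : q = 1 - p) (mu : realProb R)
    (mu_p : mu [set - p^-1] = p%:E) (mu_q : mu [set q^-1] = q%:E)
    (pq : p != q) :
  exists C1 C2 : R, [/\ 0 < C1, 0 < C2 &
    forall n : nat, (1 <= n)%N ->
      let mu_n := rescale (free_convolution_power mu n)
                    (Num.sqrt (n%:R / (p * q))) in
      let D := sup [set `|distribution_function mu_n x
                          - distribution_function (@semicircle_law R) x|
                   | x in [set: R]] in
      C1 * (Num.sqrt n%:R)^-1 <= D <= C2 * (Num.sqrt n%:R)^-1].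
Proof.
have [p0 p1] := andP hp.
have q0 : 0 < q by rewrite hq subr_gt0.
have pq1 : p + q = 1 by rewrite hq addrC subrK.
have v0 := vpar_gt0 p0 q0.
(* The asymmetry p != q makes the third moment nonzero, hence C1 positive. *)
have s0 : 0 < `|spar p q|.
  by rewrite normr_gt0 mulf_neq0 ?(gt_eqF v0)// subr_eq0 eq_sym.
exists (`|spar p q| / (54 * vpar p q ^+ 2)), (54 * vpar p q); split.
- by rewrite divr_gt0// mulr_gt0// exprn_gt0.
- by rewrite mulr_gt0.
move=> n n0; cbv zeta; set mu_n := rescale _ _.
have a0 := scale_gt0 p0 q0 n0.
have up x : `|distribution_function mu_n x - distribution_function (@semicircle_law R) x|
    <= 54 * vpar p q / Num.sqrt n%:R.
  by rewrite rescale_cdf//; exact: rate_upper.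
apply/andP; split.
  apply: (rate_lower p0 q0 pq1 mu_p mu_q n0) => x; rewrite -rescale_cdf//.
  (* The upper bound also shows that the set is bounded, without which [sup] would not dominate its
     elements. *)
  apply: ub_le_sup; last by exists x.
  by exists (54 * vpar p q / Num.sqrt n%:R) => _ [y _ <-].
apply: ge_sup; first by exists `|distribution_function mu_n 0
  - distribution_function (@semicircle_law R) 0|; exists 0.
by move=> _ [y _ <-].
Qed.
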